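(* Let $d\ge1$, $p>0$, and let $\mu\in\mathcal{P}(\mathbb{R}^d)$ satisfy $E:=\int_{\mathbb{R}^d}e^{a|y|^\beta}\,d\mu(y)<\infty$ for some $a,\beta>0$. Then there are constants $c,C>0$ depending only on $d,p,a,\beta,E$ such that the following hold. (a) If $\beta\ge p$, then for all $N\in\mathbb{N}$ and $x>0$, $$\mathbb{P}(\mathcal{T}_p(\mu,\mu_N)>x)\le C\Big(e^{-cN\varphi(x)}\mathbf{1}_{\{x\le1\}}+e^{-cNx^{\beta/p}}\mathbf{1}_{\{x\ge1\}}\Big).$$ (b) If $\beta\in(0,p)$, then for all $N\in\mathbb{N}$ and $x>0$, $$\mathbb{P}(\mathcal{T}_p(\mu,\mu_N)>x)\le C\Big(e^{-cN\varphi(x)}\mathbf{1}_{\{x\le1\}}+e^{-c(Nx)^{\beta/p}}\Big).$$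
   Context: $\mathbb{N}=\{0,1,2,\dots\}$. $\mathcal{P}(\mathbb{R}^d)$ is the set of Borel probability measures on $\mathbb{R}^d$; $|\cdot|$ is the Euclidean norm. $X_1,X_2,\dots$ are i.i.d. with law $\mu$ on a probability space $(\Omega,\mathbb{P})$; $\mu_N=\frac1N\sum_{i=1}^N\delta_{X_i}$ for $N\ge1$ and $\mu_0:=\delta_0$. $\mathcal{T}_p(\mu,\nu):=\inf_{\pi\in\mathrm{Cpl}(\mu,\nu)}\int_{\mathbb{R}^d\times\mathbb{R}^d}|x-y|^p\,d\pi(x,y)$, where $\mathrm{Cpl}(\mu,\nu)$ is the set of couplings of $\mu$ and $\nu$. Rate function (depending on $d,p$): $\varphi(x)=x^2$ if $p>d/2$; $\varphi(x)=(x/\log(2+1/x))^2$ if $p=d/2$; $\varphi(x)=x^{d/p}$ if $p\in(0,d/2)$. *)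

(* Defs.v *)
From HB Require Import structures.
From mathcomp Require Import all_boot all_order all_algebra finmap.
From mathcomp Require Import all_classical all_reals all_analysis.

Set Implicit Arguments.
Unset Strict Implicit.
Unset Printing Implicit Defensive.

Import Order.TTheory GRing.Theory Num.Theory.
Import numFieldTopology.Exports numFieldNormedType.Exports.

Local Open Scope classical_set_scope.
Local Open Scope ring_scope.

(* R^d with its Borel sigma-algebra.  The topology of 'rV[R]_d comes from the
   max norm, hence coincides with the Euclidean one. *)
Definition Rd (R : realType) (d : nat) : measurableType _ :=
  g_sigma_algebraType (@open 'rV[R]_d).

(* The library norm on matrices is the max norm. *)
Definition enorm (R : realType) (d : nat) (x : 'rV[R]_d) : R :=
  Num.sqrt (\sum_(i < d) x ord0 i ^+ 2).

Section coupling.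
Context (disp : measure_display) (T : measurableType disp) (R : realType).

(* Marginals are compared on measurable sets only: a measure of the library is
   a function on all sets, without meaning on nonmeasurable ones. *)
Definition coupling (mu nu : probability T R) : set (probability (T * T)%type R) :=
  [set pi | forall A : set T, measurable A ->
    pi (A `*` setT) = mu A /\ pi (setT `*` A) = nu A].

End coupling.

Definition transport_cost (R : realType) (d : nat) (p : R)
    (mu nu : probability (Rd R d) R) : \bar R :=
  ereal_inf
    [set (\int[pi]_z (enorm ((z.1 : 'rV[R]_d) - (z.2 : 'rV[R]_d)) `^ p)%:E)%E
       | pi in coupling mu nu].

Section empirical.
Context (disp : measure_display) (T : measurableType disp) (R : realType).
Variables (x : nat -> T) (n : nat).

Definition uniform_dirac : set T -> \bar R :=
  mscale (n.+1%:R^-1)%:nng (msum (fun i => \d_(x i)) n.+1).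

HB.instance Definition _ := Measure.on uniform_dirac.

Let uniform_dirac_setT : uniform_dirac setT = 1%E.
Proof.
rewrite /uniform_dirac /mscale /= /msum.
rewrite (eq_bigr (fun=> 1%E)); last by move=> i _; exact: diracT.
by rewrite sumEFin sumr_const card_ord -EFinM mulVf// pnatr_eq0.
Qed.

HB.instance Definition _ :=
  Measure_isProbability.Build _ _ _ uniform_dirac uniform_dirac_setT.

End empirical.

(* The empirical measure of the first N terms x 0, ..., x N.-1 of a sequence,
   with the convention that it is the Dirac mass at 0 for N = 0. *)
Definition empirical (R : realType) (d : nat) (x : nat -> Rd R d) (N : nat) :
    probability (Rd R d) R :=
  if N is n.+1 then uniform_dirac R x n else \d_((0 : 'rV[R]_d) : Rd R d).

Section iid.
Context (disp disp' : measure_display) (Omega : measurableType disp)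
  (T : measurableType disp') (R : realType) (P : probability Omega R).

Definition mutually_independent (X : nat -> {RV P >-> T}) : Prop :=
  forall (I : {fset nat}) (A : nat -> set T),
    (forall i, measurable (A i)) ->
    P (\bigcap_(i in [set` I]) (X i @^-1` A i)) =
    (\prod_(i <- I) P (X i @^-1` A i))%E.

Definition iid (X : nat -> {RV P >-> T}) (mu : probability T R) : Prop :=
  mutually_independent X /\
  forall i (A : set T), measurable A -> distribution P (X i) A = mu A.

End iid.

Definition rate (R : realType) (d : nat) (p x : R) : R :=
  if d%:R / 2 < p then x ^+ 2
  else if p == d%:R / 2 then (x / ln (2 + x^-1)) ^+ 2
  else x `^ (d%:R / p).

(* Main.v *)
(* Cut R^d into the dyadic shells 2^(n-1) < |y| <= 2^n and each shell into the
   cubes of side 2^n/2^l.  These cells form a laminar family, so matching mass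
   greedily, inside the smallest cells first, gives a coupling of mu and mu_N
   under which at most |mu F - mu_N F| leaves or enters each cell F.  Hence
   T_p(mu, mu_N) is at most a constant times
     sum_(n,l) (2^n/2^l)^p sum_F |mu F - mu_N F|
   plus truncation errors and the p-th moments of mu and mu_N outside a ball.
   Bernstein's inequality over all sign patterns, with the deviation allowed at
   scale (n,l) proportional to sqrt(rate x) 2^(-2pn) 2^(dl/2), controls the sum
   for x <= 1; the three regimes of the rate come from the geometric series in
   l.  The moment of mu_N outside the ball is a sum of i.i.d. variables with an
   exponential moment if p <= beta, and is truncated at level N x if beta < p.
   For large x the bound T_p <= 2^p (moment of mu + moment of mu_N) suffices. *)

From HB Require Import structures.
Require Import Defs.
From mathcomp Require Import all_boot all_order all_algebra finmap.
From mathcomp Require Import all_classical all_reals all_analysis.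
From mathcomp Require Import measurable_realfun ring lra zify.

Set Implicit Arguments.
Unset Strict Implicit.
Unset Printing Implicit Defensive.

Import Order.TTheory GRing.Theory Num.Theory.
Import numFieldTopology.Exports numFieldNormedType.Exports.

Local Open Scope classical_set_scope.
Local Open Scope ring_scope.

(** * Laminar couplings *)

Section laminar_matching.
Context (R : realFieldType) (I : finType).
Implicit Types (p q : I -> R) (m : I -> I -> R) (F G : {set I}).

Lemma mulr_div_maxr (a b : R) : 0 <= a -> 0 <= b ->
  a * b / Num.max a b = Num.min a b.
Proof.
move=> a0 b0; case: (leP a b) => ab.
  have [b00|bn0] := eqVneq b 0; last by rewrite mulfK.
  by rewrite b00 mulr0 mul0r; apply/eqP; rewrite eq_le a0 -b00 ab.
by rewrite mulrAC mulfV ?mul1r // gt_eqF // (le_lt_trans b0).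
Qed.

(* Greedy matching, innermost sets first: inside each set, as much of the
   unmatched mass as possible is matched.  The lower bound obtained for a set
   survives all later steps since the matching only increases. *)
Lemma laminar_matching p q (s : seq {set I}) :
  (forall i, 0 <= p i) -> (forall i, 0 <= q i) ->
  pairwise (fun F G => (F \subset G) || [disjoint F & G]) s ->
  exists m, [/\ forall i j, 0 <= m i j,
    forall i, \sum_j m i j <= p i, forall j, \sum_i m i j <= q j,
    forall F, F \in s -> Num.min (\sum_(i in F) p i) (\sum_(i in F) q i) <=
      \sum_(i in F) \sum_(j in F) m i j &
    forall G, all (fun F => (F \subset G) || [disjoint F & G]) s ->
      forall i j, (i \in G) != (j \in G) -> m i j = 0].
Proof.
move=> p0 q0; elim/last_ind: s => [_|s F IH].
  by exists (fun _ _ => 0); split => // i; rewrite big1.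
rewrite pairwise_rcons => /andP[sF /IH [m [m0 mp mq ms mG]]].
pose r i := if i \in F then p i - \sum_j m i j else 0.
pose t j := if j \in F then q j - \sum_i m i j else 0.
have r0 i : 0 <= r i by rewrite /r; case: ifP => // _; rewrite subr_ge0.
have t0 j : 0 <= t j by rewrite /t; case: ifP => // _; rewrite subr_ge0.
set a := \sum_i r i; set b := \sum_j t j.
have a0 : 0 <= a by exact: sumr_ge0.
have b0 : 0 <= b by exact: sumr_ge0.
have M0 : 0 <= Num.max a b by rewrite le_max a0.
have d0 i j : 0 <= r i * t j / Num.max a b by rewrite divr_ge0 ?mulr_ge0.
have div_max_le (x y : R) : 0 <= x -> 0 <= y -> y <= Num.max a b ->
    x * y / Num.max a b <= x.
  move=> x0 y0 yM; rewrite -mulrA ler_piMr//.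
  have [->|/eqP Mn0] := eqVneq (Num.max a b) 0; first by rewrite invr0 mulr0.
  by rewrite ler_pdivrMr ?mul1r// lt_neqAle eq_sym M0 andbT; apply/eqP.
have drow i : \sum_j (m i j + r i * t j / Num.max a b) =
    \sum_j m i j + r i * b / Num.max a b.
  by rewrite big_split/= -mulr_suml -mulr_sumr.
have dcol j : \sum_i (m i j + r i * t j / Num.max a b) =
    \sum_i m i j + t j * a / Num.max a b.
  by rewrite big_split/= -mulr_suml -mulr_suml (mulrC a).
exists (fun i j => m i j + r i * t j / Num.max a b); split.
- by move=> i j; rewrite addr_ge0.
- move=> i; rewrite drow.
  have H := div_max_le (r i) b (r0 i) b0.
  have {H} := H (ltac:(by rewrite le_max lexx orbT)).
  rewrite /r; case: ifP => iF H; last by rewrite !mul0r addr0.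
  by rewrite -lerBrDl.
- move=> j; rewrite dcol.
  have H := div_max_le (t j) a (t0 j) a0.
  have {H} := H (ltac:(by rewrite le_max lexx)).
  rewrite /t; case: ifP => iF H; last by rewrite !mul0r addr0.
  by rewrite -lerBrDl.
- move=> G; rewrite mem_rcons inE => /orP[/eqP ->|Gs]; last first.
    apply: le_trans (ms _ Gs) _; apply: ler_sum => i _; apply: ler_sum => j _.
    by rewrite lerDl.
  have mF := mG F sF.
  have Em : \sum_(i in F) \sum_(j in F) (m i j + r i * t j / Num.max a b) =
      \sum_(i in F) \sum_(j in F) m i j + a * b / Num.max a b.
    under eq_bigr do rewrite big_split/=.
    rewrite big_split/=; congr (_ + _).
    under eq_bigr do rewrite -mulr_suml -mulr_sumr.
    rewrite -mulr_suml -mulr_suml.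
    have -> : \sum_(i in F) r i = a.
      by rewrite big_mkcond/=; apply: eq_bigr => i _; rewrite /r; case: (i \in F).
    have -> // : \sum_(i in F) t i = b.
    by rewrite big_mkcond/=; apply: eq_bigr => i _; rewrite /t; case: (i \in F).
  have Ea : a = \sum_(i in F) p i - \sum_(i in F) \sum_(j in F) m i j.
    rewrite -sumrB big_mkcond/=; apply: eq_bigr => i _.
    rewrite /r; case: ifP => // iF; congr (_ - _).
    rewrite [RHS]big_mkcond/=; apply: eq_bigr => j _.
    by case: ifP => // jF; apply: mF; rewrite iF jF.
  have Eb : b = \sum_(i in F) q i - \sum_(i in F) \sum_(j in F) m i j.
    rewrite exchange_big/= -sumrB big_mkcond/=; apply: eq_bigr => i _.
    rewrite /t; case: ifP => // iF; congr (_ - _).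
    rewrite [RHS]big_mkcond/=; apply: eq_bigr => j _.
    by case: ifP => // jF; apply: mF; rewrite iF jF.
  rewrite Em mulr_div_maxr// Ea Eb.
  move: (\sum_(i in F) p i) (\sum_(i in F) q i) => x y.
  move: (\sum_(i in F) _) => z.
  rewrite -lerBlDl; case: (leP x y) => xy.
    by rewrite min_l// lerD2r.
  by rewrite min_r// lerD2r ltW.
- move=> G; rewrite all_rcons => /andP[FG sG] i j ij.
  rewrite (mG G)// add0r /r /t.
  case: ifP => iF; last by rewrite !mul0r.
  case: ifP => jF; last by rewrite mulr0 mul0r.
  case/orP: FG => [/fintype.subsetP FG|/disjointFr FG].
    by rewrite !FG// eqxx in ij.
  by rewrite !FG// eqxx in ij.
Qed.

Lemma laminar_coupling p q (s : seq {set I}) :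
  (forall i, 0 <= p i) -> (forall i, 0 <= q i) -> \sum_i p i = \sum_i q i ->
  {in s &, forall F G, [|| F \subset G, G \subset F | [disjoint F & G]]} ->
  exists m, [/\ forall i j, 0 <= m i j,
    forall i, \sum_j m i j = p i, forall j, \sum_i m i j = q j,
    forall F, F \in s -> \sum_(i in F) \sum_(j in ~: F) m i j <=
      `|\sum_(i in F) p i - \sum_(i in F) q i| &
    forall F, F \in s -> \sum_(i in ~: F) \sum_(j in F) m i j <=
      `|\sum_(i in F) p i - \sum_(i in F) q i|].
Proof.
move=> p0 q0 pq sL.
pose s' := sort (fun F G => #|F| <= #|G|)%N s.
have sub_or F G : F \in s -> G \in s -> (#|F| <= #|G|)%N ->
    (F \subset G) || [disjoint F & G].
  move=> Fs Gs FG; have /or3P[->//|GF|->] := sL _ _ Fs Gs; last by rewrite orbT.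
  have /eqP -> : G == F by rewrite eqEcard GF.
  by rewrite fintype.subxx.
have s'P : pairwise (fun F G => (F \subset G) || [disjoint F & G])
    (rcons s' [set: I]%SET).
  rewrite pairwise_rcons; apply/andP; split.
    by apply/allP => F _; rewrite finset.subsetT.
  have : pairwise (fun F G : {set I} => #|F| <= #|G|)%N s'.
    rewrite -sorted_pairwise; last by move=> ? ? ?; apply: leq_trans.
    by apply: sort_sorted => F G; apply: leq_total.
  apply: (@sub_in_pairwise _ (mem s)); last by apply/allP => F; rewrite mem_sort.
  by move=> F G Fs Gs; apply: sub_or.
have [m [m0 mp mq ms _]] := laminar_matching p0 q0 s'P.
have tot : \sum_i p i <= \sum_i \sum_j m i j.
  have sumT (f : I -> R) : \sum_(i in [set: I]%SET) f i = \sum_i f i.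
    by apply: eq_bigl => i; rewrite inE.
  have := ms [set: I]%SET; rewrite mem_rcons inE eqxx => /(_ isT).
  by rewrite !sumT pq minxx (eq_bigr _ (fun i _ => sumT (m i))).
have rowE i : \sum_j m i j = p i.
  apply/eqP; rewrite eq_le mp/=.
  have := ler_sum (P := predC1 i) (index_enum I) (fun k _ => mp k).
  by move: tot; rewrite (bigD1 i)//= [X in _ <= X](bigD1 i)//=; lra.
have colE j : \sum_i m i j = q j.
  apply/eqP; rewrite eq_le mq/=.
  have := ler_sum (P := predC1 j) (index_enum I) (fun k _ => mq k).
  by move: tot; rewrite pq exchange_big/= (bigD1 j)//= [X in _ <= X](bigD1 j)//=; lra.
have cut F (g : I -> R) : \sum_i g i = \sum_(i in F) g i + \sum_(i in ~: F) g i.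
  rewrite (bigID (mem F))/=; congr (_ + _); apply: eq_bigl => i.
  by rewrite !inE.
have min_cut (x y z : R) : Num.min (x + y) z <= x -> y <= `|x + y - z|.
  have := ler_norm (x + y - z); have := normr_ge0 (x + y - z).
  by case: (leP (x + y) z) => xyz; lra.
exists m; split=> // F Fs.
  have := ms F; rewrite mem_rcons inE mem_sort Fs orbT => /(_ isT).
  have -> : \sum_(i in F) p i = \sum_(i in F) \sum_(j in F) m i j +
     \sum_(i in F) \sum_(j in ~: F) m i j.
    by rewrite -big_split/=; apply: eq_bigr => i _; rewrite -rowE (cut F).
  exact: min_cut.
have := ms F; rewrite mem_rcons inE mem_sort Fs orbT => /(_ isT).
have -> : \sum_(i in F) q i = \sum_(i in F) \sum_(j in F) m i j +
   \sum_(i in ~: F) \sum_(j in F) m i j.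
  rewrite exchange_big/= [X in _ + X]exchange_big/= -big_split/=.
  by apply: eq_bigr => i _; rewrite -colE (cut F).
by rewrite distrC minC; exact: min_cut.
Qed.

End laminar_matching.

Section mixture.
Local Open Scope ereal_scope.
Context d (T : measurableType d) (R : realType).
Variables (n : nat) (c : nat -> {nonneg R}) (m : nat -> {measure set T -> \bar R}).
Hypothesis mass1 : \sum_(k < n) (c k)%:num%:E * m k [set: T] = 1.

Definition mixture (_ : \sum_(k < n) (c k)%:num%:E * m k [set: T] = 1) : set T -> \bar R :=
  msum (fun k => mscale (c k) (m k)) n.

HB.instance Definition _ := Measure.on (mixture mass1).

Let mixture_setT : mixture mass1 setT = 1.
Proof. by rewrite -mass1. Qed.

HB.instance Definition _ :=
  Measure_isProbability.Build _ _ _ (mixture mass1) mixture_setT.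

Lemma exists_mixture : exists pi : probability T R,
  (forall A, pi A = \sum_(k < n) (c k)%:num%:E * m k A) /\
  (forall f : T -> \bar R, measurable_fun setT f -> (forall x, 0 <= f x) ->
    \int[pi]_x f x = \sum_(k < n) (c k)%:num%:E * \int[m k]_x f x).
Proof.
exists (mixture mass1); split => // f mf f0.
rewrite /mixture ge0_integral_measure_sum//; apply: eq_bigr => k _.
by rewrite ge0_integral_mscale.
Qed.

End mixture.

Section measure_laminar_coupling.
Context d (T : measurableType d) (R : realType).

Lemma measure_fibers (I : finType) (m : probability T R) (f : T -> I) :
  (forall i, measurable (f @^-1` [set i])) ->
  forall A, measurable A -> (m A = \sum_i m (A `&` f @^-1` [set i]))%E.
Proof.
move=> mf A mA.
have {1}-> : A = \bigcup_(i in [set: I]) (A `&` f @^-1` [set i]).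
  by rewrite -setI_bigcupr; apply/seteqP; split=> [x Ax|x []//]; split => //; exists (f x).
rewrite measure_fin_bigcup//.
- rewrite (fsbigE (index_enum I))//.
  + by apply: eq_bigl => i; rewrite in_setT.
  + exact: index_enum_uniq.
  + by move=> i /=; rewrite mem_index_enum.
- exact: finite_finset.
- apply/classical_sets.trivIsetP => i j _ _ /eqP ij; apply/seteqP; split => // x [[_ fi] [_ fj]]; by apply: ij; rewrite -[i]fi -[j]fj.
- by move=> i _; exact: measurableI.
Qed.

Variables (mu nu : probability T R).

(* Any coupling of the discrete laws of [f] lifts to a coupling of [mu] and
   [nu]: spread the mass of each pair of fibers as a product measure. *)
Lemma lift_coupling (I : finType) (f : T -> I) (m : I -> I -> R) :
  (forall i, measurable (f @^-1` [set i])) -> (forall i j, 0 <= m i j) ->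
  (forall i, (\sum_j m i j)%:E = mu (f @^-1` [set i])) ->
  (forall j, (\sum_i m i j)%:E = nu (f @^-1` [set j])) ->
  exists2 pi : probability (T * T)%type R, coupling mu nu pi &
    forall F G : {set I}, pi ((f @^-1` [set` F]) `*` (f @^-1` [set` G])) =
       (\sum_(i in F) \sum_(j in G) m i j)%:E.
Proof.
move=> mf m0 mrow mcol.
pose K i := f @^-1` [set i].
pose p i := \sum_j m i j; pose q j := \sum_i m i j.
have p0 i : 0 <= p i by apply: sumr_ge0.
have q0 i : 0 <= q i by apply: sumr_ge0.
have mp i j : m i j <= p i by rewrite /p (bigD1 j)//= lerDl sumr_ge0.
have mq i j : m i j <= q j by rewrite /q (bigD1 i)//= lerDl sumr_ge0.
have cancel i j : m i j / (p i * q j) * (p i * q j) = m i j.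
  have [e|ne] := eqVneq (p i * q j) 0; last by rewrite mulfVK.
  rewrite e mulr0; apply/esym/eqP; rewrite eq_le m0 andbT.
  by move/eqP: e; rewrite mulf_eq0 => /orP[/eqP <-|/eqP <-]; [exact: mp|exact: mq].
have mKK i j : measurable (K i `*` K j) by apply: measurableX; exact: mf.
pose E := enum {: I * I}; pose e0 := (f point, f point).
pose w (ij : I * I) : {nonneg R} := NngNum (divr_ge0 (m0 ij.1 ij.2) (mulr_ge0 (p0 ij.1) (q0 ij.2))).
pose M (ij : I * I) : {measure set (T * T)%type -> \bar R} :=
  mrestr (mu \x nu)%E (mKK ij.1 ij.2).
have sumE (g : I * I -> \bar R) : (\sum_(k < size E) g (nth e0 E k) = \sum_ij g ij)%E.
  by rewrite -(big_mkord xpredT (fun k => g (nth e0 E k))) -(big_nth e0 xpredT g) big_enum.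
have MX i j A B : measurable A -> measurable B ->
    (M (i, j) (A `*` B) = mu (A `&` K i) * nu (B `&` K j))%E.
  move=> mA mB; rewrite /M /= /mrestr -setXI product_measure1E//; apply: measurableI => //; exact: mf.
have tot (A B : set T) : measurable A -> measurable B ->
    (\sum_(k < size E) (w (nth e0 E k))%:num%:E * M (nth e0 E k) (A `*` B) =
     \sum_i \sum_j (m i j / (p i * q j))%:E * (mu (A `&` K i) * nu (B `&` K j)))%E.
  move=> mA mB; rewrite (sumE (fun ij => (w ij)%:num%:E * M ij (A `*` B))%E).
  by rewrite pair_big/=; apply: eq_bigr => -[i j] _; rewrite MX.
have totF (F G : {set I}) :
    (\sum_(k < size E) (w (nth e0 E k))%:num%:E * M (nth e0 E k)
       ((f @^-1` [set` F]) `*` (f @^-1` [set` G])) =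
     (\sum_(i in F) \sum_(j in G) m i j)%:E)%E.
  have mS (H : {set I}) : measurable (f @^-1` [set` H]).
    have -> : f @^-1` [set` H] = \bigcup_(i in [set` H]) K i.
      apply/seteqP; split => [x fx|x [i iH fx]]; first by exists (f x).
      by move: iH; rewrite -[i]fx.
    by apply: fin_bigcup_measurable => // i _; exact: mf.
  rewrite tot//.
  have cap (H : {set I}) i : (f @^-1` [set` H]) `&` K i = if i \in H then K i else set0.
    case: ifP => iH; apply/seteqP; split => x //=.
    - by case.
    - by move=> Kx; split => //; rewrite [f x]Kx.
    - by case=> + Kx; rewrite [f x]Kx iH.
  rewrite [X in _ = X%:E]big_mkcond/= -sumEFin; apply: eq_bigr => i _.
  rewrite cap; case: ifP => iF; last first.
    by rewrite big1// => j _; rewrite measure0 mul0e mule0.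
  rewrite [X in _ = X%:E]big_mkcond/= -sumEFin; apply: eq_bigr => j _.
  rewrite cap; case: ifP => jG; last by rewrite measure0 !mule0.
  by rewrite -mrow -mcol -!EFinM -/(p i) -/(q j) cancel.
have mass1 : (\sum_(k < size E) (w (nth e0 E k))%:num%:E * M (nth e0 E k) setT = 1)%E.
  have := totF [set: I]%SET [set: I]%SET.
  have -> : f @^-1` [set` [set: I]%SET] = setT by apply/seteqP; split => x //= _; rewrite inE.
  rewrite setXTT => ->; rewrite -(@probability_setT _ _ _ mu).
  rewrite (measure_fibers mu mf measurableT) -sumEFin; apply: eq_big => [i|i _]; first by rewrite inE.
  rewrite setTI; apply: etrans (mrow i).
  by congr EFin; apply: eq_bigl => j; rewrite inE.
have [pi [piE _]] := @exists_mixture _ _ _ _ (fun k => w (nth e0 E k)) (fun k => M (nth e0 E k)) mass1.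
exists pi; last by move=> F G; rewrite piE totF.
move=> A mA; split.
  rewrite piE tot// (measure_fibers mu mf mA); apply: eq_bigr => i _.
  have mAK : measurable (A `&` K i) by apply: measurableI => //; exact: mf.
  under eq_bigr do rewrite setTI -mcol.
  have [a aE] : exists a, mu (A `&` K i) = a%:E.
    by exists (fine (mu (A `&` K i))); rewrite fineK//; exact: fin_num_measure.
  have a0 : 0 <= a by rewrite -lee_fin -aE.
  have ap : a <= p i.
    rewrite -lee_fin -aE mrow; apply: le_measure; rewrite ?inE//; exact: mf.
  rewrite -/(K i) aE; under eq_bigr do rewrite -!EFinM; rewrite sumEFin; congr EFin.
  have [pi0|pin0] := eqVneq (p i) 0.
    have -> : a = 0 by apply/eqP; rewrite eq_le a0 -pi0 ap.
    by rewrite big1// => j _; rewrite mul0r mulr0.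
  rewrite (eq_bigr (fun j => m i j * (a / p i))); last first.
    move=> j _; have [qj0|qjn0] := eqVneq (q j) 0; last by rewrite -/(q j); field; rewrite ?pin0 ?qjn0.
    have -> : m i j = 0 by apply/eqP; rewrite eq_le m0 -qj0 mq.
    by rewrite !mul0r.
  by rewrite -mulr_suml -/(p i) mulrC divfK.
rewrite piE tot// (measure_fibers nu mf mA) exchange_big/=; apply: eq_bigr => j _.
have mAK : measurable (A `&` K j) by apply: measurableI => //; exact: mf.
under eq_bigr do rewrite setTI -mrow.
have [a aE] : exists a, nu (A `&` K j) = a%:E.
  by exists (fine (nu (A `&` K j))); rewrite fineK//; exact: fin_num_measure.
have a0 : 0 <= a by rewrite -lee_fin -aE.
have aq : a <= q j.
  rewrite -lee_fin -aE mcol; apply: le_measure; rewrite ?inE//; exact: mf.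
rewrite -/(K j) aE; under eq_bigr do rewrite -!EFinM; rewrite sumEFin; congr EFin.
have [qj0|qjn0] := eqVneq (q j) 0.
  have -> : a = 0 by apply/eqP; rewrite eq_le a0 -qj0 aq.
  by rewrite big1// => i _; rewrite !mulr0.
rewrite (eq_bigr (fun i => m i j * (a / q j))); last first.
  move=> i _; have [pi0|pin0] := eqVneq (p i) 0; last by rewrite -/(p i); field; rewrite ?pin0 ?qjn0.
  have -> : m i j = 0 by apply/eqP; rewrite eq_le m0 -pi0 mp.
  by rewrite !mul0r.
by rewrite -mulr_suml -/(q j) mulrC divfK.
Qed.

Lemma measure_laminar_coupling (J : finType) (F : J -> set T) :
  (forall j, measurable (F j)) ->
  (forall j k, [\/ F j `<=` F k, F k `<=` F j | F j `&` F k = set0]) ->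
  exists2 pi : probability (T * T)%type R, coupling mu nu pi & forall j,
    (pi (F j `*` ~` F j) <= `|fine (mu (F j)) - fine (nu (F j))|%:E)%E /\
    (pi (~` F j `*` F j) <= `|fine (mu (F j)) - fine (nu (F j))|%:E)%E.
Proof.
move=> mF lamF.
pose f x : {set J} := [set j | `[< F j x >]]%SET.
have fE j x : (j \in f x) = `[< F j x >] by rewrite inE.
have mf i : measurable (f @^-1` [set i]).
  have -> : f @^-1` [set i] = \bigcap_(j in [set: J]) (if j \in i then F j else ~` F j).
    apply/seteqP; split=> [x <- j _|x H].
      by rewrite fE; case: asboolP.
    apply/setP => j; rewrite fE; have := H j Logic.I.
    by case: ifP => _; case: asboolP.
  apply: fin_bigcap_measurable; first exact: finite_finset.
  by move=> j _; case: ifP => // _; exact: measurableC.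
pose G j : {set {set J}} := [set i : {set J} | (j \in i) && `[< exists x, f x = i >]]%SET.
have FG j : F j = f @^-1` [set` G j].
  apply/seteqP; split => x /=; rewrite inE fE; first by move=> ?; apply/andP; split; apply/asboolP => //; exists x.
  by move=> /andP[/asboolP].
have FCG j : ~` F j = f @^-1` [set` (~: G j)%SET].
  by rewrite FG; apply/seteqP; split => x /=; rewrite finset.in_setC => /negP.
have fin (m : probability T R) A : measurable A -> m A = (fine (m A))%:E.
  by move=> mA; rewrite fineK//; exact: fin_num_measure.
have sumG (m : probability T R) (H : {set {set J}}) :
    fine (m (f @^-1` [set` H])) = \sum_(i in H) fine (m (f @^-1` [set i])).
  have mH : measurable (f @^-1` [set` H]).
    have -> : f @^-1` [set` H] = \bigcup_(i in [set` H]) f @^-1` [set i].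
      apply/seteqP; split => [x fx|x [i iH fx]]; first by exists (f x).
      by move: iH; rewrite -[i]fx.
    by apply: fin_bigcup_measurable => //; exact: finite_finset.
  apply: EFin_inj; rewrite -fin// (measure_fibers m mf mH) [X in _ = X%:E]big_mkcond/= -sumEFin.
  apply: eq_bigr => i _; case: ifP => iH.
    rewrite -fin//; congr (m _); apply/seteqP; split => x /=; first by case.
    by move=> fx; split => //; rewrite fx.
  rewrite (_ : _ `&` _ = set0) ?measure0//; apply/seteqP; split => x //= -[+ fx].
  by rewrite fx iH.
have sum1 (m : probability T R) : \sum_i fine (m (f @^-1` [set i])) = 1.
  have := sumG m [set: {set J}]%SET.
  rewrite (_ : f @^-1` _ = setT); last by apply/seteqP; split => x //= _; rewrite inE.
  by rewrite probability_setT/= => ->; apply: eq_bigl => i; rewrite inE.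
have Gsub j k : F j `<=` F k -> G j \subset G k.
  move=> jk; apply/fintype.subsetP => i; rewrite !inE => /andP[ji /asboolP[x fx]].
  rewrite -fx fE; apply/andP; split; last by apply/asboolP; exists x.
  by apply/asboolP/jk/asboolP; rewrite -fE fx.
have lam : {in [seq G j | j <- index_enum J] &, forall H H' : {set {set J}},
    [|| H \subset H', H' \subset H | [disjoint H & H']]}.
  move=> _ _ /mapP[j _ ->] /mapP[k _ ->].
  have [/Gsub ->//|/Gsub ->|jk0] := lamF j k; first by rewrite orbT.
  apply/orP; right; apply/orP; right; apply/pred0P => i /=; apply/negP.
  rewrite !inE => /andP[/andP[ji /asboolP[x fx]] /andP[ki _]].
  have : (F j `&` F k) x by split; apply/asboolP; rewrite -fE fx.
  by rewrite jk0.
have [m [m0 mrow mcol mG1 mG2]] := @laminar_coupling R _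
  (fun i => fine (mu (f @^-1` [set i]))) (fun i => fine (nu (f @^-1` [set i])))
  [seq G j | j <- index_enum J] (fun i => fine_ge0 (measure_ge0 _ _))
  (fun i => fine_ge0 (measure_ge0 _ _))
  (etrans (sum1 mu) (esym (sum1 nu)))
  lam.
have [||pi cpi piE] := @lift_coupling _ f m mf m0.
- by move=> i; rewrite mrow -fin.
- by move=> i; rewrite mcol -fin.
exists pi => // j.
have jG : G j \in [seq G j | j <- index_enum J] by apply: map_f; rewrite mem_index_enum.
rewrite FCG (FG j) !piE !lee_fin !sumG.
split; [exact: mG1|exact: mG2].
Qed.

End measure_laminar_coupling.

(** * Chernoff and Bernstein bounds for i.i.d. samples *)

Section iid_integral.
Context d d' (Omega : measurableType d) (T : measurableType d') (R : realType).
Variables (P : probability Omega R) (mu : probability T R).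

Import HBNNSimple.

Lemma measurable_indic_comp (Y : Omega -> T) A : measurable_fun setT Y ->
  measurable A -> measurable_fun setT (fun w => \1_A (Y w) : R).
Proof.
by move=> mY mA; apply: (measurableT_comp _ mY); exact: measurable_indic.
Qed.

Lemma le_integral_of_indic (Y : Omega -> T) (h : Omega -> R) (c : R) :
  measurable_fun setT Y -> measurable_fun setT h -> (forall w, 0 <= h w) ->
  (forall A, measurable A ->
    \int[P]_w (h w * \1_A (Y w))%:E <= c%:E * mu A)%E ->
  forall f : T -> R, measurable_fun setT f -> (forall y, 0 <= f y) -> 0 <= c ->
  (\int[P]_w (h w * f (Y w))%:E <= c%:E * \int[mu]_y (f y)%:E)%E.
Proof.
move=> mY mh h0 hA f mf f0 c0.
have simple (g : {nnsfun T >-> R}) :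
    (\int[P]_w (h w * g (Y w))%:E <= c%:E * \int[mu]_y (g y)%:E)%E.
  have fin : finite_set (range g) by [].
  have mg1 y : measurable_fun setT (fun w => (h w * (y * \1_(g @^-1` [set y]) (Y w)))%:E).
    apply/measurable_EFinP; apply: measurable_funM => //; apply: measurable_funM => //.
    exact: measurable_indic_comp.
  have ge0 y w : 0 <= y * \1_(g @^-1` [set y]) (Y w).
    by rewrite indicE; case: (boolP (_ \in _)); rewrite ?mulr0// inE/= => <-; rewrite mulr1.
  rewrite [X in (X <= _)%E](_ : _ = \sum_(y \in range g)
      \int[P]_w (h w * (y * \1_(g @^-1` [set y]) (Y w)))%:E)%E; last first.
    rewrite -ge0_integral_fsum//; last first.
      by move=> y w _; rewrite lee_fin mulr_ge0.
    apply: eq_integral => w _.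
    by rewrite fsbig_finite//= sumEFin -mulr_sumr {1}fimfunE fsbig_finite.
  rewrite integralT_nnsfun sintegralE ge0_mule_fsumr; last first.
    by move=> y; exact: nnsfun_mulemu_ge0.
  apply: lee_fsum => // y [z _ <-].
  under eq_integral do rewrite mulrCA EFinM.
  rewrite ge0_integralZl_EFin//; last 2 first.
  - by move=> w _; rewrite lee_fin mulr_ge0.
  - apply/measurable_EFinP; apply: measurable_funM => //.
    exact: measurable_indic_comp.
  rewrite muleCA; apply: lee_wpmul2l; first by rewrite lee_fin.
  exact: hA.
have mg : measurable_fun setT (EFin \o f) by exact/measurable_EFinP.
pose g := nnsfun_approx measurableT mg.
have gf y : EFin \o g^~ y @ \oo --> (f y)%:E.
  by apply: cvg_nnsfun_approx => // z _ /=; rewrite lee_fin.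
have gnd := nd_nnsfun_approx measurableT mg.
have gle n y : g n y <= f y.
  have := @le_approx _ T R setT (EFin \o f) n y.
  rewrite -(nnsfun_approxE measurableT mg) /= lee_fin; apply => // z _.
  by rewrite lee_fin.
have := @cvg_monotone_convergence _ _ _ P setT measurableT
  (fun n w => (h w * g n (Y w))%:E) _ _ _.
have mhg n : measurable_fun setT (fun w => (h w * g n (Y w))%:E).
  by apply/measurable_EFinP; apply: measurable_funM => //; apply: measurableT_comp.
move=> /(_ mhg) H.
have {}H := H (fun n w _ => ltac:(rewrite lee_fin; exact: (mulr_ge0 (h0 w) (fun_ge0 _)))).
have cv : (\int[P]_w (h w * g n (Y w))%:E)%E @[n --> \oo] -->
    (\int[P]_w (h w * f (Y w))%:E)%E.
  have -> : (\int[P]_w (h w * f (Y w))%:E = \int[P]_w limn (fun n => (h w * g n (Y w))%:E))%E.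
    apply: eq_integral => w _; apply/esym/cvg_lim => //.
    rewrite EFinM (_ : (fun n => _) = (fun n => (h w)%:E * (EFin \o g^~ (Y w)) n)%E).
      by apply: cvgeZl => //; exact: gf.
    by apply/funext => n /=; rewrite EFinM.
  apply: H => w _ i j ij; rewrite lee_fin ler_wpM2l//.
  by have /lefP := gnd _ _ ij.
rewrite -(cvg_lim _ cv)//; apply: lime_le; first by apply/cvg_ex; eexists; exact: cv.
apply: nearW => n; apply: le_trans (simple (g n)) _.
apply: lee_wpmul2l; first by rewrite lee_fin.
by apply: ge0_le_integral => //; do ?[by move=> y _; rewrite lee_fin | exact/measurable_EFinP].
Qed.

Lemma iid_prod_integral (X : nat -> {RV P >-> T}) (f : T -> R) (B : R) N :
  iid X mu -> measurable_fun setT f -> (forall y, 0 <= f y) ->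
  (\int[mu]_y (f y)%:E <= B%:E)%E ->
  (\int[P]_w (\prod_(i < N) f (X i w))%:E <= (B ^+ N)%:E)%E.
Proof.
move=> [indX idX] mf f0 fB.
have B0 : 0 <= B by rewrite -lee_fin; apply: le_trans fB; apply: integral_ge0 => y _; rewrite lee_fin.
have mX i : measurable_fun setT (X i) by exact: measurable_funPT.
pose m A := fine (mu A).
have mE A : measurable A -> mu A = (m A)%:E by move=> mA; rewrite fineK//; exact: fin_num_measure.
have mprod k (A : nat -> set T) : (forall i, measurable (A i)) ->
  measurable_fun setT (fun w => \prod_(i < k) f (X i w)).
  by move=> mA; apply: measurable_prod => i _; exact: measurableT_comp.
have mind k n (A : nat -> set T) : (forall i, measurable (A i)) ->
  measurable_fun setT (fun w => \prod_(k <= j < n) (\1_(A j) (X j w) : R)).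
  move=> mA; apply: measurable_prod => i _.
  exact: measurable_indic_comp.
have claim k : (k <= N)%N -> forall A : nat -> set T, (forall i, measurable (A i)) ->
   (\int[P]_w (\prod_(i < k) f (X i w) * \prod_(k <= j < N) (\1_(A j) (X j w)))%:E <=
    (B ^+ k * \prod_(k <= j < N) m (A j))%:E)%E.
  elim: k => [_ A mA|k IH kN A mA].
    have := indX [fset i | i in iota 0 N]%fset A mA.
    set I := [fset _ | _ in _]%fset => indI.
    pose C := \bigcap_(i in [set` I]) X i @^-1` A i.
    have memI j : (j \in I) = (j < N)%N by rewrite !inE mem_iota.
    have mC : measurable C.
      apply: fin_bigcap_measurable => // i _.
      by rewrite -[_ @^-1` _]setTI; exact: mX.
    rewrite (eq_integral (fun w => (\1_C w)%:E)); last first.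
      move=> w _; rewrite big_ord0 mul1r indicE; congr EFin.
      case: (boolP (w \in C)) => wC.
        rewrite big_nat big1// => j jN; rewrite indicE mem_set//.
        by move: wC; rewrite inE => /(_ j); apply; rewrite /= memI.
      apply/eqP; rewrite prodf_seq_eq0; apply: contraR wC => /hasPn H.
      rewrite inE => j /=; rewrite memI => jN.
      have := H j; rewrite mem_index_iota jN /= indicE => /(_ isT).
      by case: (boolP (_ \in _)); rewrite ?inE//= eqxx.
    rewrite integral_indic// setIT expr0 mul1r.
    rewrite [X in (X <= _)%E](_ : _ = \prod_(i <- I) P (X i @^-1` A i))%E; last exact: indI.
    rewrite (perm_big (iota 0 N)) /=; last first.
      by apply: uniq_perm; rewrite ?iota_uniq ?fset_uniq// => j; rewrite memI mem_iota.
    rewrite (eq_bigr (fun i => (m (A i))%:E)); last first.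
      by move=> i _; rewrite -mE// -(idX i).
    rewrite (big_morph EFin (id1 := 1%E) (op1 := mule)) //.
    by rewrite /index_iota subn0.
  pose h w := \prod_(i < k) f (X i w) * \prod_(k.+1 <= j < N) (\1_(A j) (X j w) : R).
  pose c := B ^+ k * \prod_(k.+1 <= j < N) m (A j).
  have c0 : 0 <= c by rewrite mulr_ge0 ?exprn_ge0//; apply: prodr_ge0 => j _; exact: fine_ge0.
  have := @le_integral_of_indic (X k) h c (mX k) _ _ _ f mf f0 c0.
  have mh : measurable_fun setT h by apply: measurable_funM; [exact: mprod|exact: mind].
  have h0 w : 0 <= h w by rewrite mulr_ge0//; apply: prodr_ge0.
  move=> /(_ mh h0) H.
  rewrite [X in (X <= _)%E](_ : _ = \int[P]_w (h w * f (X k w))%:E)%E; last first.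
    apply: eq_integral => w _; rewrite big_ord_recr/= /h; congr EFin; ring.
  apply: (@le_trans _ _ (c%:E * \int[mu]_y (f y)%:E)%E).
    apply: H => A' mA'.
    have := IH (ltnW kN) (fun j => if j == k then A' else A j) _.
    have mA'' j : measurable (if j == k then A' else A j) by case: ifP.
    move=> /(_ mA''); rewrite mE// -EFinM.
    have big_k (F : nat -> R) : \prod_(k <= j < N) F j = F k * \prod_(k.+1 <= j < N) F j.
      by rewrite big_ltn.
    have neqk (F : nat -> set T -> R) :
        \prod_(k.+1 <= j < N) F j (if j == k then A' else A j) =
        \prod_(k.+1 <= j < N) F j (A j).
      by apply: eq_big_nat => j /andP[kj _]; rewrite gtn_eqF.
    rewrite big_k eqxx (neqk (fun _ => m)).
    set F := (X in (X <= _)%E) => HF; set G := (X in (X <= _)%E).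
    suff -> : G = F.
      apply: (le_trans HF); rewrite lee_fin /c.
      by rewrite mulrCA mulrC.
    apply: eq_integral => w _; congr EFin; rewrite /h big_k eqxx.
    by rewrite (neqk (fun j D => (\1_D (X j w) : R))); ring.
  apply: (@le_trans _ _ (c%:E * B%:E)%E); first by apply: lee_wpmul2l; rewrite ?lee_fin.
  by rewrite -EFinM lee_fin /c exprS; nra.
have := claim N (leqnn N) (fun _ => setT) (fun _ => measurableT).
by rewrite big_geq// mulr1; under eq_integral do rewrite big_geq// mulr1.
Qed.

End iid_integral.

Section measure_aux.
Context d (T : measurableType d) (R : realType).

Lemma measurable_set_ge (g : T -> R) (s : R) : measurable_fun setT g ->
  measurable [set w | s <= g w].
Proof.
move=> mg; rewrite (_ : [set _ | _] = g @^-1` `[s, +oo[).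
  by rewrite -[_ @^-1` _]setTI; exact: mg.
by apply/seteqP; split => w /=; rewrite in_itv/= andbT.
Qed.

Lemma measurable_set_gt (g : T -> R) (s : R) : measurable_fun setT g ->
  measurable [set w | s < g w].
Proof.
move=> mg; rewrite (_ : [set _ | _] = g @^-1` `]s, +oo[).
  by rewrite -[_ @^-1` _]setTI; exact: mg.
by apply/seteqP; split => w /=; rewrite in_itv/= andbT.
Qed.

Lemma measure_fin_union_bound (m : {measure set T -> \bar R}) (I : finType)
    (A : set T) (B : I -> set T) : measurable A -> (forall i, measurable (B i)) ->
  A `<=` \bigcup_i B i -> (m A <= \sum_i m (B i))%E.
Proof.
move=> mA mB AB.
have := @content_sub_fsum _ _ _ m I [set: I] A B finite_finset (fun i _ => mB i) mA AB.
rewrite (fsbigE (index_enum I))//; last by move=> i _ /=; rewrite mem_index_enum.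
  by move=> H; apply: le_trans H _; rewrite le_eqVlt; apply/orP; left; apply/eqP;
    apply: eq_bigl => i; rewrite in_setT.
exact: index_enum_uniq.
Qed.

End measure_aux.

Lemma expR_le_quad (R : realType) (u : R) : u <= 1/2 -> expR u <= 1 + u + 2 * u ^+ 2.
Proof.
move=> u2; have H : (1 - u) * expR u <= 1.
  rewrite -[leRHS](expRxMexpNx_1 u) mulrC ler_wpM2l ?expR_ge0//; exact: expR_ge1Dx.
have : 1 <= (1 - u) * (1 + u + 2 * u ^+ 2) by nra.
move=> H2; rewrite -(ler_pM2l (x := 1 - u)); last lra.
exact: le_trans H H2.
Qed.

Lemma expR_le_exp_quad (R : realType) (u : R) : 0 <= u -> expR u <= 1 + u + u ^+ 2 * expR u.
Proof.
move=> u0; have H : (1 - u) * expR u <= 1.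
  rewrite -[leRHS](expRxMexpNx_1 u) mulrC ler_wpM2l ?expR_ge0//; exact: expR_ge1Dx.
have := expR_ge0 u; nra.
Qed.

Section chernoff.
Context d d' (Omega : measurableType d) (T : measurableType d') (R : realType).
Variables (P : probability Omega R) (mu : probability T R).
Variable X : nat -> {RV P >-> T}.
Hypothesis iidX : iid X mu.

Let mX i : measurable_fun setT (X i). Proof. exact: measurable_funPT. Qed.

Lemma measurable_sum_iid (g : T -> R) N : measurable_fun setT g ->
  measurable_fun setT (fun w => \sum_(i < N) g (X i w)).
Proof. by move=> mg; apply: measurable_sum => i; exact: measurableT_comp. Qed.

Lemma chernoff_iid (g : T -> R) (l B s : R) N : measurable_fun setT g -> 0 <= l ->
  (\int[mu]_y (expR (l * g y))%:E <= B%:E)%E ->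
  (P [set w | (s <= \sum_(i < N) g (X i w))%R] <= (expR (- (l * s)) * B ^+ N)%:E)%E.
Proof.
move=> mg l0 gB.
have mexp : measurable_fun setT (fun y => expR (l * g y)).
  by apply: measurableT_comp => //; exact: measurable_funM.
have := iid_prod_integral N iidX mexp (fun y => expR_ge0 _) gB.
set A := [set w | _] => H.
have mA : measurable A by apply: measurable_set_ge; exact: measurable_sum_iid.
have mprod : measurable_fun setT (fun w => \prod_(i < N) expR (l * g (X i w))).
  by apply: measurable_prod => i _; apply: (measurableT_comp (f := fun y => expR (l * g y))).
rewrite -[A]setIT -integral_indic//.
apply: (@le_trans _ _ (\int[P]_w ((expR (- (l * s)))%:E * (\prod_(i < N) expR (l * g (X i w)))%:E))%E).
  apply: ge0_le_integral => //.
  - by apply/measurable_EFinP; exact: measurable_indic.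
  - by apply: measurable_funeM; apply/measurable_EFinP.
  - move=> w _; rewrite -EFinM lee_fin -expR_sum -expRD -mulr_sumr -mulrN -mulrDr indicE.
    case: (boolP (w \in A)) => /= [|_]; last exact: expR_ge0.
    rewrite inE /A/= => As; rewrite -expR0 ler_expR mulr_ge0//; lra.
rewrite ge0_integralZl_EFin ?expR_ge0//.
- by rewrite EFinM; apply: lee_wpmul2l => //; rewrite lee_fin expR_ge0.
- by move=> w _; rewrite lee_fin; apply: prodr_ge0 => i _; exact: expR_ge0.
- exact/measurable_EFinP.
Qed.

Lemma mgf_indic (A : set T) (l : R) : measurable A ->
  (\int[mu]_y (expR (l * \1_A y))%:E = (1 + fine (mu A) * (expR l - 1))%:E)%E.
Proof.
move=> mA; have mCA := measurableC mA.
have fA : mu A = (fine (mu A))%:E by rewrite fineK//; exact: fin_num_measure.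
rewrite (eq_integral (fun y => (expR l)%:E * (\1_A y)%:E + (\1_(~` A) y)%:E)%E); last first.
  move=> y _; rewrite -EFinM -EFinD; congr EFin; rewrite !indicE in_setC.
  by case: (y \in A); rewrite /= ?mulr1 ?mulr0 ?expR0 ?addr0 ?add0r.
have m1 B : measurable B -> measurable_fun setT (EFin \o (\1_B : T -> R)).
  by move=> mB; apply/measurable_EFinP; exact: measurable_indic.
rewrite ge0_integralD//.
- rewrite ge0_integralZl_EFin ?expR_ge0//; last exact: m1.
  rewrite !integral_indic// !setIT.
  transitivity ((expR l)%:E * (fine (mu A))%:E + (1 - (fine (mu A))%:E))%E.
    by congr (_ * _ + _)%E; [exact: fA|rewrite -fA; exact: probability_setC].
  by rewrite -EFinM -EFinB -EFinD; congr EFin; ring.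
- by apply: measurable_funeM; exact: m1.
- exact: m1.
Qed.

Lemma bernstein_indic (A : set T) (b t c : R) N : measurable A ->
  fine (mu A) <= b -> 0 < t -> t <= 2 * b -> `|c| = 1 ->
  (P [set w | (N%:R * t <= c * \sum_(i < N) (\1_A (X i w) - fine (mu A)))%R]
    <= (expR (- (N%:R * t ^+ 2 / (8 * b))))%:E)%E.
Proof.
move=> mA Ab t0 tb c1; set a := fine (mu A).
have a0 : 0 <= a by exact: fine_ge0.
have b0 : 0 < b by lra.
have c2 : c ^+ 2 = 1 by rewrite -real_normK ?num_real// c1 expr1n.
pose l := t / (4 * b).
have l0 : 0 <= l by rewrite /l divr_ge0//; lra.
have l2 : l <= 1/2 by rewrite /l ler_pdivrMr; lra.
pose B := 1 + a * (expR (l * c) - 1).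
have lc2 : l * c <= 1 / 2.
  by apply: le_trans (ler_norm _) _; rewrite normrM c1 mulr1 ger0_norm.
have := @chernoff_iid (fun y => c * \1_A y) l B (N%:R * (t + c * a)) N _ l0.
have mcA : measurable_fun setT (fun y => c * \1_A y : R).
  by apply: measurable_funM => //; exact: measurable_indic.
move=> /(_ mcA); under eq_integral do rewrite mulrA.
rewrite mgf_indic// => /(_ (lexx _)) H.
rewrite [X in P X](_ : _ = [set w | N%:R * (t + c * a) <= \sum_(i < N) c * \1_A (X i w)]); last first.
  apply/seteqP; split => w /=; rewrite -mulr_sumr sumrB sumr_const card_ord -mulr_natl; lra.
apply: le_trans H _; rewrite lee_fin.
have BB : B <= expR (a * (l * c + 2 * l ^+ 2)).
  apply: le_trans (expR_ge1Dx _); rewrite lerD2l ler_wpM2l//.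
  have := expR_le_quad lc2; rewrite exprMn c2; lra.
have B0 : 0 <= B.
  rewrite /B; have : a <= 1 by rewrite -lee_fin fineK ?probability_le1//; exact: fin_num_measure.
  have := expR_ge0 (l * c); nra.
apply: (@le_trans _ _ (expR (- (l * (N%:R * (t + c * a)))) * expR (a * (l * c + 2 * l ^+ 2)) ^+ N)).
  by rewrite ler_wpM2l ?expR_ge0// lerXn2r// nnegrE expR_ge0.
rewrite -expRM_natl -expRD ler_expR.
have -> : - (l * (N%:R * (t + c * a))) + N%:R * (a * (l * c + 2 * l ^+ 2)) =
   - (N%:R * (l * t - 2 * a * l ^+ 2)) by ring.
rewrite lerN2 -mulrA ler_wpM2l//.
have -> : t ^+ 2 / (8 * b) = l * t - 2 * b * l ^+ 2.
  by rewrite /l; field; lra.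
by rewrite lerD2l lerN2 ler_wpM2r ?sqr_ge0// ler_wpM2l.
Qed.

(* The sum of the absolute deviations exceeds t only if the union of the [F j]
   over some subset of J deviates by t/2. *)
Lemma sum_deviation (J : finType) (F : J -> set T) (S : set T) (b t : R) N :
  (0 < N)%N ->
  (forall j, measurable (F j)) -> trivIset setT F ->
  measurable S -> (forall j, F j `<=` S) -> fine (mu S) <= b -> 0 < t -> t <= 4 * b ->
  (P [set w | (t < \sum_j `|N%:R^-1 * \sum_(i < N) \1_(F j) (X i w) - fine (mu (F j))|)%R]
    <= (2 ^+ (#|J|.+1) * expR (- (N%:R * t ^+ 2 / (32 * b))))%:E)%E.
Proof.
move=> N0 mF tF mS FS Sb t0 tb.
have NR : 0 < N%:R :> R by rewrite ltr0n.
pose U (A : {set J}) := \bigcup_(j in [set` A]) F j.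
have mU A : measurable (U A).
  by apply: fin_bigcup_measurable => //; exact: finite_finset.
have US A : U A `<=` S by apply: bigcup_sub.
have fin B : measurable B -> mu B = (fine (mu B))%:E.
  by move=> mB; rewrite fineK//; exact: fin_num_measure.
have Ub A : fine (mu (U A)) <= b.
  apply: le_trans Sb; rewrite -lee_fin -!fin//; apply: le_measure; rewrite ?inE//.
have muU A : fine (mu (U A)) = \sum_(j in A) fine (mu (F j)).
  apply: EFin_inj; rewrite -fin// /U measure_fin_bigcup//; last by apply: sub_trivIset tF.
  rewrite (fsbigE (enum A))//.
  - rewrite -big_enum -sumEFin [LHS]big_seq_cond [RHS]big_seq; apply: eq_big => j; last by move=> _; exact: fin.
    by rewrite mem_setE mem_enum andbb.
  - exact: enum_uniq.
  - by move=> j /=; rewrite mem_enum.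
  - by move=> j /= jA; rewrite mem_enum jA.
have indU A y : \1_(U A) y = \sum_(j in A) \1_(F j) y :> R.
  rewrite indicE; case: (boolP (y \in U A)) => [|yU].
    rewrite inE => -[j jA jy]; rewrite (bigD1 j)//= indicE mem_set// big1 ?addr0// => k /andP[kA kj].
    rewrite indicE memNset// => ky; move/eqP: kj; apply.
    by apply: tF => //; exists y.
  rewrite big1// => j jA; rewrite indicE memNset// => jy.
  by move/negP: yU; apply; rewrite inE; exists j.
pose sg (c : bool) : R := if c then 1 else -1.
pose E (Ac : {set J} * bool) := [set w |
  N%:R * (t / 2) <= sg Ac.2 * \sum_(i < N) (\1_(U Ac.1) (X i w) - fine (mu (U Ac.1)))].
have mind B : measurable B -> measurable_fun setT (\1_B : T -> R).
  by move=> mB; exact: measurable_indic.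
have mE Ac : measurable (E Ac).
  apply: measurable_set_ge; apply: measurable_funM => //.
  apply: (@measurable_sum_iid (fun y => \1_(U Ac.1) y - fine (mu (U Ac.1)))).
  by apply: measurable_funB => //; exact: mind.
apply: (@le_trans _ _ (\sum_Ac P (E Ac))%E).
  apply: measure_fin_union_bound => //.
    apply: measurable_set_gt; apply: measurable_sum => j.
    apply: measurableT_comp => //; apply: measurable_funB => //.
    by apply: measurable_funM => //; apply: measurable_sum_iid; exact: mind.
  move=> w /= tw.
  pose D j := N%:R^-1 * \sum_(i < N) \1_(F j) (X i w) - fine (mu (F j)).
  pose A := [set j | 0 <= D j]%SET.
  have DE (A' : {set J}) : \sum_(i < N) (\1_(U A') (X i w) - fine (mu (U A'))) =
      N%:R * \sum_(j in A') D j.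
    rewrite sumrB sumr_const card_ord muU.
    under eq_bigr do rewrite indU.
    rewrite exchange_big/= /D sumrB mulrBr -mulr_sumr mulVKf ?gt_eqF//.
    by rewrite mulr_natl.
  have : t < \sum_(j in A) D j - \sum_(j in ~: A) D j.
    apply: lt_le_trans tw _; rewrite (bigID (mem A))/=.
    rewrite (eq_bigr D); last by move=> j; rewrite inE => /ger0_norm.
    rewrite lerD2l -sumrN le_eqVlt; apply/orP; left; apply/eqP.
    apply: eq_big => j; first by rewrite finset.in_setC.
    by rewrite inE -ltNge => /ltW/ler0_norm.
  case: (lerP (t / 2) (\sum_(j in A) D j)) => [At _|At Bt].
    exists (A, true) => //; rewrite /E/= mul1r DE ler_pM2l//.
  exists (~: A, false) => //; rewrite /E/= mulN1r DE -mulrN ler_pM2l//; lra.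
apply: (@le_trans _ _ (\sum_(Ac : {set J} * bool) (expR (- (N%:R * (t / 2) ^+ 2 / (8 * b))))%:E)%E).
  apply: lee_sum => -[A c] _; apply: bernstein_indic => //; [lra|lra|].
  by rewrite /sg; case: c; rewrite ?normrN normr1.
rewrite sumEFin lee_fin sumr_const card_prod card_bool.
rewrite -[#|{: {set J}}|]cardsT -finset.powersetT card_powerset cardsT muln2 -mul2n -expnS.
rewrite -[leLHS]mulr_natl natrX le_eqVlt; apply/orP; left; apply/eqP; congr (_ * expR _).
by field; lra.
Qed.

End chernoff.

(** * Dyadic cells and the multiscale bound on the transport cost *)

Section euclidean_norm.
Context (R : realType) (d : nat).
Implicit Types x y : 'rV[R]_d.

Lemma enorm_ge0 x : 0 <= enorm x.
Proof. exact: sqrtr_ge0. Qed.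

Lemma enorm_sqr x : enorm x ^+ 2 = \sum_(i < d) x ord0 i ^+ 2.
Proof. by rewrite sqr_sqrtr//; apply: sumr_ge0 => i _; exact: sqr_ge0. Qed.

Lemma enorm_le x (r : R) : 0 <= r -> (enorm x <= r) = (enorm x ^+ 2 <= r ^+ 2).
Proof. by move=> r0; rewrite ler_sqr// nnegrE enorm_ge0. Qed.

Lemma normr_coord_le x i : `|x ord0 i| <= enorm x.
Proof.
rewrite -ler_sqr ?nnegrE ?enorm_ge0// enorm_sqr real_normK ?num_real//.
by rewrite (bigD1 i)//= lerDl sumr_ge0// => j _; exact: sqr_ge0.
Qed.

Lemma enorm_le_coord x (r : R) : 0 <= r ->
  (forall i, `|x ord0 i| <= r) -> enorm x <= Num.sqrt d%:R * r.
Proof.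
move=> r0 xr; rewrite enorm_le ?mulr_ge0 ?sqrtr_ge0// enorm_sqr exprMn sqr_sqrtr ?ler0n//.
rewrite mulr_natl -[in leRHS](card_ord d) -sumr_const; apply: ler_sum => i _.
by rewrite -(real_normK (num_real (x ord0 i))) ler_sqr ?nnegrE.
Qed.

(* A form of the triangle inequality avoiding Cauchy-Schwarz. *)
Lemma enormD_sqr_le x y (e : R) : 0 < e ->
  enorm (x + y) ^+ 2 <= (1 + e) * enorm x ^+ 2 + (1 + e^-1) * enorm y ^+ 2.
Proof.
move=> e0; rewrite !enorm_sqr !mulr_sumr -big_split/=; apply: ler_sum => i _.
rewrite mxE; set a := x _ _; set b := y _ _.
have -> : (1 + e) * a ^+ 2 + (1 + e^-1) * b ^+ 2 = (a + b) ^+ 2 + e * (a - b / e) ^+ 2.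
  by field; lra.
by rewrite lerDl mulr_ge0 ?sqr_ge0// ltW.
Qed.

Lemma enormB_le_max x y : enorm (x - y) <= 2 * Num.max (enorm x) (enorm y).
Proof.
have M0 : 0 <= Num.max (enorm x) (enorm y) by rewrite le_max enorm_ge0.
rewrite enorm_le ?mulr_ge0//; apply: le_trans (enormD_sqr_le _ _ ltr01) _.
rewrite invr1 exprMn.
have -> : enorm (- y) = enorm y.
  by rewrite /enorm; congr Num.sqrt; apply: eq_bigr => i _; rewrite mxE sqrrN.
have xM : enorm x ^+ 2 <= Num.max (enorm x) (enorm y) ^+ 2.
  by rewrite ler_sqr ?nnegrE ?enorm_ge0// le_max lexx.
have yM : enorm y ^+ 2 <= Num.max (enorm x) (enorm y) ^+ 2.
  by rewrite ler_sqr ?nnegrE ?enorm_ge0// le_max lexx orbT.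
move: xM yM; set a := _ ^+ 2; set b := _ ^+ 2; set c := _ ^+ 2; nra.
Qed.

Lemma measurable_open (U : set 'rV[R]_d) : open U -> measurable (U : set (Rd R d)).
Proof. by move=> oU; exact: sub_sigma_algebra. Qed.

Lemma measurable_coord i :
  measurable_fun setT (fun y : Rd R d => (y : 'rV[R]_d) ord0 i).
Proof.
move=> mD; apply: (measurability _ (RGenOInfty.measurableE R)) => //.
move=> _ [_ [x ->] <-]; rewrite setTI; apply: measurable_open.
apply: open_comp; last exact: interval_open.
by move=> y _; exact: coord_continuous.
Qed.

Lemma measurable_enorm_of d' (T : measurableType d') (f : T -> 'rV[R]_d) :
  (forall i, measurable_fun setT (fun t => f t ord0 i)) ->
  measurable_fun setT (fun t => enorm (f t)).
Proof.
move=> mf; apply: (measurableT_comp (f := @Num.sqrt R)).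
  by apply: continuous_measurable_fun; exact: sqrt_continuous.
by apply: measurable_sum => i; apply: measurable_funX.
Qed.

Lemma measurable_enorm : measurable_fun setT (fun y : Rd R d => enorm (y : 'rV[R]_d)).
Proof. by apply: measurable_enorm_of => i; exact: measurable_coord. Qed.

Lemma measurable_cost (p : R) : measurable_fun setT (fun z : (Rd R d * Rd R d)%type =>
  (enorm ((z.1 : 'rV[R]_d) - (z.2 : 'rV[R]_d)) `^ p)%:E).
Proof.
apply/measurable_EFinP; apply: (measurableT_comp (measurable_powR p)).
apply: measurable_enorm_of => i.
rewrite (_ : (fun _ => _) = (fun z : (Rd R d * Rd R d)%type =>
    (z.1 : 'rV[R]_d) ord0 i - (z.2 : 'rV[R]_d) ord0 i)); last first.
  by apply/funext => z; rewrite !mxE.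
apply: measurable_funB.
  exact: (measurableT_comp (measurable_coord i) measurable_fst).
exact: (measurableT_comp (measurable_coord i) measurable_snd).
Qed.

End euclidean_norm.

Section dyadic_cells.
Context (R : realType) (d : nat).

Definition shell (n : nat) : set (Rd R d) :=
  [set y : Rd R d | enorm (y : 'rV[R]_d) <= 2 ^+ n /\
    (if n is k.+1 then 2 ^+ k < enorm (y : 'rV[R]_d) else True)].

(* A cube of side 2^n/2^l; inside the shell the integer indices [c i] range over
   0, ..., 2^(l+1). *)
Definition cell (n l : nat) (c : 'I_d -> nat) : set (Rd R d) :=
  shell n `&` [set y : Rd R d | forall i,
    (c i)%:R <= 2 ^+ l * ((y : 'rV[R]_d) ord0 i / 2 ^+ n + 1) < (c i).+1%:R].

Definition cell_index (n l : nat) (y : Rd R d) : {ffun 'I_d -> 'I_(2 ^ l.+1).+1} :=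
  [ffun i => inord (Num.truncn (2 ^+ l * ((y : 'rV[R]_d) ord0 i / 2 ^+ n + 1)))].

Lemma measurable_shell n : measurable (shell n).
Proof.
have m1 : measurable [set y : Rd R d | enorm (y : 'rV[R]_d) <= 2 ^+ n].
  rewrite (_ : [set _ | _] = ~` [set y : Rd R d | 2 ^+ n < enorm (y : 'rV[R]_d)]).
    by apply: measurableC; apply: measurable_set_gt; exact: measurable_enorm.
  by apply/seteqP; split => y /=; [move=> h; apply/negP; rewrite -leNgt|move/negP; rewrite -leNgt].
apply: measurableI => //; case: n {m1} => [|n]; first exact: measurableT.
by apply: measurable_set_gt; exact: measurable_enorm.
Qed.

Lemma measurable_cell n l c : measurable (cell n l c).
Proof.
apply: measurableI; first exact: measurable_shell.
rewrite (_ : [set _ | _] = \bigcap_(i in [set: 'I_d]) [set y : Rd R d |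
    (c i)%:R <= 2 ^+ l * ((y : 'rV[R]_d) ord0 i / 2 ^+ n + 1) < (c i).+1%:R]); last first.
  by apply/seteqP; split => [y H i _|y H i]; exact: H.
apply: fin_bigcap_measurable => [|i _]; first exact: finite_finset.
rewrite (_ : [set _ | _] = (fun y : Rd R d => 2 ^+ l * ((y : 'rV[R]_d) ord0 i / 2 ^+ n + 1)) @^-1`
  `[(c i)%:R, (c i).+1%:R[); last by apply/seteqP; split => y /=; rewrite in_itv.
rewrite -[_ @^-1` _]setTI.
have : measurable_fun setT (fun y : Rd R d => 2 ^+ l * ((y : 'rV[R]_d) ord0 i / 2 ^+ n + 1) : R).
  by apply: measurable_funM => //; apply: measurable_funD => //; apply: measurable_funM => //;
    exact: measurable_coord.
by apply.
Qed.

Lemma shell_inj n m y : shell n y -> shell m y -> n = m.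
Proof.
have key k l : (k < l)%N -> shell k y -> shell l y -> False.
  case: l => // l kl [yk _] [_ yl].
  by have := lt_le_trans yl yk; rewrite ltNge ler_weXn2l// ler1n.
by move=> yn ym; case: (ltngtP n m) => // nm; exfalso; [exact: (key _ _ nm)|exact: (key _ _ nm)].
Qed.

Lemma trivIset_cell n l :
  trivIset setT (fun c : {ffun 'I_d -> 'I_(2 ^ l.+1).+1} => cell n l (fun i => c i)).
Proof.
move=> c e _ _ [y [[_ yc] [_ ye]]]; apply/ffunP => i; apply/val_inj.
have /andP[a b] := yc i; have /andP[a' b'] := ye i.
have := le_lt_trans a b'; have := le_lt_trans a' b; rewrite !ltr_nat => /= u v.
by apply/eqP; rewrite eqn_leq -ltnS v -ltnS u.
Qed.

Lemma cell_indexP n l y : shell n y -> cell n l (fun i => cell_index n l y i) y.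
Proof.
move=> sy; split => // i; rewrite ffunE.
have n0 : 0 < 2 ^+ n :> R by rewrite exprn_gt0.
have : `|(y : 'rV[R]_d) ord0 i / 2 ^+ n| <= 1.
  rewrite normrM normfV (gtr0_norm n0) ler_pdivrMr// mul1r.
  exact: le_trans (normr_coord_le _ _) sy.1.
rewrite ler_norml => /andP[a b].
set v := 2 ^+ l * _.
have v0 : 0 <= v by rewrite mulr_ge0 ?exprn_ge0//; lra.
have v2 : v < (2 ^ l.+1).+1%:R.
  apply: (@le_lt_trans _ _ (2 ^ l.+1)%:R); last by rewrite ltr_nat.
  by rewrite natrX exprSr ler_wpM2l ?exprn_ge0//; lra.
have /andP[t1 t2] := Num.Theory.truncn_itv v0.
rewrite inordK ?t1//.
by rewrite -(ltr_nat R); exact: le_lt_trans t1 v2.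
Qed.

Lemma cell_coord_dist n l c y z i : cell n l c y -> cell n l c z ->
  `|((y : 'rV[R]_d) - (z : 'rV[R]_d)) ord0 i| <= 2 ^+ n / 2 ^+ l.
Proof.
move=> [_ /(_ i) /andP[a b]] [_ /(_ i) /andP[a' b']].
rewrite -natr1 in b; rewrite -natr1 in b'.
have n0 : 0 < 2 ^+ n :> R by rewrite exprn_gt0.
have l0 : 0 < 2 ^+ l :> R by rewrite exprn_gt0.
rewrite !mxE ler_pdivlMr//.
set u := (y : 'rV[R]_d) ord0 i in a b *; set v := (z : 'rV[R]_d) ord0 i in a' b' *.
have -> : `|u - v| * 2 ^+ l = `|2 ^+ l * (u / 2 ^+ n + 1) - 2 ^+ l * (v / 2 ^+ n + 1)| * 2 ^+ n.
  transitivity `|(u - v) * 2 ^+ l|; first by rewrite normrM (gtr0_norm l0).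
  transitivity `|(2 ^+ l * (u / 2 ^+ n + 1) - 2 ^+ l * (v / 2 ^+ n + 1)) * 2 ^+ n|.
    by congr (`| _ |); field; rewrite gt_eqF.
  by rewrite normrM (gtr0_norm n0).
apply: ler_piMl; first exact: ltW.
rewrite ler_norml.
by move: a b a' b'; set s := _ * (u / _ + 1); set t := _ * (v / _ + 1); lra.
Qed.

Lemma cell_laminar n l (c : 'I_d -> nat) k m (e : 'I_d -> nat) : (l <= m)%N ->
  cell k m e `<=` cell n l c \/ cell n l c `&` cell k m e = set0.
Proof.
move=> lm; case: (pselect (cell n l c `&` cell k m e !=set0)) => [|/set0P/negP/negPn/eqP]; last by right.
move=> [z [[zn zc] [zk ze]]]; left => y [yk ye].
have nk : n = k by exact: (shell_inj zn zk).
subst k; split => // i.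
have /andP[a b] := zc i; have /andP[a' b'] := ze i; have /andP[f g] := ye i.
have q0 : 0 < 2 ^+ (m - l) :> R by rewrite exprn_gt0.
have E u : 2 ^+ m * u = 2 ^+ (m - l) * (2 ^+ l * u) :> R by rewrite mulrA -exprD subnK.
rewrite !E in a' b' f g.
have ce : (2 ^ (m - l) * c i <= e i)%N.
  rewrite -ltnS -(ltr_nat R) natrM natrX; apply: le_lt_trans b'.
  by rewrite ler_pM2l.
have ec : ((e i).+1 <= 2 ^ (m - l) * (c i).+1)%N.
  rewrite -(ltr_nat R) natrM natrX; apply: (le_lt_trans a').
  by rewrite ltr_pM2l.
apply/andP; split.
  rewrite -(ler_pM2l q0); apply: le_trans f.
  by rewrite -natrX -natrM ler_nat.
rewrite -(ltr_pM2l q0); apply: (lt_le_trans g).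
by rewrite -natrX -natrM ler_nat.
Qed.

Lemma cell_in_shell n l c : cell n l c `<=` shell n.
Proof. by move=> y []. Qed.

Lemma shell_cover (n1 : nat) (y : Rd R d) : enorm (y : 'rV[R]_d) <= 2 ^+ n1 ->
  exists2 n, (n <= n1)%N & shell n y.
Proof.
elim: n1 => [y1|n IH yn]; first by exists 0%N.
case: (lerP (enorm (y : 'rV[R]_d)) (2 ^+ n)) => [/IH[k kn yk]|ny].
  by exists k => //; exact: leqW.
by exists n.+1.
Qed.

End dyadic_cells.

Section integral_bound.
Context d (T : measurableType d) (R : realType) (m : {measure set T -> \bar R}).

Definition int_le (f : T -> R) (a : R) :=
  [/\ measurable_fun setT f, forall x, 0 <= f x & (\int[m]_x (f x)%:E <= a%:E)%E].

Lemma int_leD f g a b : int_le f a -> int_le g b -> int_le (fun x => f x + g x) (a + b).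
Proof.
move=> [mf f0 fa] [mg g0 gb]; split; [exact: measurable_funD|by move=> x; rewrite addr_ge0|].
under eq_integral do rewrite EFinD.
rewrite ge0_integralD//; do ?[by move=> x _; rewrite lee_fin|exact/measurable_EFinP].
by rewrite EFinD; apply: leeD.
Qed.

Lemma int_leZ f a k : 0 <= k -> int_le f a -> int_le (fun x => k * f x) (k * a).
Proof.
move=> k0 [mf f0 fa]; split; [exact: measurable_funM|by move=> x; rewrite mulr_ge0|].
under eq_integral do rewrite EFinM.
rewrite ge0_integralZl_EFin//; do ?[by move=> x _; rewrite lee_fin|exact/measurable_EFinP].
by rewrite EFinM; apply: lee_wpmul2l; rewrite ?lee_fin.
Qed.

Lemma int_le_sum (I : Type) (s : seq I) (f : I -> T -> R) (a : I -> R) :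
  (forall i, int_le (f i) (a i)) -> int_le (fun x => \sum_(i <- s) f i x) (\sum_(i <- s) a i).
Proof.
move=> fa; elim: s => [|i s IH].
  split => [|x|]; last by rewrite (eq_integral (fun=> 0%E)) ?integral0 ?big_nil// => x _; rewrite big_nil.
    by under eq_fun do rewrite big_nil; exact: measurable_cst.
  by rewrite big_nil.
have := int_leD (fa i) IH; rewrite big_cons.
by congr int_le; apply/funext => x; rewrite big_cons.
Qed.

Lemma int_le_indic (A : set T) (a : R) : measurable A -> (m A <= a%:E)%E -> int_le \1_A a.
Proof.
move=> mA Aa; split; [exact: measurable_indic|by []|].
by rewrite integral_indic// setIT.
Qed.

Lemma int_le_le (f g : T -> R) (a : R) : measurable_fun setT f -> (forall x, 0 <= f x) ->
  (forall x, f x <= g x) -> int_le g a -> int_le f a.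
Proof.
move=> mf f0 fg [mg g0 ga]; split => //; apply: le_trans ga.
by apply: ge0_le_integral => //; do ?[by move=> x _; rewrite lee_fin|exact/measurable_EFinP].
Qed.

End integral_bound.

Lemma coupling_integral d (T : measurableType d) (R : realType)
    (mu nu : probability T R) (pi : probability (T * T)%type R) (f : T -> R) :
  coupling mu nu pi -> measurable_fun setT f -> (forall x, 0 <= f x) ->
  ((\int[pi]_z (f z.1)%:E = \int[mu]_x (f x)%:E)%E *
   (\int[pi]_z (f z.2)%:E = \int[nu]_x (f x)%:E)%E)%type.
Proof.
move=> cpi mf f0; have mEf : measurable_fun setT (EFin \o f) by exact/measurable_EFinP.
have key (g : T * T -> T) (m : probability T R) : measurable_fun setT g ->
    (forall A, measurable A -> pi (g @^-1` A) = m A) ->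
    (\int[pi]_z (f (g z))%:E = \int[m]_x (f x)%:E)%E.
  move=> mg H; rewrite -(@eq_measure_integral _ _ _ setT m (pushforward pi g)).
    by rewrite (ge0_integral_pushforward mg)//= => y _; rewrite lee_fin.
  by move=> A mA _; exact: H.
split; apply: key => // A mA; rewrite -?(cpi A mA).1 -?(cpi A mA).2; congr (pi _).
  by apply/seteqP; split => // -[x y] /= [].
by apply/seteqP; split => // -[x y] /= [].
Qed.

Section transport_bound.
Context (R : realType) (d : nat) (p : R).
Hypotheses (d_ge1 : (1 <= d)%N) (p_gt0 : 0 < p).
Variables (n1 : nat) (L : nat -> nat).
Local Notation Rd := (Rd R d).

Definition side (n l : nat) : R := 2 ^+ n / 2 ^+ l.

Lemma side_ge0 n l : 0 <= side n l.
Proof. by rewrite divr_ge0// exprn_ge0. Qed.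

Definition tail_moment (y : Rd) : R :=
  enorm (y : 'rV[R]_d) `^ p * (2 ^+ n1 < enorm (y : 'rV[R]_d))%R%:R.

Let W : R := (2 * Num.sqrt d%:R) `^ p.

Let W0 : 0 <= W. Proof. exact: powR_ge0. Qed.

Definition split_cell n l (z : Rd * Rd) : R :=
  \sum_(c : {ffun 'I_d -> 'I_(2 ^ l.+1).+1})
     (\1_(cell n l (fun i => c i) `*` ~` cell n l (fun i => c i)) z +
      \1_(~` cell n l (fun i => c i) `*` cell n l (fun i => c i)) z).

Let split_cell_ge0 n l z : 0 <= split_cell n l z.
Proof. by apply: sumr_ge0. Qed.

Let tail_ge0 y : 0 <= tail_moment y.
Proof. by rewrite mulr_ge0// powR_ge0. Qed.

Let split_cell_ge1 n l x y :
  ~ cell n l (fun i => cell_index n l x i) y -> shell n x ->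
  1 <= split_cell n l (x, y) /\ 1 <= split_cell n l (y, x).
Proof.
move=> Nxy sx; have xC := cell_indexP l sx.
split; rewrite /split_cell (bigD1 (cell_index n l x))//=; set s := \sum_(i | _) _.
  have s0 : 0 <= s by apply: sumr_ge0.
  rewrite indicE mem_set//=.
  have : 0 <= \1_(~` cell n l (fun i => cell_index n l x i) `*` cell n l (fun i => cell_index n l x i)) (x, y) :> R by [].
  lra.
have s0 : 0 <= s by apply: sumr_ge0.
rewrite [X in _ + X + _]indicE mem_set//=.
have : 0 <= \1_(cell n l (fun i => cell_index n l x i) `*` ~` cell n l (fun i => cell_index n l x i)) (y, x) :> R by [].
lra.
Qed.

Let multi n l z := side n l `^ p * split_cell n l z.

Let multi_le (n l : nat) z : (n < n1.+1)%N -> (l < (L n).+1)%N ->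
  multi n l z <= \sum_(n < n1.+1) \sum_(l < (L n).+1) multi n l z.
Proof.
move=> nn ll.
have m0 k m : 0 <= multi k m z by rewrite mulr_ge0// powR_ge0.
rewrite (bigD1 (Ordinal nn))//= (bigD1 (Ordinal ll))//= -addrA lerDl addr_ge0//.
  exact: sumr_ge0.
by apply: sumr_ge0 => i _; apply: sumr_ge0.
Qed.

(* Two points of the same shell have distance at most a constant times the side
   of the last common cell, that is twice the side of the first cell that
   separates them. *)
Lemma enorm_cost_le (x y : Rd) :
  enorm ((x : 'rV[R]_d) - (y : 'rV[R]_d)) `^ p <=
  W * (\sum_(n < n1.+1) \sum_(l < (L n).+1) side n l `^ p * split_cell n l (x, y)) +
  W * (\sum_(n < n1.+1) side n (L n) `^ p * \1_(shell n) x) +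
  2 `^ p * (tail_moment x + tail_moment y).
Proof.
set A := \sum_(n < n1.+1) \sum_(l < _) _; set B := \sum_(n < n1.+1) _ `^ _ * _.
have A0 : 0 <= A.
  by apply: sumr_ge0 => n _; apply: sumr_ge0 => l _; rewrite mulr_ge0// powR_ge0.
have B0 : 0 <= B by apply: sumr_ge0 => n _; rewrite mulr_ge0// powR_ge0.
have C0 : 0 <= 2 `^ p * (tail_moment x + tail_moment y).
  by rewrite mulr_ge0 ?powR_ge0// addr_ge0.
have WA0 : 0 <= W * A by rewrite mulr_ge0.
have WB0 : 0 <= W * B by rewrite mulr_ge0.
have powle (u v : R) : 0 <= u -> u <= v -> u `^ p <= v `^ p.
  by move=> u0 uv; apply: ge0_ler_powR; rewrite ?nnegrE// ?(le_trans u0 uv)// ltW.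
set M := Num.max (enorm (x : 'rV[R]_d)) (enorm (y : 'rV[R]_d)).
have M0 : 0 <= M by rewrite le_max enorm_ge0.
have costM := powle _ _ (enorm_ge0 _) (enormB_le_max (x : 'rV[R]_d) (y : 'rV[R]_d)).
case: (ltP (2 ^+ n1) M) => Mn.
  apply: (le_trans costM); rewrite powRM// -/M.
  have : M `^ p <= tail_moment x + tail_moment y.
    have tx := tail_ge0 x; have ty := tail_ge0 y.
    move: Mn; rewrite /M; case: (leP (enorm (x : 'rV[R]_d)) (enorm (y : 'rV[R]_d))) => xy Mn.
      by rewrite {2}/tail_moment Mn mulr1; lra.
    by rewrite {1}/tail_moment Mn mulr1; lra.
  move=> h; have := ler_wpM2l (powR_ge0 2 p) h; lra.
have [xn yn] : enorm (x : 'rV[R]_d) <= 2 ^+ n1 /\ enorm (y : 'rV[R]_d) <= 2 ^+ n1.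
  by move: Mn; rewrite /M ge_max => /andP.
have [n nn xs] := shell_cover xn; have [m mn ys] := shell_cover yn.
have sd1 : 1 <= Num.sqrt d%:R :> R by rewrite -[leLHS]sqrtr1 ler_sqrt ?ler0n// ler1n.
have sd0 : 0 <= 2 * Num.sqrt d%:R :> R by rewrite mulr_ge0 ?sqrtr_ge0.
have WM (u v : R) : 0 <= v -> u <= v -> (2 * u) `^ p <= W * v `^ p \/ u < 0.
  move=> v0 uv; case: (leP 0 u) => u0; [left|by right].
  rewrite /W -powRM//.
  by apply: powle; [lra|have := ler_wpM2r v0 sd1; lra].
have W2 (u v : R) : 0 <= u -> u <= v -> (2 * u) `^ p <= W * v `^ p.
  by move=> u0 uv; have [//|] := WM u v (le_trans u0 uv) uv; rewrite ltNge u0.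
suff [[k [l [kn lL kl s1]]]|fine_] :
    (exists k l, [/\ (k < n1.+1)%N, (l < (L k).+1)%N,
       enorm ((x : 'rV[R]_d) - (y : 'rV[R]_d)) `^ p <= W * side k l `^ p &
       1 <= split_cell k l (x, y)]) \/
    enorm ((x : 'rV[R]_d) - (y : 'rV[R]_d)) `^ p <= W * B.
- have := multi_le (x, y) kn lL; rewrite /multi -/A => h.
  have : side k l `^ p <= A.
    by apply: le_trans h; rewrite ler_peMr// powR_ge0.
  move=> /(ler_wpM2l W0); lra.
- lra.
have side0 k : side k 0 = 2 ^+ k by rewrite /side expr0 divr1.
have [nm|mn'|nm] := ltngtP n m.
- left; exists m, 0%N; split=> //.
    apply: (le_trans costM); apply: W2 => //; rewrite side0 ge_max ys.1 andbT.
    by apply: le_trans xs.1 _; rewrite ler_weXn2l// ?ler1n// ltnW.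
  apply: (split_cell_ge1 _ ys).2 => -[xm _].
  by move: nm; rewrite (shell_inj xs xm) ltnn.
- left; exists n, 0%N; split=> //.
    apply: (le_trans costM); apply: W2 => //; rewrite side0 ge_max xs.1 /=.
    by apply: le_trans ys.1 _; rewrite ler_weXn2l// ?ler1n// ltnW.
  apply: (split_cell_ge1 _ xs).1 => -[ym _].
  by move: mn'; rewrite (shell_inj ys ym) ltnn.
subst m.
pose same l := cell n l (fun i => cell_index n l x i) y.
have dist l : same l -> enorm ((x : 'rV[R]_d) - (y : 'rV[R]_d)) <= Num.sqrt d%:R * side n l.
  move=> xyl; apply: enorm_le_coord; first exact: side_ge0.
  by move=> i; apply: cell_coord_dist xyl; exact: cell_indexP.
case: (pselect (same (L n))) => [sL|NsL].
  right; apply: (@le_trans _ _ (W * side n (L n) `^ p)).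
    rewrite /W -powRM ?side_ge0//.
    apply: powle (enorm_ge0 _) _; apply: le_trans (dist _ sL) _.
    by rewrite ler_wpM2r ?side_ge0//; lra.
  rewrite ler_wpM2l//; have nn' : (n < n1.+1)%N by [].
  rewrite /B (bigD1 (Ordinal nn'))//= indicE mem_set//= mulr1 lerDl.
  by apply: sumr_ge0 => i _; rewrite mulr_ge0// powR_ge0.
have exl : exists l, `[< ~ same l >] && (l <= L n)%N.
  by exists (L n); rewrite leqnn andbT; apply/asboolP.
left; exists n, (ex_minn exl); case: ex_minnP => l /andP[/asboolP Nsl lL] lmin; split => //.
  case: l => [|l] in Nsl lL lmin *.
    by apply: (le_trans costM); apply: W2 => //; rewrite side0 ge_max xs.1 ys.1.
  have sl : same l.
    apply: contrapT => Nl; have := lmin l; rewrite (ltnW lL) andbT ltnn.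
    have -> : `[< ~ same l >] by apply/asboolP.
    by move=> /(_ isT).
  rewrite /W -powRM ?side_ge0//.
  apply: powle (enorm_ge0 _) _; apply: le_trans (dist _ sl) _.
  rewrite (_ : side n l = 2 * side n l.+1); first by rewrite mulrCA mulrA.
  by rewrite /side exprS; field; rewrite expf_neq0.
exact: (split_cell_ge1 Nsl xs).1.
Qed.

Lemma transport_cost_le (mu nu : probability Rd R) (tmu tnu : R) :
  (\int[mu]_y (tail_moment y)%:E <= tmu%:E)%E ->
  (\int[nu]_y (tail_moment y)%:E <= tnu%:E)%E ->
  (transport_cost p mu nu <=
   (2 * W * (\sum_(n < n1.+1) \sum_(l < (L n).+1) side n l `^ p *
       \sum_(c : {ffun 'I_d -> 'I_(2 ^ l.+1).+1})
         `|fine (mu (cell n l (fun i => c i))) - fine (nu (cell n l (fun i => c i)))|) +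
    W * (\sum_(n < n1.+1) side n (L n) `^ p * fine (mu (shell n))) +
    2 `^ p * (tmu + tnu))%:E)%E.
Proof.
move=> Hmu Hnu.
pose J : finType := {n : 'I_n1.+1 & {l : 'I_(L n).+1 & {ffun 'I_d -> 'I_(2 ^ l.+1).+1}}}.
pose F (j : J) := @cell R d (tag j) (tag (tagged j)) (fun i => tagged (tagged j) i).
have mF j : measurable (F j) by exact: measurable_cell.
have lamF j k : [\/ F j `<=` F k, F k `<=` F j | F j `&` F k = set0].
  have /orP[h|h] := leq_total (tag (tagged j)) (tag (tagged k)).
    have [|] := @cell_laminar R d (tag j) _ (fun i => tagged (tagged j) i) (tag k) _ (fun i => tagged (tagged k) i) h.
      by constructor 2.
    by constructor 3.
  have [|] := @cell_laminar R d (tag k) _ (fun i => tagged (tagged k) i) (tag j) _ (fun i => tagged (tagged j) i) h.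
    by constructor 1.
  by rewrite setIC; constructor 3.
have [pi cpi piF] := measure_laminar_coupling mu nu mF lamF.
apply: (@le_trans _ _ (\int[pi]_z (enorm ((z.1 : 'rV[R]_d) - (z.2 : 'rV[R]_d)) `^ p)%:E)%E).
  by apply: ereal_inf_lbound; exists pi.
have mtail : measurable_fun setT tail_moment.
  apply: measurable_funM.
    exact: (measurableT_comp (measurable_powR p) (@measurable_enorm R d)).
  rewrite (_ : (fun _ => _) = \1_[set y : Rd | 2 ^+ n1 < enorm (y : 'rV[R]_d)]).
    by apply: measurable_indic; apply: measurable_set_gt; exact: measurable_enorm.
  apply/funext => y; rewrite indicE; congr (nat_of_bool _)%:R.
  by apply/idP/idP => [h|]; [exact: mem_set|rewrite inE].
suff [] : int_le pi (fun z => enorm ((z.1 : 'rV[R]_d) - (z.2 : 'rV[R]_d)) `^ p)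
   (2 * W * (\sum_(n < n1.+1) \sum_(l < (L n).+1) side n l `^ p *
       \sum_(c : {ffun 'I_d -> 'I_(2 ^ l.+1).+1})
         `|fine (mu (cell n l (fun i => c i))) - fine (nu (cell n l (fun i => c i)))|) +
    W * (\sum_(n < n1.+1) side n (L n) `^ p * fine (mu (shell n))) +
    2 `^ p * (tmu + tnu)) by [].
apply: (int_le_le _ _ (fun z => enorm_cost_le z.1 z.2)).
- by have /measurable_EFinP := @measurable_cost R d p.
- by move=> z; exact: powR_ge0.
apply: int_leD; first apply: int_leD.
- rewrite (mulrC 2) -mulrA; apply: int_leZ => //; rewrite mulr_sumr; apply: int_le_sum => n.
  rewrite mulr_sumr; apply: int_le_sum => l.
  rewrite mulrCA; apply: int_leZ; first exact: powR_ge0.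
  rewrite mulr_sumr; apply: int_le_sum => c; rewrite mulr_natl mulr2n.
  pose j : J := existT _ n (existT _ l c).
  have mC : measurable (~` F j) by exact: measurableC.
  apply: int_leD.
    by apply: int_le_indic; [exact: (measurableX (mF j) mC)|exact: (piF j).1].
  by apply: int_le_indic; [exact: (measurableX mC (mF j))|exact: (piF j).2].
- apply: int_leZ => //; apply: int_le_sum => n; apply: int_leZ; first exact: powR_ge0.
  have mS := @measurable_shell R d n.
  rewrite (_ : (fun z : Rd * Rd => \1_(shell n) z.1) = \1_(shell n `*` setT)).
    apply: int_le_indic; first exact: measurableX.
    rewrite [X in (X <= _)%E](_ : _ = mu (shell n)); last exact: (cpi _ mS).1.
    by rewrite fineK//; exact: fin_num_measure.
  by apply/funext => z; rewrite !indicE in_setX in_setT andbT.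
- apply: int_leZ; first exact: powR_ge0.
  apply: int_leD; split=> //.
  + exact: measurableT_comp mtail measurable_fst.
  + by rewrite (coupling_integral cpi mtail tail_ge0).1.
  + exact: measurableT_comp mtail measurable_snd.
  + by rewrite (coupling_integral cpi mtail tail_ge0).2.
Qed.

End transport_bound.

(** * Measurability of the deviation event *)

Lemma ge0_integral_mrestr d (T : measurableType d) (R : realType)
    (m : {measure set T -> \bar R}) (D : set T) (mD : measurable D) (f : T -> R) :
  measurable_fun setT f -> (forall x, 0 <= f x) ->
  (\int[mrestr m mD]_x (f x)%:E = \int[m]_x (f x * \1_D x)%:E)%E.
Proof.
move=> mf f0; have mEf : measurable_fun setT (EFin \o f) by exact/measurable_EFinP.
have mDC := measurableC mD.
rewrite [LHS](@ge0_negligible_integral _ _ _ _ setT (~` D))//; last 2 first.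
- by move=> x _; rewrite lee_fin.
- by transitivity (m (~` D `&` D)); [|rewrite setICl measure0].
rewrite setTD setCK (@eq_measure_integral _ _ _ D m).
  rewrite integral_mkcond; apply: eq_integral => x _.
  by rewrite patchE indicE; case: ifP; rewrite ?mulr1 ?mulr0.
by move=> A mA AD; first [exact: (congr1 m (setIidl AD)) | exact: (esym (congr1 m (setIidl AD)))].
Qed.

Section empirical_lemmas.
Context (R : realType) (d : nat).
Local Notation Rd := (Rd R d).
Implicit Types (x : nat -> Rd).

Lemma empiricalE x n (A : set Rd) :
  empirical x n.+1 A = (n.+1%:R^-1 * \sum_(i < n.+1) \1_A (x i))%:E.
Proof.
rewrite /= /uniform_dirac /mscale /= /msum EFinM; congr (_ * _)%E.
by rewrite -sumEFin; apply: eq_bigr.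
Qed.

Lemma integral_empirical x n (f : Rd -> R) : measurable_fun setT f ->
  (forall y, 0 <= f y) ->
  (\int[empirical x n.+1]_y (f y)%:E = (n.+1%:R^-1 * \sum_(i < n.+1) f (x i))%:E)%E.
Proof.
move=> mf f0; have mEf : measurable_fun setT (EFin \o f) by exact/measurable_EFinP.
have Ef0 y : [set: Rd] y -> (0 <= (EFin \o f) y)%E by rewrite lee_fin.
have h : 0 <= n.+1%:R^-1 :> R by [].
transitivity (\int[mscale (NngNum h) (msum (fun i => \d_(x i)) n.+1)]_y (EFin \o f) y)%E.
  exact: eq_measure_integral.
rewrite ge0_integral_mscale// ge0_integral_measure_sum//.
rewrite EFinM -sumEFin; congr (_ * _)%E; apply: eq_bigr => i _.
by rewrite integral_dirac// diracT mul1e.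
Qed.

Lemma measurable_set1_Rd (a : Rd) : measurable [set a].
Proof.
rewrite (_ : [set a] = \bigcap_(i in [set: 'I_d])
    ((fun y : Rd => (y : 'rV[R]_d) ord0 i) @^-1` [set (a : 'rV[R]_d) ord0 i])).
  apply: fin_bigcap_measurable => [|i _]; first exact: finite_finset.
  by rewrite -[_ @^-1` _]setTI; exact: measurable_coord.
apply/seteqP; split=> [y -> //|y H].
by apply/rowP => i; exact: (H i).
Qed.

End empirical_lemmas.

Lemma powR_perturb (R : realType) (d : nat) (p rho : R) : 0 < p -> 0 < rho ->
  exists2 delta : R, 0 < delta & forall y x x' : 'rV[R]_d, enorm (x - x') <= delta ->
    enorm (y - x') `^ p <= (1 + rho) * enorm (y - x) `^ p + rho.
Proof.
move=> p0 rho0.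
pose e := ((1 + rho) `^ (2 / p) - 1) / 2.
have h1 : 1 < (1 + rho) `^ (2 / p).
  apply: (@le_lt_trans _ _ (1 `^ (2 / p))); first by rewrite powR1.
  by apply: gt0_ltr_powR; rewrite ?divr_gt0// ?nnegrE; lra.
have e0 : 0 < e by rewrite /e; lra.
have powp (u : R) : 0 <= u -> (u ^+ 2) `^ (p / 2) = u `^ p.
  by move=> u0; rewrite -powR_mulrn// -powRrM mulrCA divff ?mulr1//.
have eE : (1 + 2 * e) `^ (p / 2) = 1 + rho.
  have -> : 1 + 2 * e = (1 + rho) `^ (2 / p) by rewrite /e; field.
  rewrite -powRrM (_ : 2 / p * (p / 2) = 1) ?powRr1//; [lra|field; lra].
pose K := (e^-1 * (1 + e) + 1) * (1 + e^-1).
have ei0 : 0 < e^-1 by rewrite invr_gt0.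
have K0 : 0 < K by rewrite /K mulr_gt0//; nra.
pose B := K `^ (p / 2).
have B0 : 0 < B by rewrite powR_gt0.
exists ((rho / B) `^ p^-1) => [|y x x' xx']; first by apply: powR_gt0; exact: divr_gt0.
set delta := _ `^ _ in xx'.
have delta0 : 0 <= delta by exact: powR_ge0.
have deltap : delta `^ p = rho / B.
  by rewrite /delta -powRrM mulVf ?gt_eqF// powRr1// divr_ge0// ltW.
set a := enorm (y - x); have a0 : 0 <= a by exact: enorm_ge0.
have D : enorm (y - x') ^+ 2 <= (1 + e) * a ^+ 2 + (1 + e^-1) * delta ^+ 2.
  have -> : y - x' = (y - x) + (x - x') by rewrite addrA subrK.
  apply: le_trans (enormD_sqr_le _ _ e0) _; rewrite lerD2l ler_wpM2l//; first by lra.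
  by rewrite ler_sqr ?nnegrE ?enorm_ge0.
have p20 : 0 <= p / 2 by lra.
have mono (u v : R) : 0 <= u -> u <= v -> u `^ (p / 2) <= v `^ (p / 2).
  by move=> u0 uv; apply: ge0_ler_powR; rewrite ?nnegrE// (le_trans u0).
have ap0 : 0 <= a `^ p by exact: powR_ge0.
case: (leP ((1 + e^-1) * delta ^+ 2) (e * a ^+ 2)) => h.
  have : enorm (y - x') `^ p <= (1 + rho) * a `^ p.
    rewrite -eE -!powp ?enorm_ge0// -powRM ?sqr_ge0//; last by lra.
    apply: mono; first exact: sqr_ge0.
    apply: le_trans D _; rewrite (_ : (1 + 2 * e) * a ^+ 2 = (1 + e) * a ^+ 2 + e * a ^+ 2); last by ring.
    by rewrite lerD2l.
  by move=> h1'; apply: le_trans h1' _; rewrite lerDl ltW.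
have : enorm (y - x') `^ p <= rho.
  have -> : rho = B * delta `^ p by rewrite deltap mulrCA divff ?mulr1// gt_eqF.
  rewrite -!powp ?enorm_ge0// /B -powRM ?sqr_ge0//; last exact: ltW.
  apply: mono; first exact: sqr_ge0.
  apply: le_trans D _.
  have : a ^+ 2 <= e^-1 * ((1 + e^-1) * delta ^+ 2).
    by rewrite -(ler_pM2l e0) mulVKf ?gt_eqF// ltW.
  move=> /(ler_wpM2l (_ : 0 <= 1 + e)) h2.
  have {}h2 := h2 (ltac:(lra)).
  rewrite (_ : K * delta ^+ 2 = (1 + e) * (e^-1 * ((1 + e^-1) * delta ^+ 2)) + (1 + e^-1) * delta ^+ 2).
    by rewrite lerD2r.
  by rewrite /K; ring.
move=> h3; apply: le_trans h3 _.
by rewrite lerDr mulr_ge0// addr_ge0// ltW.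
Qed.

Section transport_usc.
Context (R : realType) (d : nat) (p : R).
Hypothesis p_gt0 : 0 < p.
Local Notation Rd := (Rd R d).

(* A coupling of [mu] with the empirical measure of [x] is transported to [x'] by
   splitting the mass sent to each atom equally among the indices [k] with that
   value of [x k]. *)
Lemma transport_cost_usc (mu : probability Rd R) (x : nat -> Rd) n (t : R) :
  (transport_cost p mu (empirical x n.+1) < t%:E)%E ->
  exists2 delta : R, 0 < delta & forall x' : nat -> Rd,
    (forall i, (i < n.+1)%N -> enorm ((x i : 'rV[R]_d) - (x' i : 'rV[R]_d)) <= delta) ->
    (transport_cost p mu (empirical x' n.+1) < t%:E)%E.
Proof.
move=> /ereal_inf_lt[_ [pi cpi <-] pit].
set c := fun z : Rd * Rd => enorm ((z.1 : 'rV[R]_d) - (z.2 : 'rV[R]_d)) `^ p.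
have mc : measurable_fun setT c by have /measurable_EFinP := @measurable_cost R d p.
have c0 z : 0 <= c z by exact: powR_ge0.
have [C CE] : exists C : R, (\int[pi]_z (c z)%:E = C%:E)%E.
  exists (fine (\int[pi]_z (c z)%:E)); rewrite fineK// ge0_fin_numE; last first.
    by apply: integral_ge0 => z _; rewrite lee_fin.
  by apply: lt_le_trans pit _; rewrite leey.
have C0 : 0 <= C by rewrite -lee_fin -CE; apply: integral_ge0 => z _; rewrite lee_fin.
have Ct : C < t by rewrite -lte_fin -CE.
have [rho rho0 rhoE] : exists2 rho, 0 < rho & (1 + rho) * C + rho < t.
  clear -Ct C0; exists ((t - C) / (2 * (C + 1))); first by rewrite divr_gt0//; lra.
  rewrite [ltLHS](_ : _ = (t + C) / 2); first lra.
  by field; lra.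
have [delta delta0 Hd] := powR_perturb d p_gt0 rho0.
exists delta => // x' xx'.
pose D (k : nat) := [set: Rd] `*` [set x k].
have mD k : measurable (D k) by apply: measurableX => //; exact: measurable_set1_Rd.
pose mult (k : nat) : R := \sum_(i < n.+1) (x i == x k)%:R.
have mult_ge0 k : 0 <= (mult k)^-1 by rewrite invr_ge0; apply: sumr_ge0 => i _; case: eqP.
have mult_gt0 k : (k < n.+1)%N -> 0 < mult k.
  move=> kn; rewrite /mult (bigD1 (Ordinal kn))//= eqxx ltr_pwDl//.
  by apply: sumr_ge0 => i _; case: eqP.
pose w k : {nonneg R} := NngNum (mult_ge0 k).
have mshift (k : nat) : measurable_fun setT (fun z : Rd * Rd => (z.1, x' k)).
  by apply: measurable_fun_pair => //; exact: measurable_cst.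
pose m (k : nat) : {measure set (Rd * Rd)%type -> \bar R} :=
  measure_function_pushforward__canonical__measure_function_Measure
    (mrestr pi (mD k)) (mshift k).
have mE k A : m k A = pi ([set z | A (z.1, x' k)] `&` D k) by [].
have empD k : pi (D k) = (n.+1%:R^-1 * mult k)%:E.
  rewrite (cpi _ (measurable_set1_Rd (x k))).2 empiricalE; congr (_ * _)%:E.
  apply: eq_bigr => i _; rewrite indicE; congr (nat_of_bool _)%:R.
  by apply/idP/eqP => [|->]; rewrite inE.
have col A : (\sum_(k < n.+1) (w k)%:num%:E * m k (setT `*` A) =
    empirical x' n.+1 A)%E.
  rewrite empiricalE mulr_sumr -sumEFin; apply: eq_bigr => k _.
  rewrite mE indicE /=; case: (boolP (x' k \in A)) => xA.
    rewrite (_ : _ `&` _ = D k); last first.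
      by apply/seteqP; split => z /=; [case|move=> zD; split => //; split => //; rewrite inE in xA].
    by rewrite empD -EFinM mulr1 mulrCA mulVf ?mulr1// gt_eqF// mult_gt0.
  rewrite (_ : _ `&` _ = set0) ?measure0 ?mule0 ?mulr0//; apply/seteqP; split => z //= -[[_]] + _.
  by move/negP: xA; rewrite inE.
have mass1 : (\sum_(k < n.+1) (w k)%:num%:E * m k setT = 1)%E.
  by rewrite -setXTT col probability_setT.
have [pi' [pi'E pi'I]] := exists_mixture mass1.
have weight_le1 (f : Rd * Rd -> R) : measurable_fun setT f -> (forall z, 0 <= f z) ->
    (\sum_(k < n.+1) (w k)%:num%:E * \int[mrestr pi (mD k)]_z (f z)%:E <=
     \int[pi]_z (f z)%:E)%E.
  move=> mf f0.
  have mfD k : measurable_fun setT (fun z => (f z * \1_(D k) z)%:E).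
    by apply/measurable_EFinP; apply: measurable_funM => //; exact: measurable_indic.
  have fD0 k z : 0 <= f z * \1_(D k) z by rewrite mulr_ge0.
  rewrite (eq_bigr (fun k : 'I_n.+1 => \int[pi]_z ((mult k)^-1 * (f z * \1_(D k) z))%:E)%E); last first.
    move=> k _; rewrite ge0_integral_mrestr//.
    under [RHS]eq_integral do rewrite EFinM.
    by rewrite ge0_integralZl_EFin// => z _; rewrite lee_fin.
  rewrite -ge0_integral_sum//; last 2 first.
  - by move=> k; under eq_fun do rewrite EFinM; exact: measurable_funeM.
  - by move=> k z _; rewrite lee_fin mulr_ge0.
  apply: ge0_le_integral => //.
  - by move=> z _; rewrite sumEFin lee_fin; apply: sumr_ge0 => k _; rewrite mulr_ge0.
  - by apply: emeasurable_sum => k; under eq_fun do rewrite EFinM; exact: measurable_funeM.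
  - exact/measurable_EFinP.
  move=> z _; rewrite sumEFin lee_fin.
  rewrite (eq_bigr (fun k : 'I_n.+1 => f z * ((mult k)^-1 * (x k == z.2)%:R))); last first.
    move=> k _; rewrite mulrCA; congr (_ * (_ * (nat_of_bool _)%:R)).
    apply/idP/eqP; first by rewrite inE => -[_ /= ->].
    by move=> kz; rewrite inE; split => //=; rewrite -kz.
  rewrite -mulr_sumr ler_piMr//.
  case: (pselect (exists k : 'I_n.+1, x k = z.2)) => [[k0 k0E]|Nz]; last first.
    rewrite big1// => k _; case: eqP => [kz|]; last by rewrite mulr0.
    by exfalso; apply: Nz; exists k.
  rewrite (eq_bigr (fun k : 'I_n.+1 => (mult k0)^-1 * (x k == x k0)%:R)); last first.
    by move=> k _; rewrite -k0E; case: eqP => [e|]; rewrite ?mulr0// /mult e.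
  by rewrite -mulr_sumr mulVf// gt_eqF// mult_gt0.
have row A : measurable A -> (pi' (A `*` setT) <= mu A)%E.
  move=> mA; rewrite pi'E.
  have mAT : measurable (A `*` [set: Rd]) by exact: measurableX.
  have m1 : measurable_fun setT (\1_(A `*` [set: Rd]) : _ -> R) by exact: measurable_indic.
  have p1 z : 0 <= \1_(A `*` [set: Rd]) z :> R by [].
  have := weight_le1 _ m1 p1.
  rewrite integral_indic// setIT => H.
  rewrite [X in (_ <= X)%E](_ : _ = pi (A `*` setT)); last exact/esym/(cpi _ mA).1.
  apply: le_trans H; rewrite le_eqVlt; apply/orP; left; apply/eqP; apply: eq_bigr => k _.
  congr (_ * _)%E; rewrite integral_indic// setIT.
  by rewrite mE /= /mrestr.
have cpi' : coupling mu (empirical x' n.+1) pi'.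
  move=> A mA; split; last by rewrite pi'E col.
  apply/eqP; rewrite eq_le row//=.
  have := row _ (measurableC mA).
  have -> : ~` A `*` setT = ~` (A `*` [set: Rd]).
    by apply/seteqP; split => z /=; [move=> [h _] []|move=> h; split => // ?; apply: h].
  have mAT : measurable (A `*` [set: Rd]) by exact: measurableX.
  have key (u v : \bar R) : u \is a fin_num -> v \is a fin_num ->
      (1 - v <= 1 - u)%E -> (u <= v)%E.
    case: u => [u| |]//; case: v => [v| |]// _ _.
    by rewrite -!EFinB !lee_fin lerD2l lerN2.
  move=> H; apply: key; [exact: fin_num_measure|exact: fin_num_measure|].
  apply: le_trans (_ : _ <= pi' (~` (A `*` [set: Rd])))%E _.
    by rewrite le_eqVlt; apply/orP; left; apply/eqP/esym; exact: probability_setC.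
  apply: (le_trans H).
  by rewrite le_eqVlt; apply/orP; left; apply/eqP; exact: probability_setC.
apply: (@le_lt_trans _ _ (\int[pi']_z (c z)%:E)%E).
  by apply: ereal_inf_lbound; exists pi'.
rewrite pi'I//; last exact/measurable_EFinP.
have mf : measurable_fun setT (fun z => (1 + rho) * c z + rho).
  by apply: measurable_funD => //; exact: measurable_funM.
have f0 z : 0 <= (1 + rho) * c z + rho.
  by rewrite addr_ge0 ?mulr_ge0 ?addr_ge0// ltW.
have mcs (k : nat) : measurable_fun setT (fun z : Rd * Rd => c (z.1, x' k)).
  exact: (measurableT_comp mc (mshift k)).
apply: (@le_lt_trans _ _ (\sum_(k < n.+1) (w k)%:num%:E * \int[mrestr pi (mD k)]_z ((1 + rho) * c z + rho)%:E)%E).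
  apply: lee_sum => k _; apply: lee_wpmul2l; first by rewrite lee_fin.
  rewrite /m ge0_integral_pushforward//=; last 2 first.
  - exact/measurable_EFinP.
  - by move=> z _; rewrite lee_fin.
  have E1 := ge0_integral_mrestr pi (mD k) (mcs k) (fun z => c0 _).
  have E2 := ge0_integral_mrestr pi (mD k) mf f0.
  apply: (le_trans (y := (\int[pi]_z (((1 + rho) * c z + rho) * \1_(D k) z)%:E)%E)); last first.
    by rewrite le_eqVlt; apply/orP; left; apply/eqP/esym; exact: E2.
  apply: (le_trans (y := (\int[pi]_z (c (z.1, x' k) * \1_(D k) z)%:E)%E)).
    by rewrite le_eqVlt; apply/orP; left; apply/eqP; exact: E1.
  have mD1 : measurable_fun setT (\1_(D k) : (Rd * Rd)%type -> R) by exact: measurable_indic.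
  have mg1 : measurable_fun setT (fun z => (c (z.1, x' k) * \1_(D k) z)%:E).
    by apply/measurable_EFinP; exact: (measurable_funM (mcs k) mD1).
  have mg2 : measurable_fun setT (fun z => (((1 + rho) * c z + rho) * \1_(D k) z)%:E).
    by apply/measurable_EFinP; exact: (measurable_funM mf mD1).
  apply: ge0_le_integral; [exact: measurableT| |exact: mg1|exact: mg2|].
  - by move=> z _; rewrite lee_fin mulr_ge0.
  move=> z _; rewrite lee_fin indicE; case: (boolP (z \in D k)) => zD; last by rewrite !mulr0.
  rewrite !mulr1; move: zD; rewrite inE => -[_ /= zk]; rewrite /c /= zk.
  by apply: Hd; exact: xx'.
apply: le_lt_trans (weight_le1 _ mf f0) _.
under eq_integral do rewrite EFinD EFinM.
rewrite ge0_integralD//; last 3 first.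
- by move=> z _; rewrite -EFinM lee_fin mulr_ge0// addr_ge0// ltW.
- by apply: measurable_funeM; exact/measurable_EFinP.
- by move=> z _; rewrite lee_fin ltW.
rewrite ge0_integralZl_EFin//; last 3 first.
- by move=> z _; rewrite lee_fin.
- exact/measurable_EFinP.
- by rewrite addr_ge0// ltW.
rewrite integral_cst// [X in (_ + _ * X < _)%E](_ : _ = 1%E); last exact: probability_setT.
by rewrite mule1 CE -EFinM -EFinD lte_fin.
Qed.

End transport_usc.

Section transport_measurable.
Context (R : realType) (d : nat) (p : R) (disp : measure_display)
  (Omega : measurableType disp).
Hypothesis p_gt0 : 0 < p.
Local Notation Rd := (Rd R d).
Variables (mu : probability Rd R) (X : nat -> Omega -> Rd).
Hypothesis mX : forall i, measurable_fun setT (X i).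

Lemma measurable_transport_lt n (t : R) :
  measurable [set w | (transport_cost p mu (empirical (X^~ w) n.+1) < t%:E)%E].
Proof.
pose I := ({ffun 'I_n.+1 * 'I_d -> rat} * nat)%type.
pose rad (k : nat) : R := k.+1%:R^-1.
have rad0 k : 0 < rad k by rewrite invr_gt0.
pose box (u : I) := [set x : nat -> Rd | forall (i : 'I_n.+1) (j : 'I_d),
  `|(x i : 'rV[R]_d) ord0 j - ratr (u.1 (i, j))| < rad u.2].
pose good (u : I) := `[< forall x, box u x ->
  (transport_cost p mu (empirical x n.+1) < t%:E)%E >].
pose F (u : I) := if good u then [set w | box u (X^~ w)] else set0.
have -> : [set w | (transport_cost p mu (empirical (X^~ w) n.+1) < t%:E)%E] = \bigcup_u F u.
  apply/seteqP; split=> [w /= wt|w [u _]]; last first.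
    by rewrite /F; case: ifP => // /asboolP gu; exact: gu.
  have [delta delta0 Hd] := transport_cost_usc p_gt0 wt.
  have sd0 : 0 < Num.sqrt d%:R + 1 :> R by rewrite ltr_pwDr// sqrtr_ge0.
  have [k kd] : exists k, Num.sqrt d%:R * (2 * rad k) <= delta.
    exists (Num.truncn (2 * (Num.sqrt d%:R + 1) / delta)).
    have := Num.Theory.truncnS_gt (2 * (Num.sqrt d%:R + 1) / delta).
    set k := Num.truncn _; move=> h.
    have k0 : 0 < k.+1%:R :> R by [].
    rewrite /rad mulrA ler_pdivrMr//.
    rewrite ltr_pdivrMr// in h.
    apply: (@le_trans _ _ (2 * (Num.sqrt d%:R + 1))); last by rewrite [leRHS]mulrC ltW.
    by rewrite [leLHS]mulrC ler_pM2l// lerDl.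
  have ex (i : 'I_n.+1) (j : 'I_d) : exists q : rat, `|(X i w : 'rV[R]_d) ord0 j - ratr q| < rad k.
    set a := (X i w : 'rV[R]_d) ord0 j.
    have ar : a - rad k < a + rad k by rewrite ltrD2l gtrN.
    have [q] := rat_in_itvoo ar; rewrite in_itv/= => /andP[q1 q2].
    by exists q; rewrite distrC ltr_distl q1 q2.
  pose q : {ffun 'I_n.+1 * 'I_d -> rat} := [ffun ij => projT1 (cid (ex ij.1 ij.2))].
  have bq : box (q, k) (X^~ w).
    by move=> i j; rewrite /= ffunE /=; exact: (projT2 (cid (ex i j))).
  exists (q, k) => //; rewrite /F ifT//.
  apply/asboolP => x bx; apply: Hd => i iN.
  apply: le_trans kd; apply: enorm_le_coord => [|j].
    by rewrite mulr_ge0// ltW.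
  have /= h1 := bq (Ordinal iN) j; have /= h2 := bx (Ordinal iN) j.
  rewrite !mxE; apply: le_trans (ler_distD (ratr (q (Ordinal iN, j))) _ _) _.
  by rewrite mulr_natl mulr2n lerD// ltW// distrC.
apply: countable_bigcupT_measurable; first exact: countableP.
move=> u; rewrite /F; case: ifP => // _.
have -> : [set w | box u (X^~ w)] = \bigcap_(ij in [set: 'I_n.+1 * 'I_d])
    [set w | rad u.2 - `|(X ij.1 w : 'rV[R]_d) ord0 ij.2 - ratr (u.1 ij)| > 0].
  apply/seteqP; split => [w H [i j] _|w H i j] /=; first by rewrite subr_gt0; exact: H.
  by have := H (i, j) Logic.I; rewrite /= subr_gt0.
apply: fin_bigcap_measurable => [|ij _]; first exact: finite_finset.
apply: measurable_set_gt; apply: measurable_funB => //.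
apply: measurableT_comp => //; apply: measurable_funB => //.
exact: (measurableT_comp (measurable_coord ij.2) (mX ij.1)).
Qed.

Lemma measurable_transport_gt N (t : R) :
  measurable [set w | (t%:E < transport_cost p mu (empirical (X^~ w) N))%E].
Proof.
case: N => [|n].
  pose T0 := transport_cost p mu (@empirical R d (fun=> ((0 : 'rV[R]_d) : Rd)) 0).
  case: (pselect (t%:E < T0)%E) => h.
    by rewrite (_ : [set _ | _] = setT)//; apply/seteqP; split.
  by rewrite (_ : [set _ | _] = set0)//; apply/seteqP; split.
rewrite (_ : [set _ | _] = ~` \bigcap_k
    [set w | (transport_cost p mu (empirical (X^~ w) n.+1) < (t + k.+1%:R^-1)%:E)%E]).
  apply: measurableC; apply: bigcap_measurable => //.
  by move=> k _; exact: measurable_transport_lt.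
apply/seteqP; split => w /=.
  move=> tw H; case E : (transport_cost p mu (empirical (X^~ w) n.+1)) tw H => [r| |]// tr H.
  - rewrite lte_fin in tr.
    have [k kr] : exists k, t + k.+1%:R^-1 <= r.
      exists (Num.truncn (r - t)^-1).
      have rt : 0 < r - t by rewrite subr_gt0.
      have := Num.Theory.truncnS_gt (r - t)^-1; set k := Num.truncn _ => h.
      rewrite -lerBrDl -[leRHS]invrK lef_pV2 ?posrE ?invr_gt0//; exact: ltW.
    by have := H k Logic.I; rewrite /= E lte_fin ltNge kr.
  - by have := H 0%N Logic.I; rewrite /= E.
move=> H; rewrite ltNge; apply/negP => tw; apply: H => k _ /=.
by apply: le_lt_trans tw _; rewrite lte_fin ltrDl invr_gt0.
Qed.

End transport_measurable.

(** * Numerical estimates *)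

Section numeric.
Context (R : realType).
Implicit Types (a b p q u x : R).

Lemma powR_le_expR q a b : 0 <= q -> 0 < a -> 0 < b ->
  exists2 C : R, 0 < C & forall u, 0 <= u -> u `^ q <= C * expR (a * u `^ b).
Proof.
move=> q0 a0 b0; pose k := (Num.truncn (q / b)).+1.
have qk : q / b <= k%:R by apply/ltW; exact: Num.Theory.truncnS_gt.
have k0 : 0 < k`!%:R / a ^+ k :> R by rewrite divr_gt0 ?ltr0n ?fact_gt0// exprn_gt0.
exists (1 + k`!%:R / a ^+ k) => [|u u0]; first by rewrite addr_gt0.
set v := u `^ b; have v0 : 0 <= v by exact: powR_ge0.
have -> : u `^ q = v `^ (q / b).
  by rewrite /v -powRrM mulrCA divff ?mulr1// gt_eqF.
have av0 : 0 <= a * v by rewrite mulr_ge0// ltW.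
have e1 : 1 <= expR (a * v) by rewrite -expR0 ler_expR.
have vk : v ^+ k <= k`!%:R / a ^+ k * expR (a * v).
  have := expR_ge1Dxn k.-1 av0; rewrite -/k => h.
  have h2 : (a * v) ^+ k / k`!%:R <= expR (a * v).
    by apply: le_trans h; rewrite lerDr.
  have kf : 0 < k`!%:R :> R by rewrite ltr0n fact_gt0.
  move: h2; rewrite exprMn ler_pdivrMr// => h2.
  by rewrite mulrAC ler_pdivlMr ?exprn_gt0// mulrC [leRHS]mulrC.
rewrite mulrDl mul1r; case: (leP v 1) => v1.
  apply: (@le_trans _ _ 1).
    apply: (@le_trans _ _ (1 `^ (q / b))); last by rewrite powR1.
    by apply: ge0_ler_powR; rewrite ?nnegrE// divr_ge0// ltW.
  by apply: le_trans e1 _; rewrite lerDl mulr_ge0 ?expR_ge0// ltW.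
apply: (@le_trans _ _ (v ^+ k)).
  by rewrite -powR_mulrn//; apply: ler_powR => //; exact: ltW.
by apply: le_trans vk _; rewrite lerDr expR_ge0.
Qed.

Lemma geometric_sum_le (r : R) n : 0 <= r -> r < 1 ->
  \sum_(l < n) r ^+ l <= (1 - r)^-1.
Proof.
move=> r0 r1; rewrite -[leRHS]div1r ler_pdivlMr ?subr_gt0//.
have := subrX1 r n; have := exprn_ge0 n r0; set S := \sum_(i < n) _; lra.
Qed.

Lemma double_exp_sum (Z : R) A (B : nat -> nat) : 1 <= Z ->
  \sum_(n < A) \sum_(l < B n) expR (- (Z * (n + l).+1%:R)) <= 4 * expR (- Z).
Proof.
move=> Z1; pose q := expR (- Z).
have q0 : 0 <= q by exact: expR_ge0.
have q2 : q <= 2^-1.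
  rewrite /q expRN lef_pV2 ?posrE ?expR_gt0//.
  by apply: le_trans (expR_ge1Dx Z); lra.
have term (n l : nat) : expR (- (Z * (n + l).+1%:R)) = q * (q ^+ n * q ^+ l).
  by rewrite /q -!expRM_natl -!expRD; congr expR; rewrite -natr1 natrD; ring.
have inv : (1 - q)^-1 <= 2.
  by rewrite -[leRHS]invrK lef_pV2 ?posrE; lra.
have geo n : \sum_(l < n) q ^+ l <= 2.
  by apply: le_trans inv; apply: geometric_sum_le => //; lra.
apply: (@le_trans _ _ (\sum_(n < A) q * q ^+ n * 2)).
  apply: ler_sum => n _.
  under eq_bigr do rewrite term mulrA.
  by rewrite -mulr_sumr ler_wpM2l// mulr_ge0// exprn_ge0.
rewrite -mulr_suml -mulr_sumr; have := geo A; set S := \sum_(i < A) _.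
by move=> S2; have := ler_wpM2l q0 S2; rewrite -/q; lra.
Qed.

Section rate.
Variables (d : nat) (p : R).
Hypotheses (d_ge1 : (1 <= d)%N) (p_gt0 : 0 < p).

Let ln_gt0' x : 0 < x -> 0 < ln (2 + x^-1).
Proof. by move=> x0; apply: ln_gt0; rewrite ltr_pwDr ?invr_gt0//; lra. Qed.

Let ln_le x : 0 < x -> ln 2 <= ln (2 + x^-1).
Proof.
move=> x0; have xi : 0 < x^-1 by rewrite invr_gt0.
by rewrite ler_ln ?posrE//; [rewrite lerDl ltW|rewrite addr_gt0].
Qed.

Lemma rate_gt0 x : 0 < x -> 0 < rate d p x.
Proof.
move=> x0; rewrite /rate; case: ifP => _; first exact: exprn_gt0.
by case: ifP => _; [rewrite exprn_gt0// divr_gt0// ln_gt0'|exact: powR_gt0].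
Qed.

Lemma rate_le_sqr : exists2 C : R, 0 < C &
  forall x, 0 < x -> x <= 1 -> rate d p x <= C * x ^+ 2.
Proof.
have l2 : 0 < ln 2 :> R by apply: ln_gt0; lra.
exists (1 + (ln 2) ^- 2) => [|x x0 x1]; first by rewrite addr_gt0// invr_gt0 exprn_gt0.
have x20 : 0 <= x ^+ 2 by exact: sqr_ge0.
have l20 : 0 <= (ln 2) ^- 2 :> R by rewrite invr_ge0 sqr_ge0.
rewrite mulrDl mul1r /rate; case: ifP => h1; first by rewrite lerDl mulr_ge0.
case: ifP => h2.
  apply: (@le_trans _ _ ((ln 2) ^- 2 * x ^+ 2)); last by rewrite lerDr.
  rewrite expr_div_n mulrC ler_wpM2r// lef_pV2 ?posrE ?exprn_gt0 ?ln_gt0'//.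
  by rewrite ler_sqr ?nnegrE ?(ltW l2) ?(ltW (ln_gt0' x0))// ln_le.
apply: (@le_trans _ _ (x ^+ 2)); last by rewrite lerDl mulr_ge0.
rewrite -[leRHS]powR_mulrn ?(ltW x0)//.
have xx : 0 < x <= 1 by rewrite x0.
apply: (ger_powR xx).
move/negbT: h1; rewrite -leNgt => h1; rewrite ler_pdivlMr//.
by move: h1; rewrite ler_pdivlMr// mulrC.
Qed.

Lemma rate_sum (K : R) : 1 <= K -> exists2 C : R, 0 < C &
  forall x H, 0 < x -> x <= 1 -> (2 `^ p) ^+ H <= K / x ->
  Num.sqrt (rate d p x) * \sum_(l < H.+1) (2 `^ (d%:R / 2) / 2 `^ p) ^+ l <= C * x.
Proof.
move=> K1; rewrite /rate.
have p2 : 0 < 2 `^ p :> R by exact: powR_gt0.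
set r := 2 `^ (d%:R / 2) / 2 `^ p.
have r0 : 0 < r by rewrite divr_gt0// powR_gt0.
have rE : r = 2 `^ (d%:R / 2 - p).
  by rewrite powRB// (_ : 2 != 0)// implybT.
case: (ltP (d%:R / 2) p) => [dp|pd].
  have r1 : r < 1.
    rewrite /r ltr_pdivrMr// mul1r /powR gt_eqF// ltr_expR ltr_pM2r//.
    by apply: ln_gt0; lra.
  exists (1 - r)^-1 => [|x H x0 x1 _]; first by rewrite invr_gt0 subr_gt0.
  rewrite sqrtr_sqr ger0_norm ?(ltW x0)// mulrC ler_wpM2r ?(ltW x0)//.
  exact: geometric_sum_le (ltW r0) r1.
have l2 : 0 < ln 2 :> R by apply: ln_gt0; lra.
case: (eqVneq p (d%:R / 2)) => [dp|dp].
  pose C : R := (ln K / (p * ln 2) + 1) / ln 2 + (p * ln 2)^-1.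
  have pl0 : 0 < p * ln 2 by rewrite mulr_gt0.
  have lK : 0 <= ln K by exact: ln_ge0.
  have C0 : 0 < C.
    by rewrite ltr_pwDr ?invr_gt0// divr_ge0 ?(ltW l2)// addr_ge0// divr_ge0// ltW.
  exists C => // x H x0 x1 HK.
  have lx : 0 < ln (2 + x^-1) by exact: ln_gt0'.
  have -> : r = 1 by rewrite rE -dp subrr powRr0.
  under eq_bigr do rewrite expr1n.
  rewrite sumr_const card_ord sqrtr_sqr ger0_norm ?(divr_ge0 (ltW x0) (ltW lx))//.
  rewrite mulrAC ler_pdivrMr// [leRHS](_ : _ = x * (C * ln (2 + x^-1))); last by ring.
  rewrite ler_pM2l//.
  have l2x := ln_le x0.
  have Hl : H%:R * (p * ln 2) <= ln K + ln (2 + x^-1).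
    have : ln ((2 `^ p) ^+ H) <= ln (K / x).
      by rewrite ler_ln ?posrE ?exprn_gt0 ?divr_gt0//; lra.
    rewrite lnXn// ln_powR mulr_natl => h; apply: le_trans h _.
    rewrite lnM ?posrE ?invr_gt0//; last lra.
    by rewrite lerD2l ler_ln ?posrE ?addr_gt0 ?invr_gt0//; lra.
  have -> : 1 *+ H.+1 = H%:R + 1 :> R by rewrite natr1.
  have H2 : H%:R <= (ln K + ln (2 + x^-1)) / (p * ln 2) by rewrite ler_pdivlMr.
  set y := ln (2 + x^-1) in lx l2x H2 *.
  have h1 : 1 <= y / ln 2 by rewrite ler_pdivlMr// mul1r.
  have kp : 0 <= ln K / (p * ln 2) + 1 by rewrite addr_ge0// divr_ge0// ltW.
  have := ler_wpM2l kp h1; rewrite mulr1 => h3.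
  have -> : C * y = (ln K / (p * ln 2) + 1) * (y / ln 2) + y / (p * ln 2) by rewrite /C; ring.
  apply: (@le_trans _ _ ((ln K + y) / (p * ln 2) + 1)); first by rewrite lerD2r.
  by rewrite mulrDl addrAC lerD2r.
have pd' : p < d%:R / 2 by rewrite lt_neqAle dp.
have r1 : 1 < r.
  rewrite /r ltr_pdivlMr// mul1r /powR gt_eqF// ltr_expR ltr_pM2r//.
pose e : R := (d%:R / 2 - p) / p.
have e0 : 0 < e by rewrite divr_gt0// subr_gt0.
exists (r / (r - 1) * K `^ e) => [|x H x0 x1 HK].
  by rewrite mulr_gt0 ?divr_gt0 ?powR_gt0//; lra.
have rH : r ^+ H = ((2 `^ p) ^+ H) `^ e.
  rewrite -!powR_mulrn ?(ltW r0) ?(ltW p2)// rE -!powRrM; congr (_ `^ _); rewrite /e; field.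
  by rewrite gt_eqF.
have rHK : r ^+ H <= (K / x) `^ e.
  rewrite rH; apply: ge0_ler_powR => //; rewrite ?nnegrE ?exprn_ge0 ?(ltW p2) ?(ltW e0)//.
  by rewrite divr_ge0 ?(ltW x0)//; lra.
have sumr : \sum_(l < H.+1) r ^+ l <= r / (r - 1) * r ^+ H.
  rewrite mulrAC ler_pdivlMr ?subr_gt0// -exprS mulrC -subrX1.
  by rewrite gerBl.
have sE : Num.sqrt (x `^ (d%:R / p)) = x * x `^ e.
  rewrite -powR12_sqrt ?powR_ge0// -powRrM; transitivity (x `^ (1 + e)).
    by congr (_ `^ _); rewrite /e; field; rewrite gt_eqF.
  by rewrite powRD ?powRr1 ?(ltW x0)// (gt_eqF x0) implybT.
rewrite sE.
apply: (@le_trans _ _ (x * x `^ e * (r / (r - 1) * (K / x) `^ e))).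
  apply: ler_wpM2l; first by rewrite mulr_ge0 ?powR_ge0// ltW.
  apply: le_trans sumr _; apply: ler_wpM2l => //; rewrite divr_ge0//; lra.
have xK : x `^ e * (K / x) `^ e = K `^ e.
  rewrite -powRM ?(ltW x0)//; first by rewrite mulrCA divff ?mulr1// gt_eqF.
  by rewrite divr_ge0 ?(ltW x0)//; lra.
by rewrite -xK le_eqVlt; apply/orP; left; apply/eqP; ring.
Qed.

End rate.
End numeric.

(** * Tails of sums with exponential moments *)

Lemma int_le_cst d (T : measurableType d) (R : realType) (m : probability T R) (k : R) :
  0 <= k -> int_le m (fun=> k) k.
Proof.
move=> k0; split => //; rewrite (integral_cst m measurableT k%:E).
rewrite [X in (_ * X <= _)%E](_ : _ = 1%E); last exact: probability_setT.
by rewrite mule1.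
Qed.

Lemma int_le_bound d (T : measurableType d) (R : realType)
  (m : {measure set T -> \bar R}) (f : T -> R) (a b : R) :
  a <= b -> int_le m f a -> int_le m f b.
Proof. by move=> ab [mf f0 fa]; split => //; apply: le_trans fa _; rewrite lee_fin. Qed.

Section tails.
Context d d' (Omega : measurableType d) (T : measurableType d') (R : realType).
Variables (P : probability Omega R) (mu : probability T R) (X : nat -> {RV P >-> T}).
Hypothesis iidX : iid X mu.

Lemma bernstein_exp (W : T -> R) (m C2 l0 l s : R) N :
  int_le mu W m -> int_le mu (fun y => W y ^+ 2 * expR (l0 * W y)) C2 ->
  0 <= l -> l <= l0 ->
  (P [set w | (N%:R * s <= \sum_(i < N) W (X i w))%R] <=
   (expR (- (N%:R * (l * s - l * m - l ^+ 2 * C2))))%:E)%E.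
Proof.
move=> Wm W2 l_ge0 ll0; have [mW W0 _] := Wm.
pose B := 1 + (l * m + l ^+ 2 * C2).
have m0 : 0 <= m.
  rewrite -lee_fin; case: Wm => _ _; apply: le_trans.
  by apply: integral_ge0 => y _; rewrite lee_fin.
have C20 : 0 <= C2.
  rewrite -lee_fin; case: W2 => _ W20; apply: le_trans.
  by apply: integral_ge0 => y _; rewrite lee_fin.
have ml : measurable_fun setT (fun y => expR (l * W y)).
  by apply: measurableT_comp => //; exact: measurable_funM.
have IB : int_le mu (fun y => expR (l * W y)) B.
  apply: (@int_le_le _ _ _ _ _ (fun y => 1 + (l * W y + l ^+ 2 * (W y ^+ 2 * expR (l0 * W y))))) => //.
  - move=> y; apply: le_trans (expR_le_exp_quad (mulr_ge0 l_ge0 (W0 y))) _.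
    rewrite -addrA lerD2l lerD2l exprMn mulrA ler_wpM2l ?mulr_ge0 ?sqr_ge0//.
    by rewrite ler_expR ler_wpM2r.
  - apply: int_leD; first exact: int_le_cst.
    by apply: int_leD; apply: int_leZ => //; exact: sqr_ge0.
have B0 : 0 <= B by rewrite !addr_ge0 ?mulr_ge0 ?sqr_ge0.
case: IB => _ _ /(chernoff_iid iidX (N%:R * s) N mW l_ge0) H.
apply: le_trans H _; rewrite lee_fin.
apply: (@le_trans _ _ (expR (- (l * (N%:R * s))) * expR (l * m + l ^+ 2 * C2) ^+ N)).
  rewrite ler_wpM2l ?expR_ge0// lerXn2r ?nnegrE ?expR_ge0//.
  exact: expR_ge1Dx.
by rewrite -expRM_natl -expRD ler_expR le_eqVlt; apply/orP; left; apply/eqP; ring.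
Qed.

Lemma measure_gt_powR (nrm W : T -> R) (p a beta E0 t : R) i :
  0 < p -> 0 < a -> 0 < beta -> 0 <= t ->
  measurable_fun setT nrm -> measurable_fun setT W ->
  (forall y, 0 <= nrm y) -> (forall y, W y <= nrm y `^ p) ->
  int_le mu (fun y => expR (a * nrm y `^ beta)) E0 ->
  (P [set w | (t < W (X i w))%R] <= (E0 * expR (- (a * t `^ (beta / p))))%:E)%E.
Proof.
move=> p0 a0 beta0 t0 mn mW n0 Wn HE.
have mS : measurable [set y | t < W y] by exact: measurable_set_gt.
have -> : P [set w | t < W (X i w)] = mu [set y | t < W y].
  exact: (iidX.2 i _ mS).
have : int_le mu (\1_[set y | t < W y] : T -> R) (expR (- (a * t `^ (beta / p))) * E0).
  apply: (int_le_le _ _ _ (int_leZ (expR_ge0 _) HE)) => //.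
  move=> y; rewrite indicE; case: (boolP (y \in _)) => [|_]; last by rewrite mulr_ge0 ?expR_ge0.
    rewrite inE /= => ty; rewrite -expRD -expR0 ler_expR addrC subr_ge0 ler_pM2l//.
    have -> : nrm y `^ beta = (nrm y `^ p) `^ (beta / p).
      by rewrite -powRrM mulrCA divff ?mulr1// gt_eqF.
    apply: ge0_ler_powR; rewrite ?nnegrE ?powR_ge0//; first by rewrite divr_ge0 ?ltW.
    by apply: le_trans (Wn y); exact: ltW.
case=> _ _; rewrite integral_indic// setIT mulrC => H; exact: H.
Qed.

End tails.

Lemma exp_moment_bound (R : realType) (p a beta : R) : 0 < p -> 0 < a -> 0 < beta ->
  exists2 C : R, 0 < C & forall u w l : R, 0 <= u -> 0 <= w -> w <= u `^ p ->
    l * w <= a / 2 * (1 + u `^ beta) ->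
    w ^+ 2 * expR (l * w) <= C * expR (a * u `^ beta).
Proof.
move=> p0 a0 b0; have a20 : 0 < a / 2 by rewrite divr_gt0.
have p20 : 0 <= p * 2 by rewrite mulr_ge0// ltW.
have [C C0 HC] := powR_le_expR p20 a20 b0.
exists (C * expR (a / 2)) => [|u w l u0 w0 wu lw]; first by rewrite mulr_gt0 ?expR_gt0.
have w2 : w ^+ 2 <= C * expR (a / 2 * u `^ beta).
  apply: le_trans (HC u u0); rewrite powRrM powR_mulrn ?powR_ge0//.
  by rewrite lerXn2r// nnegrE ?powR_ge0.
have e1 : expR (l * w) <= expR (a / 2) * expR (a / 2 * u `^ beta).
  by rewrite -expRD ler_expR; apply: le_trans lw _; rewrite mulrDr mulr1.
apply: le_trans (ler_pM (sqr_ge0 _) (expR_ge0 _) w2 e1) _.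
rewrite le_eqVlt; apply/orP; left; apply/eqP.
have -> : a * u `^ beta = a / 2 * u `^ beta + a / 2 * u `^ beta by field.
by rewrite expRD; ring.
Qed.

Lemma tail_light (R : realType) (p a beta E0 k : R) :
  0 < p -> 0 < a -> p <= beta -> 0 < E0 -> 0 < k ->
  exists2 c : R, 0 < c & forall d d' (Omega : measurableType d) (T : measurableType d')
    (P : probability Omega R) (mu : probability T R) (X : nat -> {RV P >-> T})
    (nrm W : T -> R) (N : nat) (x : R), iid X mu ->
  measurable_fun setT nrm -> (forall y, 0 <= nrm y) -> (forall y, W y <= nrm y `^ p) ->
  int_le mu (fun y => expR (a * nrm y `^ beta)) E0 ->
  0 < x -> x <= 1 -> int_le mu W (k * x) ->
  (P [set w | (N%:R * (2 * k * x) <= \sum_(i < N) W (X i w))%R] <=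
   (expR (- (c * N%:R * x ^+ 2)))%:E)%E.
Proof.
move=> p0 a0 pb E00 k0; have b0 : 0 < beta by exact: lt_le_trans pb.
have [C C0 HC] := exp_moment_bound p0 a0 b0.
pose C2 := C * E0; have C20 : 0 < C2 by rewrite mulr_gt0.
pose dl := Num.min (a / 2) (k / (2 * C2)).
have dl0 : 0 < dl by rewrite lt_min !divr_gt0// mulr_gt0.
have dlC : dl * C2 <= k / 2.
  apply: (@le_trans _ _ (k / (2 * C2) * C2)); first by rewrite ler_wpM2r ?(ltW C20)// ge_min lexx orbT.
  by rewrite le_eqVlt; apply/orP; left; apply/eqP; field; rewrite gt_eqF.
exists (dl * (k / 2)) => [|d d' Omega T P mu X nrm W N x iidX mn n0 Wn HE x0 x1 Wk].
  by rewrite mulr_gt0// divr_gt0.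
have [mW W0 _] := Wk.
have W2 : int_le mu (fun y => W y ^+ 2 * expR (a / 2 * W y)) C2.
  apply: (int_le_le _ _ _ (int_leZ (ltW C0) HE)).
  - apply: measurable_funM; first exact: measurable_funX.
    by apply: measurableT_comp => //; exact: measurable_funM.
  - by move=> y; rewrite mulr_ge0 ?sqr_ge0 ?expR_ge0.
  move=> y; apply: HC => //; apply: ler_wpM2l; first by rewrite divr_ge0// ltW.
  apply: le_trans (Wn y) _; case: (leP (nrm y) 1) => ny.
    apply: (@le_trans _ _ 1); last by rewrite lerDl powR_ge0.
    apply: (@le_trans _ _ (1 `^ p)); last by rewrite powR1.
    by apply: ge0_ler_powR; rewrite ?nnegrE// ltW.
  apply: (@le_trans _ _ (nrm y `^ beta)); last by rewrite lerDr.
  by apply: ler_powR => //; exact: ltW.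
have l_ge0 : 0 <= dl * x by rewrite mulr_ge0// ltW.
have ll0 : dl * x <= a / 2.
  apply: (@le_trans _ _ dl); last by rewrite ge_min lexx.
  by rewrite ler_piMr// ltW.
apply: le_trans (bernstein_exp iidX (2 * k * x) N Wk W2 l_ge0 ll0) _.
rewrite lee_fin ler_expR lerN2.
have -> : dl * x * (2 * k * x) - dl * x * (k * x) - (dl * x) ^+ 2 * C2 =
   dl * x ^+ 2 * (k - dl * C2) by ring.
rewrite (_ : dl * (k / 2) * N%:R * x ^+ 2 = N%:R * (dl * x ^+ 2 * (k / 2))); last by ring.
apply: ler_wpM2l => //; apply: ler_wpM2l; first by apply: mulr_ge0; [exact: ltW|exact: sqr_ge0].
by rewrite lerBrDr -lerBrDl (_ : k - k / 2 = k / 2)//; field.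
Qed.

Lemma tail_heavy (R : realType) (p a beta E0 : R) :
  0 < p -> 0 < a -> 0 < beta -> beta < p -> 0 < E0 ->
  exists2 C2 : R, 0 < C2 & forall d d' (Omega : measurableType d) (T : measurableType d')
    (P : probability Omega R) (mu : probability T R) (X : nat -> {RV P >-> T})
    (nrm W : T -> R) (N : nat) (s : R), iid X mu -> (0 < N)%N ->
  measurable_fun setT nrm -> (forall y, 0 <= nrm y) -> (forall y, W y <= nrm y `^ p) ->
  int_le mu (fun y => expR (a * nrm y `^ beta)) E0 ->
  0 < s -> int_le mu W (s / 2) ->
  (P [set w | (N%:R * s <= \sum_(i < N) W (X i w))%R] <=
   (N%:R * (E0 * expR (- (a * (N%:R * s) `^ (beta / p)))) +
    (expR (- (a / 8 * (N%:R * s) `^ (beta / p))) +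
     expR (- (N%:R * s ^+ 2 / (16 * C2)))))%:E)%E.
Proof.
move=> p0 a0 b0 bp E00.
have [C C0 HC] := exp_moment_bound p0 a0 b0.
pose C2 := C * E0; have C20 : 0 < C2 by rewrite mulr_gt0.
exists C2 => // d d' Omega T P mu X nrm W N s iidX N0 mn n0 Wn HE s0 Ws.
have [mW W0 _] := Ws.
have NR : 0 < N%:R :> R by rewrite ltr0n.
pose t := N%:R * s; have t0 : 0 < t by rewrite mulr_gt0.
pose r := beta / p; have r0 : 0 < r by rewrite divr_gt0.
have r1 : r < 1 by rewrite ltr_pdivrMr// mul1r.
pose W' y := W y * (W y <= t)%R%:R.
have W'0 y : 0 <= W' y by rewrite mulr_ge0.
have W'W y : W' y <= W y by rewrite ler_piMr// lern1 leq_b1.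
have W't y : W' y <= t.
  by rewrite /W'; case: (leP (W y) t) => h; rewrite ?mulr1 ?mulr0 ?(ltW t0)//.
have mind : measurable_fun setT (fun y => (W y <= t)%R%:R : R).
  rewrite (_ : (fun _ => _) = \1_(~` [set y | t < W y])).
    by apply: measurable_indic; apply: measurableC; exact: measurable_set_gt.
  apply/funext => y; rewrite indicE in_setC; congr (nat_of_bool _)%:R.
  rewrite leNgt; congr (~~ _); apply/idP/idP => [h|]; first exact: mem_set.
  by rewrite inE.
have mW' : measurable_fun setT W' by exact: measurable_funM.
pose l0 := a / 2 * t `^ (r - 1).
have tr0 : 0 < t `^ (r - 1) by exact: powR_gt0.
have l00 : 0 < l0 by rewrite mulr_gt0// divr_gt0.
have l0W y : l0 * W' y <= a / 2 * (1 + nrm y `^ beta).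
  rewrite /l0 -mulrA; apply: ler_wpM2l; first by rewrite divr_ge0// ltW.
  apply: (@le_trans _ _ (nrm y `^ beta)); last by rewrite lerDr.
  have -> : nrm y `^ beta = (nrm y `^ p) `^ r.
    by rewrite -powRrM mulrCA divff ?mulr1// gt_eqF.
  apply: (@le_trans _ _ (W' y `^ r)); last first.
    apply: ge0_ler_powR; rewrite ?nnegrE ?powR_ge0// ?(ltW r0)//.
    exact: le_trans (W'W y) (Wn y).
  have [->|Wn0] := eqVneq (W' y) 0; first by rewrite mulr0 powR_ge0.
  have Wp : 0 < W' y by rewrite lt_neqAle eq_sym Wn0 W'0.
  have -> : W' y `^ r = W' y `^ (r - 1) * W' y.
    by rewrite -[X in _ * X](powRr1 (W'0 y)) -powRD ?subrK// Wn0 implybT.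
  apply: ler_wpM2r => //.
  rewrite -(opprB 1 r) !powRN lef_pV2 ?posrE ?powR_gt0//.
  by apply: ge0_ler_powR; rewrite ?nnegrE ?subr_ge0// ltW.
have W2 : int_le mu (fun y => W' y ^+ 2 * expR (l0 * W' y)) C2.
  apply: (int_le_le _ _ _ (int_leZ (ltW C0) HE)).
  - apply: measurable_funM; first exact: measurable_funX.
    by apply: measurableT_comp => //; exact: measurable_funM.
  - by move=> y; rewrite mulr_ge0 ?sqr_ge0 ?expR_ge0.
  by move=> y; apply: HC => //; exact: le_trans (W'W y) (Wn y).
have W's : int_le mu W' (s / 2) by exact: (int_le_le mW' W'0 W'W Ws).
have msum (V : T -> R) : measurable_fun setT V ->
    measurable [set w | N%:R * s <= \sum_(i < N) V (X i w)].
  move=> mV; apply: measurable_set_ge; apply: measurable_sum => i.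
  have mX : measurable_fun setT (X i) by exact: measurable_funPT.
  exact: measurableT_comp.
have mbig i : measurable [set w | t < W (X i w)].
  have mX : measurable_fun setT (X i) by exact: measurable_funPT.
  by apply: measurable_set_gt; exact: measurableT_comp.
pose A2 := [set w | N%:R * s <= \sum_(i < N) W' (X i w)].
pose A1 := \bigcup_(i in [set: 'I_N]) [set w | t < W (X i w)].
have mA1 : measurable A1 by apply: fin_bigcup_measurable => //; exact: finite_finset.
have mA2 : measurable A2 by exact: msum.
apply: (@le_trans _ _ (P A1 + P A2)%E).
  have := @measure_fin_union_bound _ _ _ P bool [set w | N%:R * s <= \sum_(i < N) W (X i w)]
    (fun b => if b then A1 else A2).
  rewrite big_bool; apply; [exact: msum|by case|].
  move=> w /= Nw; case: (pselect (A1 w)) => [A1w|NA1]; first by exists true.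
  exists false => //=; rewrite /A2/=.
  rewrite (eq_bigr (fun i : 'I_N => W (X i w)))// => i _.
  rewrite /W' (_ : (W (X i w) <= t) = true) ?mulr1// leNgt; apply/negP => h.
  by apply: NA1; exists i.
rewrite EFinD; apply: leeD.
  apply: (@le_trans _ _ (\sum_(i < N) P [set w | (t < W (X i w))%R])%E).
    by apply: measure_fin_union_bound => //; move=> w [i _ iw]; exists i.
  apply: (@le_trans _ _ (\sum_(i < N) (E0 * expR (- (a * t `^ (beta / p))))%:E)%E).
    by apply: lee_sum => i _; apply: (measure_gt_powR iidX _ p0 a0 b0 (ltW t0) mn mW n0 Wn HE).
  by rewrite sumEFin lee_fin sumr_const card_ord mulr_natl.
pose l := Num.min l0 (s / (4 * C2)).
have l_ge0 : 0 <= l by rewrite le_min (ltW l00) divr_ge0 ?(ltW s0)// mulr_ge0// ltW.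
have ll0 : l <= l0 by rewrite ge_min lexx.
have lC : l * C2 <= s / 4.
  apply: (@le_trans _ _ (s / (4 * C2) * C2)).
    by rewrite ler_wpM2r ?(ltW C20)// ge_min lexx orbT.
  by rewrite le_eqVlt; apply/orP; left; apply/eqP; field; rewrite gt_eqF.
apply: le_trans (bernstein_exp iidX s N W's W2 l_ge0 ll0) _; rewrite lee_fin.
have bnd : l * s / 4 <= l * s - l * (s / 2) - l ^+ 2 * C2.
  have := ler_wpM2l l_ge0 lC.
  have -> : l * s - l * (s / 2) - l ^+ 2 * C2 = l * s / 2 - l * (l * C2) by field.
  have -> : l * s / 4 = l * s / 2 - l * (s / 4) by field.
  by rewrite lerD2l lerN2.
apply: (@le_trans _ _ (expR (- (N%:R * (l * s / 4))))).
  by rewrite ler_expR lerN2 ler_wpM2l// ltW.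
rewrite /l; case: (leP l0 (s / (4 * C2))) => h.
  have -> : N%:R * (l0 * s / 4) = a / 8 * t `^ r.
    have -> : t `^ r = t `^ (r - 1) * t.
      by rewrite -[X in _ = _ * X](powRr1 (ltW t0)) -powRD ?subrK// gt_eqF ?implybT.
    by rewrite /l0 /t; field.
  by rewrite lerDl expR_ge0.
have -> : N%:R * (s / (4 * C2) * s / 4) = N%:R * s ^+ 2 / (16 * C2).
  by field; rewrite gt_eqF.
by rewrite lerDr expR_ge0.
Qed.

(** * Deviations for small x *)

Lemma cell_count_le d l : (0 < d)%N ->
  (((2 ^ l.+1).+1 ^ d).+1 <= 2 * 4 ^ d * 2 ^ (d * l))%N.
Proof.
move=> d0; have h1 : ((2 ^ l.+1).+1 <= 4 * 2 ^ l)%N.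
  rewrite expnS; have : (0 < 2 ^ l)%N by rewrite expn_gt0.
  by move: (2 ^ l)%N => q; lia.
have h2 : ((2 ^ l.+1).+1 ^ d <= 4 ^ d * 2 ^ (d * l))%N.
  by rewrite (mulnC d l) expnM -expnMn leq_exp2r.
have h3 : (0 < (2 ^ l.+1).+1 ^ d)%N by rewrite expn_gt0.
rewrite -mulnA mul2n -addnn; exact: (leq_add (leq_trans h3 h2) h2).
Qed.

Section cells_probability.
Context (R : realType) (d : nat) (p : R) (disp : measure_display)
  (Omega : measurableType disp) (P : probability Omega R)
  (mu : probability (Rd R d) R) (X : nat -> {RV P >-> Rd R d}).
Hypotheses (d_ge1 : (1 <= d)%N) (p_gt0 : 0 < p) (iidX : iid X mu).
Local Notation rho := (2 `^ p : R).
Local Notation D := (2 `^ (d%:R / 2) : R).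

Definition cell_deviation N (n l : nat) (w : Omega) : R :=
  \sum_(c : {ffun 'I_d -> 'I_(2 ^ l.+1).+1})
    `|N%:R^-1 * \sum_(i < N) \1_(cell n l (fun j => c j)) (X i w) -
      fine (mu (cell n l (fun j => c j)))|.

Lemma cells_probability N (K s : R) (m n1 : nat) (L : nat -> nat) :
  (0 < N)%N -> 0 < s -> 0 < K -> 2 <= rho ^+ m ->
  (forall n, fine (mu (shell n)) <= K / rho ^+ ((m + 4) * n)) ->
  (forall n l, (n < n1.+1)%N -> (l < (L n).+1)%N ->
     s / rho ^+ (2 * n) * D ^+ l <= 4 * (K / rho ^+ ((m + 4) * n))) ->
  4 ^+ d.+1 <= N%:R * s ^+ 2 / (32 * K) ->
  (P (\bigcup_(u in [set: {n : 'I_n1.+1 & 'I_(L n).+1}])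
     [set w | (s / rho ^+ (2 * tag u) * D ^+ tagged u <
               cell_deviation N (tag u) (tagged u) w)%R]) <=
   (4 * expR (- (N%:R * s ^+ 2 / (64 * K))))%:E)%E.
Proof.
move=> N0 s0 K0 rho2 shellK tK Zbig.
have NR : 0 < N%:R :> R by rewrite ltr0n.
have rho0 : 0 < rho by exact: powR_gt0.
have D0 : 0 < D by exact: powR_gt0.
have DE l : (D ^+ l) ^+ 2 = 2 ^+ (d * l).
  rewrite -exprM mulnC exprM -[D ^+ 2]powR_mulrn ?powR_ge0// -powRrM divfK ?pnatr_eq0//.
  by rewrite powR_mulrn// -exprM.
pose Z := N%:R * s ^+ 2 / (32 * K).
have Z4 : 4 ^+ d.+1 <= Z by [].
have Z1 : 1 <= Z / 2.
  have : 4 <= 4 ^+ d.+1 :> R by rewrite exprS ler_peMr// exprn_ege1//; lra.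
  move: Z4; clearbody Z; lra.
pose E (u : {n : 'I_n1.+1 & 'I_(L n).+1}) :=
  [set w | s / rho ^+ (2 * tag u) * D ^+ tagged u < cell_deviation N (tag u) (tagged u) w].
have mE u : measurable (E u).
  apply: measurable_set_gt; apply: measurable_sum => c.
  apply: measurableT_comp => //; apply: measurable_funB => //.
  apply: measurable_funM => //; apply: measurable_sum => i.
  have mX : measurable_fun setT (X i) by exact: measurable_funPT.
  by apply: measurable_indic_comp => //; exact: measurable_cell.
apply: (@le_trans _ _ (\sum_u P (E u))%E).
  apply: measure_fin_union_bound => //.
  by apply: fin_bigcup_measurable => [|u _]; [exact: finite_finset|exact: mE].
apply: (@le_trans _ _ (\sum_(u : {n : 'I_n1.+1 & 'I_(L n).+1})
    (expR (- (Z / 2 * (tag u + tagged u).+1%:R)))%:E)%E).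
  apply: lee_sum => -[n l] _; rewrite /E /=.
  set t := s / _ * _.
  pose b := K / rho ^+ ((m + 4) * n).
  have b0 : 0 < b by rewrite divr_gt0// exprn_gt0.
  have t0 : 0 < t by rewrite mulr_gt0 ?divr_gt0 ?exprn_gt0.
  have tb : t <= 4 * b by exact: tK.
  have := @sum_deviation _ _ _ _ _ P mu X iidX {ffun 'I_d -> 'I_(2 ^ l.+1).+1}
    (fun c => cell n l (fun j => c j)) (shell n) b t N N0
    (fun c => measurable_cell _ _ _) (@trivIset_cell R d n l) (measurable_shell n)
    (fun c => @cell_in_shell _ _ _ _ _) (shellK n) t0 tb.
  move=> H; apply: (le_trans H); rewrite lee_fin {H}.
  have -> : N%:R * t ^+ 2 / (32 * b) = Z * (rho ^+ (m * n) * 2 ^+ (d * l)).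
    rewrite /t /b /Z exprMn DE expr_div_n mulnDl exprD.
    have -> : (rho ^+ (2 * n)) ^+ 2 = rho ^+ (4 * n) by rewrite -exprM mulnAC.
    by field; rewrite ?gt_eqF ?exprn_gt0.
  rewrite card_ffun !card_ord.
  have cardle : ((2 ^ l.+1).+1 ^ d).+1%:R <= 2 * 4 ^+ d * 2 ^+ (d * l) :> R.
    rewrite -!natrX -!natrM ler_nat.
    exact: cell_count_le.
  have two_pow (j : nat) : 2 ^+ j <= expR j%:R :> R.
    rewrite -[j%:R]mulr1 expRM_natl lerXn2r ?nnegrE ?expR_ge0//.
    by apply: le_trans (expR_ge1Dx 1); lra.
  apply: (@le_trans _ _ (expR (2 * 4 ^+ d * 2 ^+ (d * l)) *
      expR (- (Z * (rho ^+ (m * n) * 2 ^+ (d * l)))))).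
    rewrite ler_wpM2r ?expR_ge0//; apply: le_trans (two_pow _) _.
    by rewrite ler_expR.
  rewrite -expRD ler_expR.
  have r1 : 1 <= rho ^+ (m * n) by rewrite exprM exprn_ege1//; lra.
  have q0 : 0 <= 2 ^+ (d * l) :> R by exact: exprn_ge0.
  have big : (n + l).+1%:R <= rho ^+ (m * n) * 2 ^+ (d * l) :> R.
    apply: (@le_trans _ _ (2 ^+ n * 2 ^+ l)).
      by rewrite -exprD -natrX ler_nat ltn_expl.
    apply: ler_pM; [exact: exprn_ge0|exact: exprn_ge0| |].
      rewrite exprM; apply: lerXn2r; rewrite ?nnegrE//; apply: exprn_ge0; exact: ltW.
    by rewrite ler_weXn2l ?ler1n// leq_pmull.
  rewrite exprS in Z4.
  have Z0 : 0 <= Z / 2 by lra.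
  have := ler_wpM2l Z0 big.
  set y := rho ^+ _ * 2 ^+ _ => h.
  have qy : 2 ^+ (d * l) <= y by rewrite ler_peMl.
  have y0 : 0 <= y by exact: le_trans qy.
  have f1 : 2 * 4 ^+ d * 2 ^+ (d * l) <= Z / 2 * y.
    apply: ler_pM => //.
    by move: Z4; set v := 4 ^+ d; clearbody Z; lra.
  move: h f1; set z := Z * y; set e := _ * 2 ^+ _; set f := _ * _.+1%:R.
  have -> : Z / 2 * y = z / 2 by rewrite /z; field.
  clearbody z e f; lra.
rewrite sumEFin lee_fin.
have -> : N%:R * s ^+ 2 / (64 * K) = Z / 2 by rewrite /Z; field; rewrite gt_eqF.
apply: le_trans (double_exp_sum n1.+1 (fun n => (L n).+1) Z1).
by rewrite (sig_big_dep xpredT (fun _ => xpredT)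
  (fun (n : 'I_n1.+1) (l : 'I_(L n).+1) => expR (- (Z / 2 * (n + l).+1%:R)))).
Qed.

End cells_probability.

Lemma leq_divn_step H m : (H <= (m + 3) * (H %/ (m + 2)) + (m + 2))%N.
Proof. by have := @ltn_ceil H (m + 2); move: (H %/ _)%N => q; nia. Qed.

Lemma pow_floor (R : archiRealFieldType) (r y : R) : 1 < r -> 1 <= y ->
  exists H : nat, r ^+ H <= y /\ y < r ^+ H.+1.
Proof.
move=> r1 y1; have r0 : 0 < r - 1 by rewrite subr_gt0.
have bern n : 1 + n%:R * (r - 1) <= r ^+ n.
  elim: n => [|n IH]; first by rewrite mul0r addr0 expr0.
  have := ler_wpM2l (_ : 0 <= r) IH => /(_ (ltac:(lra))) h; rewrite exprS; apply: le_trans h.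
  have : 0 <= n%:R * (r - 1) * (r - 1) by rewrite !mulr_ge0// ltW.
  by rewrite -natr1; lra.
have ex : exists H, y < r ^+ H.+1.
  exists (Num.truncn (y / (r - 1))).
  apply: lt_le_trans (bern _).
  have := Num.Theory.truncnS_gt (y / (r - 1)); rewrite ltr_pdivrMr// => h.
  by apply: lt_trans h _; rewrite ltrDr.
exists (ex_minn ex); case: ex_minnP => H yH Hmin; split => //.
case: H yH Hmin => [|H] yH Hmin; first by rewrite expr0.
by rewrite leNgt; apply/negP => /Hmin; rewrite ltnn.
Qed.

Section cost_sums.
Context (R : realType) (rho : R).
Hypothesis rho1 : 1 < rho.
Let rho0 : 0 < rho. Proof. exact: lt_trans rho1. Qed.

Lemma sum_inv_powers_le n : \sum_(i < n) (rho ^+ i)^-1 <= rho / (rho - 1).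
Proof.
have r1 : rho^-1 < 1 by rewrite invf_lt1.
have r0 : 0 <= rho^-1 by rewrite invr_ge0 ltW.
have := geometric_sum_le n r0 r1.
under eq_bigr do rewrite exprVn.
move=> h; apply: (le_trans h); rewrite le_eqVlt; apply/orP; left; apply/eqP.
by field; rewrite subr_eq0 !gt_eqF.
Qed.

Lemma cost_cells_bound (D s B : R) n1 (L : nat -> nat) (dev : nat -> nat -> R) :
  0 <= B ->
  (forall n l, (n < n1.+1)%N -> (l < (L n).+1)%N -> dev n l <= s / rho ^+ (2 * n) * D ^+ l) ->
  (forall n, (n < n1.+1)%N -> s * \sum_(l < (L n).+1) (D / rho) ^+ l <= B) ->
  \sum_(n < n1.+1) \sum_(l < (L n).+1) rho ^+ n / rho ^+ l * dev n l <=
    rho / (rho - 1) * B.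
Proof.
move=> B0 devle sB; apply: (@le_trans _ _ (\sum_(n < n1.+1) (rho ^+ n)^-1 * B)); last first.
  by rewrite -mulr_suml ler_wpM2r// sum_inv_powers_le.
apply: ler_sum => n _; have nn := ltn_ord n.
have n0 : 0 < rho ^+ n by exact: exprn_gt0.
apply: (@le_trans _ _ ((rho ^+ n)^-1 * (s * \sum_(l < (L n).+1) (D / rho) ^+ l))); last first.
  by rewrite ler_wpM2l ?sB// invr_ge0 ltW.
rewrite !mulr_sumr; apply: ler_sum => l _.
have l0 : 0 < rho ^+ l by exact: exprn_gt0.
apply: (@le_trans _ _ (rho ^+ n / rho ^+ l * (s / rho ^+ (2 * n) * D ^+ l))).
  by apply: ler_wpM2l; [by rewrite divr_ge0 ?(ltW n0) ?(ltW l0)|exact: devle].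
rewrite mul2n -addnn exprD expr_div_n le_eqVlt; apply/orP; left; apply/eqP.
by field; rewrite !gt_eqF.
Qed.

Lemma cost_rest_bound (M : R) m H n1 (L : nat -> nat) (f : nat -> R) :
  (forall n, f n <= M / rho ^+ ((m + 4) * n)) ->
  (forall n, (n < n1.+1)%N -> (L n + (m + 2) * n = H)%N) -> 0 <= M ->
  \sum_(n < n1.+1) rho ^+ n / rho ^+ (L n) * f n <= rho / (rho - 1) * (M / rho ^+ H).
Proof.
move=> fM LH M0; have H0 : 0 < rho ^+ H by exact: exprn_gt0.
apply: (@le_trans _ _ (\sum_(n < n1.+1) (rho ^+ n)^-1 * (M / rho ^+ H))); last first.
  by rewrite -mulr_suml ler_wpM2r ?sum_inv_powers_le// divr_ge0// ltW.
apply: ler_sum => n _.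
have n0 : 0 < rho ^+ n by exact: exprn_gt0.
have l0 : 0 < rho ^+ (L n) by exact: exprn_gt0.
apply: (@le_trans _ _ (rho ^+ n / rho ^+ (L n) * (M / rho ^+ ((m + 4) * n)))).
  by apply: ler_wpM2l; [by rewrite divr_ge0 ?(ltW n0) ?(ltW l0)|exact: fM].
have -> : rho ^+ H = rho ^+ (L n) * rho ^+ ((m + 2) * n) by rewrite -exprD LH.
have -> : ((m + 4) * n = (m + 2) * n + (n + n))%N by lia.
have k0 : 0 < rho ^+ ((m + 2) * n) by exact: exprn_gt0.
rewrite !exprD le_eqVlt; apply/orP; left; apply/eqP.
by move: k0; set q := rho ^+ (_ * n) => k0; field; rewrite !gt_eqF.
Qed.

End cost_sums.

Section moments.
Context (R : realType) (d : nat) (p : R).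
Hypothesis p_gt0 : 0 < p.
Local Notation Rd := (Rd R d).
Local Notation rho := (2 `^ p : R).
Local Notation nrm := (fun y : Rd => enorm (y : 'rV[R]_d)).
Variables (mu : probability Rd R) (k : nat) (M : R).
Hypothesis HM : int_le mu (fun y : Rd => nrm y `^ (p * k%:R)) M.

Lemma powR_two_exp (j k' : nat) : (2 ^+ j) `^ (p * k'%:R) = rho ^+ (k' * j) :> R.
Proof.
rewrite -powR_mulrn// -powRrM mulrCA -powR_mulrn ?powR_ge0// -powRrM natrM.
by congr (_ `^ _); ring.
Qed.

Let rho0 : 0 < rho. Proof. exact: powR_gt0. Qed.

Let mono (j k' : nat) (u : R) : 2 ^+ j <= u -> rho ^+ (k' * j) <= u `^ (p * k'%:R).
Proof.
move=> ju; rewrite -powR_two_exp; apply: ge0_ler_powR; rewrite ?nnegrE//.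
- by rewrite mulr_ge0// ltW.
- by apply: le_trans ju.
Qed.

Let M0 : 0 <= M.
Proof.
rewrite -lee_fin; case: HM => _ _; apply: le_trans.
by apply: integral_ge0 => y _; rewrite lee_fin powR_ge0.
Qed.

Lemma shell_mass_le n :
  fine (mu (shell n)) <= (1 + M * rho ^+ k) / rho ^+ (k * n).
Proof.
have mS := @measurable_shell R d n.
have fS : mu (shell n) = (fine (mu (shell n)))%:E by rewrite fineK//; exact: fin_num_measure.
case: n => [|j] in mS fS *.
  rewrite muln0 expr0 divr1; apply: (@le_trans _ _ 1).
    by rewrite -lee_fin -fS probability_le1.
  by rewrite lerDl mulr_ge0// exprn_ge0// ltW.
apply: (@le_trans _ _ ((rho ^+ (k * j))^-1 * M)); last first.
  rewrite mulnS exprD invfM mulrA mulrDl mul1r mulfK ?expf_eq0 ?gt_eqF ?andbF//.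
  rewrite mulrC ler_wpM2r ?invr_ge0 ?exprn_ge0 ?(ltW rho0)//.
  by rewrite lerDr invr_ge0 exprn_ge0 ?(ltW rho0).
have kj0 : 0 < rho ^+ (k * j) by exact: exprn_gt0.
have ki0 : 0 <= (rho ^+ (k * j))^-1 by rewrite invr_ge0 ltW.
have : int_le mu (\1_(shell j.+1) : Rd -> R) ((rho ^+ (k * j))^-1 * M).
  apply: (int_le_le _ _ _ (int_leZ ki0 HM)) => //.
  move=> y; rewrite indicE; case: (boolP (y \in _)) => [|_]; last by rewrite mulr_ge0 ?powR_ge0.
  rewrite inE => -[_ /= yj]; rewrite mulrC ler_pdivlMr// mul1r.
  by apply: mono; exact: ltW.
by case=> _ _; rewrite integral_indic// setIT -lee_fin -fS.
Qed.

Lemma tail_mass_le n1 (k1 : nat) : k = k1.+1 ->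
  int_le mu (@tail_moment R d p n1) (M / rho ^+ (k1 * n1)).
Proof.
move=> kE; have kn0 : 0 < rho ^+ (k1 * n1) by exact: exprn_gt0.
have ki0 : 0 <= (rho ^+ (k1 * n1))^-1 by rewrite invr_ge0 ltW.
have mnrm := @measurable_enorm R d.
rewrite mulrC; apply: (int_le_le _ _ _ (int_leZ ki0 HM)).
- apply: measurable_funM.
    exact: (measurableT_comp (measurable_powR p) mnrm).
  rewrite (_ : (fun _ => _) = \1_[set y : Rd | 2 ^+ n1 < enorm (y : 'rV[R]_d)]).
    by apply: measurable_indic; exact: measurable_set_gt.
  apply/funext => y; rewrite indicE; congr (nat_of_bool _)%:R.
  by apply/idP/idP => [h|]; [exact: mem_set|rewrite inE].
- by move=> y; rewrite /tail_moment mulr_ge0 ?powR_ge0.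
move=> y; rewrite /tail_moment; case: (ltP (2 ^+ n1) _) => ny; last by rewrite mulr0 mulr_ge0 ?powR_ge0.
rewrite mulr1 mulrC ler_pdivlMr//.
rewrite (_ : p * k%:R = p + p * k1%:R); last by rewrite kE -[k1.+1%:R]natr1; ring.
rewrite powRD; last first.
  have y0 : 0 < enorm (y : 'rV[R]_d) by apply: lt_trans ny; exact: exprn_gt0.
  by rewrite (gt_eqF y0) implybT.
by rewrite ler_wpM2l ?powR_ge0// mono// ltW.
Qed.

End moments.

(* [H] is chosen such that 2^(pH) is of order 1/x; the shells n <= H/k are refined
   down to level H - kn, and the outer ones form the tail. *)
Lemma small_deviation (R : realType) (d : nat) (p a beta E0 : R) :
  (1 <= d)%N -> 0 < p -> 0 < a -> 0 < beta -> 0 < E0 ->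
  exists c C : R, [/\ 0 < c, 0 < C &
    forall (mu : probability (Rd R d) R) (disp : measure_display)
      (Omega : measurableType disp) (P : probability Omega R)
      (X : nat -> {RV P >-> Rd R d}) (N : nat) (x : R),
    int_le mu (fun y : Rd R d => expR (a * enorm (y : 'rV[R]_d) `^ beta)) E0 ->
    iid X mu -> (0 < N)%N -> 0 < x -> x <= 1 ->
    exists2 n1 : nat, int_le mu (@tail_moment R d p n1) (x / (8 * 2 `^ p)) &
      (P [set w | (x%:E < transport_cost p mu (empirical (X^~ w) N))%E] <=
       (C * expR (- (c * N%:R * rate d p x)))%:E +
       P [set w | (N%:R * (x / (4 * 2 `^ p)) <=
                   \sum_(i < N) @tail_moment R d p n1 (X i w))%R])%E].
Proof.
move=> d1 p0 a0 b0 E00.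
pose rho : R := 2 `^ p.
have rho1 : 1 < rho.
  by rewrite /rho /powR gt_eqF// expR_gt1 mulr_gt0// ln_gt0//; lra.
have rho0 : 0 < rho by exact: lt_trans rho1.
have rhoB : 0 < rho - 1 by rewrite subr_gt0.
pose m := (Num.truncn p^-1).+1.
have rhom : 2 <= rho ^+ m.
  have pm : 1 <= p * m%:R.
    have := Num.Theory.truncnS_gt p^-1; rewrite -/m => h.
    by rewrite mulrC -ler_pdivrMr// div1r ltW.
  rewrite /rho -powR_mulrn ?powR_ge0// -powRrM -[leLHS]powRr1//.
  by apply: ler_powR => //; lra.
have Q0 : 0 <= p * (m + 4)%:R by rewrite mulr_ge0// ltW.
have [CQ CQ0 HCQ] := powR_le_expR Q0 a0 b0.
pose MQ := CQ * E0; have MQ0 : 0 < MQ by rewrite mulr_gt0.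
pose M := 1 + MQ * rho ^+ (m + 4).
have M0 : 0 < M by rewrite addr_gt0// mulr_gt0// exprn_gt0.
have M1 : 1 <= M by rewrite lerDl mulr_ge0 ?exprn_ge0 ?(ltW MQ0) ?(ltW rho0).
have MQM : MQ <= M.
  rewrite /M; apply: (@le_trans _ _ (MQ * rho ^+ (m + 4))); last by rewrite lerDr.
  by rewrite ler_peMr ?(ltW MQ0)// exprn_ege1// ltW.
pose W : R := (2 * Num.sqrt d%:R) `^ p.
have W0 : 0 <= W by exact: powR_ge0.
have [G GE] : exists G : R, G = rho / (rho - 1) by eexists.
have G0 : 0 < G by rewrite GE divr_gt0.
pose A : R := 1 + 4 * W * G * rho + 8 * rho ^+ (m + 4).
have WG : 0 <= 4 * W * G * rho by rewrite !mulr_ge0 ?(ltW G0) ?(ltW rho0).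
have rm0 : 0 < rho ^+ (m + 4) by exact: exprn_gt0.
have A1 : 1 <= A by rewrite /A; lra.
have A0 : 0 < A by exact: lt_le_trans A1.
have AW : 4 * W * G * rho <= A by rewrite /A; lra.
have Arho : 8 * rho ^+ (m + 4) <= A by rewrite /A; lra.
pose K := A * M.
have K0 : 0 < K by rewrite mulr_gt0.
have K1 : 1 <= K by rewrite /K -[leLHS]mulr1 ler_pM.
have MK : M <= K by rewrite /K ler_peMl// ltW.
have [CR CR0 HCR] := rate_sum d p0 K1.
pose cc := (1 + CR + 16 * W * G * CR)^-1.
have WGC : 0 <= 16 * W * G * CR by rewrite !mulr_ge0 ?(ltW G0) ?(ltW CR0).
have cd0 : 0 < 1 + CR + 16 * W * G * CR by rewrite ltr_pwDl// addr_gt0.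
have cc0 : 0 < cc by rewrite invr_gt0.
have cCR : cc * CR <= 1 by rewrite mulrC ler_pdivrMr// mul1r; lra.
have cWG : 2 * W * (cc * (G * CR)) <= 8^-1.
  rewrite (_ : _ * _ = (2 * W * G * CR) / (1 + CR + 16 * W * G * CR)); last by rewrite /cc; ring.
  by rewrite ler_pdivrMr//; lra.
pose c3 := cc ^+ 2 / (64 * K).
have c30 : 0 < c3 by rewrite divr_gt0 ?exprn_gt0// mulr_gt0.
pose C4 : R := 4 ^+ d.+1.
exists c3, (4 + expR C4); split => //.
move=> mu disp Omega P X N x HE iidX N0 x0 x1.
have NR : 0 < N%:R :> R by rewrite ltr0n.
have HM : int_le mu (fun y : Rd R d => enorm (y : 'rV[R]_d) `^ (p * (m + 4)%:R)) MQ.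
  apply: (int_le_le _ _ _ (int_leZ (ltW CQ0) HE)).
  - exact: (measurableT_comp (measurable_powR _) (@measurable_enorm R d)).
  - by move=> y; exact: powR_ge0.
  - by move=> y; apply: HCQ; exact: enorm_ge0.
have xK : 1 <= K / x by rewrite ler_pdivlMr// mul1r; exact: le_trans K1.
have [H [HK KH]] := pow_floor rho1 xK.
pose k := (m + 2)%N; have k0 : (0 < k)%N by rewrite /k addnS.
pose n1 := (H %/ k)%N; pose L n := (H - k * n)%N.
have rH : (rho ^+ H)^-1 <= rho * x / K.
  move: KH; rewrite ltr_pdivrMr// => KH.
  rewrite ler_pdivlMr// mulrC ler_pdivrMr ?exprn_gt0//; apply: (le_trans (ltW KH)).
  by rewrite exprS mulrAC.
have Hmu : int_le mu (@tail_moment R d p n1) (x / (8 * 2 `^ p)).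
  apply: (int_le_bound _ (tail_mass_le p0 HM n1 (k1 := m + 3) _)); last by rewrite addnS.
  have h : (H <= (m + 3) * n1 + (m + 2))%N.
    exact: leq_divn_step.
  have : (rho ^+ ((m + 3) * n1))^-1 <= rho ^+ (m + 2) * (rho * x / K).
    apply: (@le_trans _ _ (rho ^+ (m + 2) / rho ^+ H)); last first.
      by rewrite ler_wpM2l ?exprn_ge0// ltW.
    rewrite ler_pdivlMr ?exprn_gt0// mulrC ler_pdivrMr ?exprn_gt0// -exprD.
    by rewrite ler_weXn2l ?(ltW rho1)// addnC.
  move=> h2; apply: (@le_trans _ _ (M * (rho ^+ (m + 2) * (rho * x / K)))).
    by apply: ler_pM => //; rewrite ?invr_ge0 ?exprn_ge0 ?(ltW rho0) ?(ltW MQ0).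
  have -> : M * (rho ^+ (m + 2) * (rho * x / K)) = rho ^+ (m + 4) * x / (A * rho).
    rewrite /K !exprD !exprS; field; rewrite ?gt_eqF//.
  rewrite ler_pdivrMr ?mulr_gt0//.
  rewrite (_ : x / (8 * 2 `^ p) * (A * rho) = x * A / 8); last first.
    by rewrite -/rho; field; rewrite gt_eqF.
  by rewrite ler_pdivlMr// mulrAC [leRHS]mulrC ler_pM2r// mulrC.
exists n1 => //.
case: N N0 NR => [//|N] N0 NR.
have rate0 : 0 < rate d p x by exact: rate_gt0.
pose s := cc * Num.sqrt (rate d p x).
have s0 : 0 < s by rewrite mulr_gt0// sqrtr_gt0.
have s2 : s ^+ 2 = cc ^+ 2 * rate d p x by rewrite exprMn sqr_sqrtr// ltW.
have cE : N.+1%:R * s ^+ 2 / (64 * K) = c3 * N.+1%:R * rate d p x.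
  by rewrite s2 /c3; ring.
set Etail := [set w | _ <= _].
have mX i : measurable_fun setT (X i) by exact: measurable_funPT.
have mT := @measurable_transport_gt R d p _ Omega p0 mu X mX N.+1 x.
have mtail : measurable Etail.
  apply: measurable_set_ge; apply: measurable_sum => i.
  by apply: (measurableT_comp _ (mX i)); have [] := tail_mass_le p0 HM n1 (k1 := m + 3) (addnS _ _).
have C40 : 0 < C4 by exact: exprn_gt0.
case: (leP (4 ^+ d.+1) (N.+1%:R * s ^+ 2 / (32 * K))) => Zbig; last first.
  apply: (@le_trans _ _ 1%E); first exact: probability_le1.
  rewrite -[leLHS]adde0; apply: leeD => //; rewrite lee_fin.
  apply: (@le_trans _ _ (expR C4 * expR (- (c3 * N.+1%:R * rate d p x)))); last first.
    by rewrite ler_wpM2r ?expR_ge0// lerDr.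
  rewrite -expRD -cE; apply: (@le_trans _ _ (expR 0)); first by rewrite expR0.
  rewrite ler_expR subr_ge0; apply/ltW; apply: le_lt_trans Zbig.
  apply: ler_wpM2l; first by rewrite mulr_ge0 ?sqr_ge0.
  by rewrite lef_pV2 ?posrE ?mulr_gt0// ler_pM2r// ler_nat.
pose D : R := 2 `^ (d%:R / 2).
have rLn n : (n < n1.+1)%N -> (L n + k * n = H)%N.
  rewrite ltnS => nn; rewrite subnK//; apply: leq_trans (leq_divM H k).
  by rewrite mulnC leq_mul2r nn orbT.
have shellM n : fine (mu (shell n)) <= M / rho ^+ ((m + 4) * n).
  exact: (shell_mass_le p0 HM n).
have shellK n : fine (mu (shell n)) <= K / rho ^+ ((m + 4) * n).
  by apply: le_trans (shellM n) _; rewrite ler_wpM2r ?invr_ge0 ?exprn_ge0 ?(ltW rho0).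
have sumL n : s * \sum_(l < (L n).+1) (D / rho) ^+ l <= cc * (CR * x).
  rewrite /s -mulrA ler_wpM2l ?(ltW cc0)//; apply: HCR => //.
  by apply: le_trans HK; rewrite ler_weXn2l ?(ltW rho1)// leq_subr.
have D0 : 0 < D by exact: powR_gt0.
have tK n l : (n < n1.+1)%N -> (l < (L n).+1)%N ->
    s / rho ^+ (2 * n) * D ^+ l <= 4 * (K / rho ^+ ((m + 4) * n)).
  move=> nn ll.
  have sl : s * (D / rho) ^+ l <= x.
    apply: (@le_trans _ _ (cc * (CR * x))); last by rewrite mulrA ler_piMl// ltW.
    apply: le_trans (sumL n); rewrite ler_wpM2l ?(ltW s0)//.
    rewrite (bigD1 (Ordinal ll))//= lerDl; apply: sumr_ge0 => i _.
    by rewrite exprn_ge0// divr_ge0 ?(ltW D0) ?(ltW rho0).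
  have l0 : 0 < rho ^+ l by exact: exprn_gt0.
  have n20 : 0 < rho ^+ (2 * n) by exact: exprn_gt0.
  have nk0 : 0 < rho ^+ (k * n) by exact: exprn_gt0.
  have -> : s / rho ^+ (2 * n) * D ^+ l = s * (D / rho) ^+ l * rho ^+ l / rho ^+ (2 * n).
    by rewrite expr_div_n; field; rewrite !gt_eqF.
  have -> : rho ^+ ((m + 4) * n) = rho ^+ (k * n) * rho ^+ (2 * n).
    by rewrite -exprD -mulnDl /k -addnA.
  apply: (@le_trans _ _ (K / (rho ^+ (k * n) * rho ^+ (2 * n)))); last first.
    have : 0 <= K / (rho ^+ (k * n) * rho ^+ (2 * n)) by rewrite divr_ge0 ?mulr_ge0// ltW.
    by move=> h; rewrite ler_peMl// ler1n.
  rewrite invfM mulrA ler_wpM2r ?invr_ge0 ?(ltW n20)// ler_pdivlMr//.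
  apply: (@le_trans _ _ (x * rho ^+ H)); last by rewrite mulrC -ler_pdivlMr.
  rewrite -(rLn n nn) exprD mulrA ler_wpM2r ?(ltW nk0)//.
  apply: ler_pM => //; [|exact: ltW|by rewrite ler_weXn2l ?(ltW rho1)].
  by rewrite mulr_ge0 ?(ltW s0)// exprn_ge0// divr_ge0 ?(ltW D0) ?(ltW rho0).
have Hcells := cells_probability d1 iidX (L := L) N0 s0 K0 rhom shellK tK Zbig.
set Ecells := \bigcup_(u in _) _ in Hcells.
have mcells : measurable Ecells.
  apply: fin_bigcup_measurable => [|u _]; first exact: finite_finset.
  apply: measurable_set_gt; apply: measurable_sum => c.
  apply: measurableT_comp => //; apply: measurable_funB => //.
  apply: measurable_funM => //; apply: measurable_sum => i.
  by apply: measurable_indic_comp; [exact: mX|exact: measurable_cell].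
apply: (@le_trans _ _ (P Ecells + P Etail)%E); last first.
  apply: leeD => //; apply: (le_trans Hcells); rewrite lee_fin cE.
  by rewrite ler_wpM2r ?expR_ge0// lerDl expR_ge0.
have := @measure_fin_union_bound _ _ _ P bool
   [set w | (x%:E < transport_cost p mu (empirical (X^~ w) N.+1))%E]
   (fun b => if b then Ecells else Etail).
rewrite big_bool; apply => //; first by case.
move=> w /= xT; case: (pselect (Ecells w)) => [Ew|NE]; first by exists true.
case: (pselect (Etail w)) => [Ew|NT]; first by exists false.
exfalso; move: xT; apply/negP; rewrite -leNgt.
have [mtl tl0 Htl] := Hmu.
have Htnu : (\int[empirical (X^~ w) N.+1]_y (@tail_moment R d p n1 y)%:E <= (x / (4 * rho))%:E)%E.
  rewrite integral_empirical// lee_fin mulrC ler_pdivrMr// mulrC.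
  by move/negP: NT; rewrite /Etail/= -ltNge => /ltW.
apply: (le_trans (transport_cost_le d1 p0 L Htl Htnu)); rewrite lee_fin -/W -/rho.
have sideE n l : side R n l `^ p = rho ^+ n / rho ^+ l.
  have l0 : rho ^+ l != 0 by rewrite gt_eqF// exprn_gt0.
  apply: (mulIf l0); rewrite divfK//.
  have e j : (2 ^+ j) `^ p = rho ^+ j by have := @powR_two_exp R p j 1; rewrite mulr1 mul1n.
  by rewrite -!e -powRM ?side_ge0 ?exprn_ge0// /side divfK// gt_eqF// exprn_gt0.
set S1 := \sum_(n < _) _; set S2 := \sum_(n < _) _.
have h1 : S1 <= G * (cc * (CR * x)).
  rewrite GE; pose dev n l := cell_deviation mu X N.+1 n l w.
  apply: le_trans (@cost_cells_bound R rho rho1 D s _ n1 L dev _ _ _).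
  - rewrite le_eqVlt; apply/orP; left; apply/eqP; apply: eq_bigr => n _; apply: eq_bigr => l _.
    rewrite sideE; congr (_ * _); apply: eq_bigr => c _.
    by rewrite empiricalE ?fineK// distrC.
  - by rewrite !mulr_ge0 ?(ltW cc0) ?(ltW CR0) ?(ltW x0).
  - move=> n l nn ll; rewrite leNgt; apply/negP => h; apply: NE.
    by exists (existT (fun n : 'I_n1.+1 => 'I_(L n).+1) (Ordinal nn) (Ordinal ll)).
  - by move=> n _.
have h2 : S2 <= G * (M / rho ^+ H).
  rewrite GE; apply: le_trans (cost_rest_bound rho1 shellM rLn (ltW M0)).
  by rewrite le_eqVlt; apply/orP; left; apply/eqP; apply: eq_bigr => n _; rewrite sideE.
have b1 : 2 * W * S1 <= 8^-1 * x.
  apply: (@le_trans _ _ (2 * W * (G * (cc * (CR * x))))).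
    by rewrite ler_wpM2l ?mulr_ge0.
  apply: (@le_trans _ _ (2 * W * (cc * (G * CR)) * x)); last by rewrite ler_wpM2r ?(ltW x0).
  by rewrite le_eqVlt; apply/orP; left; apply/eqP; ring.
have b2 : W * S2 <= 4^-1 * x.
  apply: (@le_trans _ _ (W * (G * (M * (rho * x / K))))).
    rewrite ler_wpM2l//; apply: le_trans h2 _.
    by apply: ler_wpM2l; [exact: ltW|rewrite ler_wpM2l ?(ltW M0)].
  rewrite (_ : W * _ = 4 * W * G * rho * (4^-1 * x) / A); last first.
    by rewrite /K; field; rewrite !gt_eqF.
  by rewrite ler_pdivrMr// mulrC; apply: ler_wpM2l => //; rewrite mulr_ge0 ?invr_ge0 ?(ltW x0).
have b3 : rho * (x / (8 * rho) + x / (4 * rho)) = 3 / 8 * x.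
  by field; rewrite gt_eqF.
rewrite b3; move: b1 b2 x0; clear.
move: (2 * W * S1) (W * S2) => u v; lra.
Qed.

(** * Deviation bounds *)

Lemma expR_bound_le (R : realType) (C C' e e' : R) :
  0 <= C -> C <= C' -> e' <= e -> C * expR (- e) <= C' * expR (- e').
Proof. by move=> C0 CC ee; apply: ler_pM => //; rewrite ?expR_ge0// ler_expR lerN2. Qed.

Lemma transport_le_moment (R : realType) d (p : R) (mu nu : probability (Rd R d) R) (m1 m2 : R) :
  0 < p ->
  (\int[mu]_y (enorm (y : 'rV[R]_d) `^ p)%:E <= m1%:E)%E ->
  (\int[nu]_y (enorm (y : 'rV[R]_d) `^ p)%:E <= m2%:E)%E ->
  (transport_cost p mu nu <= (2 `^ p * (m1 + m2))%:E)%E.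
Proof.
move=> p0 Hmu Hnu.
have [|j|pi cpi _] := @measure_laminar_coupling _ _ R mu nu 'I_0 (fun _ => set0); try by case.
apply: (@le_trans _ _ (\int[pi]_z (enorm ((z.1 : 'rV[R]_d) - (z.2 : 'rV[R]_d)) `^ p)%:E)%E).
  by apply: ereal_inf_lbound; exists pi.
have mW : measurable_fun setT (fun y : Rd R d => enorm (y : 'rV[R]_d) `^ p).
  exact: (measurableT_comp (measurable_powR p) (@measurable_enorm R d)).
have W0 (y : Rd R d) : 0 <= enorm (y : 'rV[R]_d) `^ p by exact: powR_ge0.
suff [] : int_le pi (fun z => enorm ((z.1 : 'rV[R]_d) - (z.2 : 'rV[R]_d)) `^ p)
  (2 `^ p * (m1 + m2)) by [].
pose g (z : Rd R d * Rd R d) :=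
  2 `^ p * (enorm (z.1 : 'rV[R]_d) `^ p + enorm (z.2 : 'rV[R]_d) `^ p).
apply: (@int_le_le _ _ _ _ _ g).
- by have /measurable_EFinP := @measurable_cost R d p.
- by move=> z; exact: powR_ge0.
- move=> z; rewrite /g; set M := Num.max (enorm (z.1 : 'rV[R]_d)) (enorm (z.2 : 'rV[R]_d)).
  have M0 : 0 <= M by rewrite le_max enorm_ge0.
  apply: (@le_trans _ _ ((2 * M) `^ p)).
    by apply: ge0_ler_powR; rewrite ?nnegrE ?enorm_ge0 ?(ltW p0) ?mulr_ge0// enormB_le_max.
  rewrite powRM// ler_wpM2l ?powR_ge0// /M.
  by case: (leP (enorm (z.1 : 'rV[R]_d)) _) => _; [rewrite lerDr|rewrite lerDl]; exact: powR_ge0.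
- apply: int_leZ; first exact: powR_ge0.
  apply: int_leD; split=> //.
  + exact: measurableT_comp mW measurable_fst.
  + by rewrite (coupling_integral cpi mW W0).1.
  + exact: measurableT_comp mW measurable_snd.
  + by rewrite (coupling_integral cpi mW W0).2.
Qed.

Section deviation.
Context (R : realType) (d : nat) (p a beta E0 : R).
Hypotheses (d_ge1 : (1 <= d)%N) (p_gt0 : 0 < p) (a_gt0 : 0 < a) (beta_gt0 : 0 < beta)
  (E0_ge1 : 1 <= E0).
Local Notation Rd := (Rd R d).
Local Notation rho := (2 `^ p : R).
Local Notation r := (beta / p).
Local Notation nrm := (fun y : Rd => enorm (y : 'rV[R]_d)).

Definition deviation_le (S : nat -> R -> Prop) (B : nat -> R -> R) : Prop :=
  forall (mu : probability Rd R) (disp : measure_display) (Omega : measurableType disp)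
    (P : probability Omega R) (X : nat -> {RV P >-> Rd}) (N : nat) (x : R),
  int_le mu (fun y : Rd => expR (a * nrm y `^ beta)) E0 -> iid X mu -> S N x ->
  (P [set w | (x%:E < transport_cost p mu (empirical (X^~ w) N))%E] <= (B N x)%:E)%E.

Let E00 : 0 < E0. Proof. exact: lt_le_trans E0_ge1. Qed.
Let rho0 : 0 < rho. Proof. exact: powR_gt0. Qed.
Let r0 : 0 < r. Proof. exact: divr_gt0. Qed.
Let mnrm : measurable_fun setT nrm := @measurable_enorm R d.
Let mW : measurable_fun setT (fun y : Rd => nrm y `^ p).
Proof. exact: (measurableT_comp (measurable_powR p) mnrm). Qed.
Let nrm0 y : 0 <= nrm y. Proof. exact: enorm_ge0. Qed.

Lemma tail_moment_le n1 (y : Rd) : @tail_moment R d p n1 y <= nrm y `^ p.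
Proof. by rewrite /tail_moment ler_piMr ?powR_ge0// lern1 leq_b1. Qed.

Lemma exp_moment_powR : exists2 M : R, 0 < M & forall mu : probability Rd R,
  int_le mu (fun y : Rd => expR (a * nrm y `^ beta)) E0 ->
  int_le mu (fun y : Rd => nrm y `^ p) M.
Proof.
have [C C0 HC] := powR_le_expR (ltW p_gt0) a_gt0 beta_gt0.
exists (C * E0) => [|mu HE]; first exact: mulr_gt0.
apply: (int_le_le mW _ _ (int_leZ (ltW C0) HE)) => y; first exact: powR_ge0.
exact: HC.
Qed.

Lemma deviation_moment (mu : probability Rd R) (y : nat -> Rd) N (M s x : R) : (0 < N)%N ->
  int_le mu (fun y : Rd => nrm y `^ p) M -> rho * (M + s) <= x ->
  (x%:E < transport_cost p mu (empirical y N))%E ->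
  N%:R * s <= \sum_(i < N) nrm (y i) `^ p.
Proof.
case: N => // N _ [_ _ HM] Mx; apply: contraTT; rewrite -ltNge -leNgt => /ltW h.
have Hnu : (\int[empirical y N.+1]_y (nrm y `^ p)%:E <= s%:E)%E.
  rewrite (@integral_empirical _ _ _ _ (fun y : Rd => nrm y `^ p))//; last by move=> z; exact: powR_ge0.
  by rewrite lee_fin mulrC ler_pdivrMr// mulrC.
by apply: (le_trans (transport_le_moment p_gt0 HM Hnu)); rewrite lee_fin.
Qed.

Lemma deviation_light_small : p <= beta ->
  exists c C : R, [/\ 0 < c, 0 < C &
    deviation_le (fun N x => [/\ (0 < N)%N, 0 < x & x <= 1])
      (fun N x => C * expR (- (c * N%:R * rate d p x)))].
Proof.
move=> pb; have k0 : 0 < (8 * rho)^-1 by rewrite invr_gt0 mulr_gt0.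
have [c1 [C1 [c10 C10 H1]]] := small_deviation d_ge1 p_gt0 a_gt0 beta_gt0 E00.
have [c2 c20 H2] := tail_light p_gt0 a_gt0 pb E00 k0.
have [Cr Cr0 HCr] := rate_le_sqr d p_gt0.
pose c := Num.min c1 (c2 / Cr).
exists c, (C1 + 1); split.
- by rewrite lt_min c10 divr_gt0.
- by rewrite addr_gt0.
move=> mu disp Omega P X N x HE iidX [N0 x0 x1].
have rx := HCr x x0 x1; have rt0 : 0 < rate d p x by exact: rate_gt0.
have [n1 Ht HP] := H1 mu disp Omega P X N x HE iidX N0 x0 x1.
apply: (le_trans HP); rewrite (mulrDl C1 1 (expR _)) (mul1r (expR _)) EFinD; apply: leeD.
  rewrite lee_fin; apply: expR_bound_le => //; first exact: ltW.
  rewrite -!mulrA; apply: ler_wpM2r; first by rewrite mulr_ge0// ltW.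
  by rewrite ge_min lexx.
have kE : 2 * (8 * rho)^-1 * x = x / (4 * rho) by field; rewrite gt_eqF.
have Ht' : int_le mu (@tail_moment R d p n1) ((8 * rho)^-1 * x) by rewrite mulrC.
have := H2 _ _ Omega _ P mu X nrm (@tail_moment R d p n1) N x iidX mnrm nrm0
  (tail_moment_le n1) HE x0 x1 Ht'.
rewrite kE => h; apply: (le_trans h); rewrite lee_fin ler_expR lerN2.
apply: (@le_trans _ _ (c2 / Cr * N%:R * (Cr * x ^+ 2))).
  apply: ler_pM => //; rewrite ?mulr_ge0 ?(ltW rt0)//.
  - by rewrite le_min (ltW c10) divr_ge0 ?(ltW c20) ?(ltW Cr0).
  - by rewrite ler_wpM2r// ge_min lexx orbT.
by rewrite le_eqVlt; apply/orP; left; apply/eqP; field; rewrite gt_eqF.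
Qed.

Lemma deviation_light_large : p <= beta ->
  exists x0 c : R, [/\ 1 <= x0, 0 < c &
    deviation_le (fun N x => (0 < N)%N /\ x0 <= x)
      (fun N x => expR (- (c * N%:R * x `^ r)))].
Proof.
move=> pb; have [M M0 HM] := exp_moment_powR.
have r1 : 1 <= r by rewrite ler_pdivlMr// mul1r.
have Q0 : 0 <= 2 * E0 / a by rewrite divr_ge0 ?mulr_ge0 ?(ltW E00) ?(ltW a_gt0).
have rho1 : 1 <= rho by rewrite -[leLHS](powRr0 2); apply: ler_powR; [lra|exact: ltW].
pose S := 1 + M + 2 * E0 / a.
have S1 : 1 <= S by rewrite /S -addrA lerDl addr_ge0// ltW.
pose c := a / 2 / (4 * rho) `^ r.
have f0 : 0 < 4 * rho by rewrite mulr_gt0.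
exists (4 * rho * S), c; split.
- by rewrite -[leLHS]mulr1; apply: ler_pM => //; lra.
- by rewrite !divr_gt0// powR_gt0.
move=> mu disp Omega P X N x HE iidX [N0 xS].
have {xS}sS : S <= x / (4 * rho) by rewrite ler_pdivlMr// mulrC.
pose s := x / (4 * rho); have xs : x = 4 * rho * s by rewrite /s mulrC divfK// gt_eqF.
rewrite -/s in sS.
have s1 : 1 <= s by exact: le_trans sS.
have s0 : 0 < s by exact: lt_le_trans s1.
have sr0 : 0 < s `^ r by exact: powR_gt0.
have NR : 0 < N%:R :> R by rewrite ltr0n.
have sr : s <= s `^ r by rewrite -[leLHS]powRr1 ?(ltW s0)//; exact: ler_powR.
have mX i : measurable_fun setT (X i) by exact: measurable_funPT.
have mB : measurable_fun setT (fun y : Rd => nrm y `^ beta).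
  exact: (measurableT_comp (measurable_powR beta) mnrm).
have [mE _ HE'] := HE.
have := chernoff_iid iidX (N%:R * s `^ r) N mB (ltW a_gt0) HE'.
move=> h; apply: (@le_trans _ _ (P [set w | N%:R * s `^ r <= \sum_(i < N) nrm (X i w) `^ beta])).
  apply: le_measure; rewrite ?inE.
  - exact: measurable_transport_gt.
  - by apply: measurable_set_ge; apply: measurable_sum => i; exact: measurableT_comp mB (mX i).
  move=> w /= xT; have Ms : rho * (M + 2 * s) <= x.
    have : M <= s by apply: le_trans sS; rewrite /S; lra.
    rewrite xs => Ms; rewrite (_ : 4 * rho * s = rho * (4 * s)); last by ring.
    by rewrite ler_wpM2l ?(ltW rho0)//; lra.
  have := deviation_moment N0 (HM mu HE) Ms xT => h1.
  have h2 : \sum_(i < N) nrm (X i w) `^ p <=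
      N%:R * s + s / s `^ r * \sum_(i < N) nrm (X i w) `^ beta.
    rewrite mulr_sumr mulr_natl -[X in _ *+ X]card_ord -sumr_const -big_split/=.
    apply: ler_sum => i _; set u := enorm _.
    have -> : u `^ beta = (u `^ p) `^ r by rewrite -powRrM mulrCA divff ?mulr1// gt_eqF.
    have v0 : 0 <= u `^ p by exact: powR_ge0.
    set v := u `^ p in v0 *; case: (leP v s) => vs.
      apply: (le_trans vs); rewrite lerDl; apply: mulr_ge0; [by apply: divr_ge0; exact: ltW|exact: powR_ge0].
    apply: (@le_trans _ _ (s / s `^ r * v `^ r)); last by rewrite lerDr ltW.
    have vp : 0 < v by exact: lt_trans vs.
    have e t : 0 < t -> t `^ r = t `^ (r - 1) * t.
      by move=> t0; rewrite -[X in _ = _ * X](powRr1 (ltW t0)) -powRD ?subrK// gt_eqF ?implybT.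
    have A0 : 0 < s `^ (r - 1) by exact: powR_gt0.
    rewrite (e v)// (e s)//.
    rewrite (_ : _ / _ * _ = v * (v `^ (r - 1) / s `^ (r - 1))); last first.
      by move: A0; set A := s `^ _ => A0; field; rewrite !gt_eqF.
    rewrite ler_peMr ?(ltW vp)// ler_pdivlMr// mul1r.
    by apply: ge0_ler_powR; rewrite ?nnegrE ?subr_ge0 ?(ltW s0) ?(ltW vp) ?(ltW vs).
  have {h1 h2}h1 := le_trans h1 h2.
  have h3 : N%:R * s <= s / s `^ r * \sum_(i < N) nrm (X i w) `^ beta.
    rewrite -(lerD2l (N%:R * s)); apply: le_trans h1.
    by rewrite le_eqVlt; apply/orP; left; apply/eqP; ring.
  rewrite mulrAC ler_pdivlMr// in h3; rewrite -(ler_pM2l s0); apply: le_trans h3.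
  by rewrite le_eqVlt; apply/orP; left; apply/eqP; ring.
apply: (le_trans h); rewrite lee_fin.
have E0e : E0 <= expR E0 by apply: le_trans (expR_ge1Dx _); rewrite lerDr.
apply: (@le_trans _ _ (expR (- (a * (N%:R * s `^ r))) * expR E0 ^+ N)).
  by rewrite ler_wpM2l ?expR_ge0// lerXn2r// nnegrE ?expR_ge0// ltW.
rewrite -expRM_natl -expRD ler_expR.
have -> : x `^ r = (4 * rho) `^ r * s `^ r by rewrite xs powRM// ltW.
have -> : c * N%:R * ((4 * rho) `^ r * s `^ r) = N%:R * (a / 2 * s `^ r).
  by rewrite /c; field; rewrite gt_eqF// powR_gt0.
rewrite (_ : - _ + _ = - (N%:R * (a * s `^ r - E0))); last by rewrite -mulr_natl; ring.
rewrite lerN2 ler_pM2l//.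
suff : E0 <= a / 2 * s `^ r by lra.
have : 2 * E0 / a <= s `^ r by apply: le_trans sr; apply: le_trans sS; rewrite /S; lra.
by rewrite ler_pdivrMr// => h4; lra.
Qed.

Hypothesis beta_lt : beta < p.
Let r1 : r < 1. Proof. by rewrite ltr_pdivrMr// mul1r. Qed.

Lemma absorb_prefactor : exists2 C : R, 0 < C & forall (N : nat) (s : R), 0 < s ->
  1 <= N%:R * s ^+ 2 ->
  N%:R * (E0 * expR (- (a * (N%:R * s) `^ r))) + expR (- (a / 8 * (N%:R * s) `^ r)) <=
  C * expR (- (a / 8 * (N%:R * s) `^ r)).
Proof.
have a2 : 0 < a / 2 by rewrite divr_gt0.
have q2 : 0 <= 2 :> R by [].
have [C C0 HC] := powR_le_expR q2 a2 r0.
exists (E0 * C + 1) => [|N s s0 Ns]; first by rewrite addr_gt0// mulr_gt0.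
have t0 : 0 <= N%:R * s by rewrite mulr_ge0// ltW.
have Nt : N%:R <= (N%:R * s) `^ 2.
  rewrite powR_mulrn// exprMn expr2 -mulrA.
  by rewrite ler_peMr// ltW.
move: (N%:R * s) t0 Nt => t t0 Nt; have tr0 : 0 <= t `^ r by exact: powR_ge0.
rewrite (mulrDl (E0 * C)) (mul1r (expR _)) lerD2r mulrCA -mulrA ler_wpM2l ?(ltW E00)//.
apply: (@le_trans _ _ (C * expR (a / 2 * t `^ r) * expR (- (a * t `^ r)))).
  by rewrite ler_wpM2r ?expR_ge0//; exact: le_trans (HC t t0).
rewrite -mulrA ler_wpM2l ?(ltW C0)// -expRD ler_expR.
have : 0 <= a * t `^ r by rewrite mulr_ge0// ltW.
move: (t `^ r) => y ay; lra.
Qed.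

Lemma deviation_heavy_small :
  exists c C : R, [/\ 0 < c, 0 < C &
    deviation_le (fun N x => [/\ (0 < N)%N, 0 < x & x <= 1])
      (fun N x => C * (expR (- (c * N%:R * rate d p x)) + expR (- (c * (N%:R * x) `^ r))))].
Proof.
have [c1 [C1 [c10 C10 H1]]] := small_deviation d_ge1 p_gt0 a_gt0 beta_gt0 E00.
have [C2 C20 H2] := tail_heavy p_gt0 a_gt0 beta_gt0 beta_lt E00.
have [C3 C30 H3] := absorb_prefactor.
have [Cr Cr0 HCr] := rate_le_sqr d p_gt0.
have f0 : 0 < 4 * rho by rewrite mulr_gt0.
have fr0 : 0 < (4 * rho) `^ r by exact: powR_gt0.
pose B := (4 * rho) ^+ 2 * Cr.
have B0 : 0 < B by rewrite mulr_gt0// exprn_gt0.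
have [c [c0 cc1 cc2 cc3]] : exists c, [/\ 0 < c, c <= c1, c <= (16 * C2 * B)^-1 & c <= a / 8 / (4 * rho) `^ r].
  exists (Num.min c1 (Num.min (16 * C2 * B)^-1 (a / 8 / (4 * rho) `^ r))); split.
  - by rewrite !lt_min c10 invr_gt0 !mulr_gt0// !divr_gt0.
  - by rewrite ge_min lexx.
  - by rewrite !ge_min lexx orbT.
  - by rewrite !ge_min lexx !orbT.
have eB0 := expR_gt0 (c * B).
exists c, (C1 + C3 + 1 + expR (c * B)); split => //.
  by rewrite !addr_gt0.
move=> mu disp Omega P X N x HE iidX [N0 x0 x1].
have NR : 0 < N%:R :> R by rewrite ltr0n.
have rx := HCr x x0 x1; have rt0 : 0 < rate d p x by exact: rate_gt0.
pose s := x / (4 * rho); have s0 : 0 < s by exact: divr_gt0.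
have xs : x = 4 * rho * s by rewrite /s mulrC divfK// gt_eqF.
have Nrate : N%:R * rate d p x <= B * (N%:R * s ^+ 2).
  rewrite (_ : B * _ = N%:R * (Cr * x ^+ 2)); last by rewrite /B xs; ring.
  by rewrite ler_wpM2l.
have [eR eW] : 0 < expR (- (c * N%:R * rate d p x)) /\ 0 < expR (- (c * (N%:R * x) `^ r)).
  by split; exact: expR_gt0.
(* If N s^2 < 1, then N rate(x) is bounded and the estimate is trivial; otherwise
   N <= (N s)^2 and the prefactor N is absorbed. *)
have [Ns|Ns] := leP 1 (N%:R * s ^+ 2); last first.
  have mX i : measurable_fun setT (X i) by exact: measurable_funPT.
  have mT := @measurable_transport_gt R d p _ Omega p_gt0 mu X mX N x.
  apply: (@le_trans _ _ 1%E); first exact: probability_le1.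
  rewrite lee_fin; apply: (@le_trans _ _ (expR (c * B) * expR (- (c * N%:R * rate d p x)))).
    rewrite -expRD; apply: (@le_trans _ _ (expR 0)); first by rewrite expR0.
    rewrite ler_expR subr_ge0 -mulrA ler_wpM2l ?(ltW c0)//; apply: le_trans Nrate _.
    by rewrite ler_piMr// ltW.
  apply: ler_pM => //; rewrite ?(ltW eB0) ?(ltW eR)//.
    by rewrite lerDr !addr_ge0// ltW.
  by rewrite lerDl ltW.
have [n1 Ht HP] := H1 mu disp Omega P X N x HE iidX N0 x0 x1.
apply: (le_trans HP).
have Ht' : int_le mu (@tail_moment R d p n1) (s / 2).
  by rewrite (_ : s / 2 = x / (8 * rho))// /s; field; rewrite gt_eqF.
have := H2 _ _ Omega _ P mu X nrm (@tail_moment R d p n1) N s iidX N0 mnrm nrm0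
  (tail_moment_le n1) HE s0 Ht'.
move=> h; apply: (le_trans (leeD (lexx _) h)); rewrite -EFinD lee_fin {h HP H1 H2 Ht Ht'}.
have {}H3 := H3 N s s0 Ns.
have b1 : C1 * expR (- (c1 * N%:R * rate d p x)) <= C1 * expR (- (c * N%:R * rate d p x)).
  apply: expR_bound_le => //; first exact: ltW.
  by rewrite -!mulrA; apply: ler_wpM2r => //; rewrite mulr_ge0// ltW.
have b2 : C3 * expR (- (a / 8 * (N%:R * s) `^ r)) <= C3 * expR (- (c * (N%:R * x) `^ r)).
  apply: expR_bound_le => //; first exact: ltW.
  rewrite (_ : N%:R * x = 4 * rho * (N%:R * s)); last by rewrite xs; ring.
  rewrite (powRM r (ltW f0) (mulr_ge0 (ltW NR) (ltW s0))) mulrA ler_wpM2r ?powR_ge0//.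
  by rewrite -ler_pdivlMr.
have b3 : expR (- (N%:R * s ^+ 2 / (16 * C2))) <= expR (- (c * N%:R * rate d p x)).
  rewrite ler_expR lerN2 -mulrA.
  apply: (@le_trans _ _ ((16 * C2 * B)^-1 * (B * (N%:R * s ^+ 2)))).
    by apply: ler_pM => //; rewrite ?mulr_ge0 ?(ltW c0) ?(ltW rt0).
  by rewrite le_eqVlt; apply/orP; left; apply/eqP; field; rewrite !gt_eqF.
have p1 := mulr_ge0 (ltW C10) (ltW eW).
have p2 := mulr_ge0 (ltW C30) (ltW eR).
have p3 := mulr_ge0 (ltW eB0) (addr_ge0 (ltW eR) (ltW eW)).
move: b1 b2 b3 H3 p1 p2 p3 eW eR; clear.
set u := N%:R * (E0 * _); move: u.
set e1 := expR (- (c * N%:R * _)); set e2 := expR (- (c * _)).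
set e3 := expR (- (a / 8 * _)); set e4 := expR (- (_ / (16 * C2))).
set e5 := expR (c * B); set e6 := expR (- (c1 * _ * _)).
move: e1 e2 e3 e4 e5 e6 => e1 e2 e3 e4 e5 e6 u.
move: (C1 * e6) (C3 * e3) => v w; rewrite !mulrDl !mulrDr !mul1r => *; lra.
Qed.

Lemma deviation_heavy_large :
  exists x0 c C : R, [/\ 1 <= x0, 0 < c, 0 < C &
    deviation_le (fun N x => (0 < N)%N /\ x0 <= x)
      (fun N x => C * expR (- (c * (N%:R * x) `^ r)))].
Proof.
have [M M0 HM] := exp_moment_powR.
have [C2 C20 H2] := tail_heavy p_gt0 a_gt0 beta_gt0 beta_lt E00.
have [C3 C30 H3] := absorb_prefactor.
have rho1 : 1 <= rho by rewrite -[leLHS](powRr0 2); apply: ler_powR; [lra|exact: ltW].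
have f0 : 0 < 2 * rho by rewrite mulr_gt0.
have fr0 : 0 < (2 * rho) `^ r by exact: powR_gt0.
have [c [c0 cc1 cc2]] : exists c, [/\ 0 < c, c * (2 * rho) `^ r <= a / 8 & c * (2 * rho) `^ r <= (16 * C2)^-1].
  exists (Num.min (a / 8 / (2 * rho) `^ r) ((16 * C2)^-1 / (2 * rho) `^ r)); split.
  - by rewrite !lt_min divr_gt0// ?divr_gt0// invr_gt0 mulr_gt0.
  - by rewrite -ler_pdivlMr// ge_min lexx.
  - by rewrite -ler_pdivlMr// ge_min lexx orbT.
exists (4 * rho * (1 + M)), c, (C3 + 1); split => //.
- by rewrite -[leLHS]mulr1; apply: ler_pM => //; lra.
- by rewrite addr_gt0.
move=> mu disp Omega P X N x HE iidX [N0 xS].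
have NR : 0 < N%:R :> R by rewrite ltr0n.
pose s := x / (2 * rho); have xs : x = 2 * rho * s by rewrite /s mulrC divfK// gt_eqF.
have sM : 1 + M <= s / 2.
  rewrite -(ler_pM2l (_ : 0 < 4 * rho)) ?mulr_gt0//; apply: le_trans xS _.
  by rewrite le_eqVlt; apply/orP; left; apply/eqP; rewrite xs; field.
have s1 : 1 <= s by lra.
have s0 : 0 < s by exact: lt_le_trans s1.
have Ht : int_le mu (fun y : Rd => nrm y `^ p) (s / 2).
  by apply: int_le_bound (HM mu HE); lra.
have N1 : 1 <= N%:R :> R by rewrite ler1n.
have Ns1 : 1 <= N%:R * s by rewrite -[leLHS]mulr1; apply: ler_pM.
have Ns2 : N%:R * s <= N%:R * s ^+ 2.
  by rewrite ler_wpM2l// -[leLHS]mulr1 expr2 ler_wpM2l// ltW.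
have Ns := le_trans Ns1 Ns2.
have Nsr : (N%:R * s) `^ r <= N%:R * s ^+ 2.
  apply: le_trans Ns2; rewrite -[leRHS](powRr1 (mulr_ge0 (ltW NR) (ltW s0))).
  by apply: ler_powR => //; exact: ltW.
have mX i : measurable_fun setT (X i) by exact: measurable_funPT.
apply: (@le_trans _ _ (P [set w | N%:R * s <= \sum_(i < N) nrm (X i w) `^ p])).
  apply: le_measure; rewrite ?inE.
  - exact: measurable_transport_gt.
  - by apply: measurable_set_ge; apply: measurable_sum => i; exact: measurableT_comp mW (mX i).
  move=> w /= xT; apply: (deviation_moment N0 (HM mu HE) _ xT).
  rewrite xs (_ : 2 * rho * s = rho * (2 * s)); last by ring.
  by rewrite ler_wpM2l ?(ltW rho0)//; lra.
have := H2 _ _ Omega _ P mu X nrm (fun y : Rd => nrm y `^ p) N s iidX N0 mnrm nrm0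
  (fun y => lexx _) HE s0 Ht.
move=> h; apply: (le_trans h); rewrite lee_fin {h H2 Ht}.
rewrite (_ : N%:R * x = 2 * rho * (N%:R * s)); last by rewrite xs; ring.
rewrite (powRM r (ltW f0) (mulr_ge0 (ltW NR) (ltW s0))) (mulrA c) addrA (mulrDl C3).
have sr0 : 0 <= (N%:R * s) `^ r by exact: powR_ge0.
apply: lerD.
  apply: le_trans (H3 N s s0 Ns) _; apply: expR_bound_le => //; first exact: ltW.
  by rewrite ler_wpM2r.
rewrite (mul1r (expR _)) ler_expR lerN2 [leRHS]mulrC.
by apply: ler_pM => //; rewrite mulr_ge0 ?(ltW c0) ?(ltW fr0).
Qed.

End deviation.

Theorem mainTheorem3 (R : realType) (d : nat) (p a beta E : R)
  (d_ge1 : (1 <= d)%N) (p_gt0 : 0 < p) (a_gt0 : 0 < a) (beta_gt0 : 0 < beta) :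
  exists c C : R, [/\ 0 < c, 0 < C &
    forall mu : probability (Rd R d) R,
      (\int[mu]_y (expR (a * enorm (y : 'rV[R]_d) `^ beta))%:E = E%:E)%E ->
    forall (disp : measure_display) (Omega : measurableType disp)
      (P : probability Omega R) (X : nat -> {RV P >-> Rd R d}), iid X mu ->
      (p <= beta -> forall (N : nat) (x : R), 0 < x ->
        (P [set w | (x%:E < transport_cost p mu (empirical (X^~ w) N))%E] <=
         (C * (expR (- (c * N%:R * rate d p x)) * (x <= 1)%R%:R +
               expR (- (c * N%:R * x `^ (beta / p))) * (1 <= x)%R%:R))%:E)%E) /\
      (beta < p -> forall (N : nat) (x : R), 0 < x ->
        (P [set w | (x%:E < transport_cost p mu (empirical (X^~ w) N))%E] <=
         (C * (expR (- (c * N%:R * rate d p x)) * (x <= 1)%R%:R +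
               expR (- (c * (N%:R * x) `^ (beta / p)))))%:E)%E)].
Proof.
pose E0 := Num.max 1 E.
have E01 : 1 <= E0 by rewrite le_max lexx.
have HE0 (mu : probability (Rd R d) R) :
    (\int[mu]_y (expR (a * enorm (y : 'rV[R]_d) `^ beta))%:E = E%:E)%E ->
    int_le mu (fun y : Rd R d => expR (a * enorm (y : 'rV[R]_d) `^ beta)) E0.
  move=> HE; split => [|y|]; [|exact: expR_ge0|].
    apply: measurableT_comp => //; apply: measurable_funM => //.
    exact: (measurableT_comp (measurable_powR beta) (@measurable_enorm R d)).
  by rewrite HE lee_fin le_max lexx orbT.
set r := beta / p; have r0 : 0 < r by exact: divr_gt0.
have rate1 : 0 < rate d p 1 by exact: rate_gt0.
have [pb|bp] := leP p beta.
  have [c1 [C1 [c10 C10 H1]]] := deviation_light_small d_ge1 p_gt0 a_gt0 beta_gt0 E01 pb.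
  have [x0 [c2 [x01 c20 H2]]] := deviation_light_large d p_gt0 a_gt0 beta_gt0 E01 pb.
  have x0r : 0 < x0 `^ r by apply: powR_gt0; exact: lt_le_trans x01.
  have [c [c0 cc1 cc2 cc3]] : exists c, [/\ 0 < c, c <= c1, c <= c2 & c * x0 `^ r <= c1 * rate d p 1].
    exists (Num.min c1 (Num.min c2 (c1 * rate d p 1 / x0 `^ r))); split.
    - by rewrite !lt_min c10 c20 divr_gt0// mulr_gt0.
    - by rewrite ge_min lexx.
    - by rewrite !ge_min lexx orbT.
    - by rewrite -ler_pdivlMr// !ge_min lexx !orbT.
  exists c, (C1 + 1); split => //; first by rewrite addr_gt0.
  move=> mu /HE0 HE disp Omega P X iidX; split => [_|]; last by [].
  move=> N x xp; have CC : 0 <= C1 by exact: ltW.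
  have mX i : measurable_fun setT (X i) by exact: measurable_funPT.
  have mT y : measurable [set w | (y%:E < transport_cost p mu (empirical (X^~ w) N))%E].
    exact: (measurable_transport_gt p_gt0 mu mX).
  case: N mT => [|N] mT.
    apply: (le_trans (probability_le1 _ (mT x))); rewrite lee_fin mulr0 !mul0r oppr0 expR0 !mul1r.
    by case: (leP x 1) => h; case: (leP 1 x) => h' //=; lra.
  have NR : 0 < N.+1%:R :> R by rewrite ltr0n.
  have [x1|x1] := leP x 1.
    apply: (le_trans (H1 _ _ _ P X N.+1 x HE iidX (And3 isT xp x1))); rewrite lee_fin.
    rewrite mulr1 mulrDr -[leLHS]addr0; apply: lerD; last first.
      by rewrite !mulr_ge0 ?expR_ge0// addr_ge0.
    apply: expR_bound_le; rewrite ?lerDl// -!mulrA.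
    by apply: ler_wpM2r => //; rewrite mulr_ge0 ?(ltW NR)// ltW// rate_gt0.
  rewrite mulr0 add0r (ltW x1) mulr1.
  have [x0x|xx0] := leP x0 x.
    apply: (le_trans (H2 _ _ _ P X N.+1 x HE iidX (conj isT x0x))).
    rewrite lee_fin -[leLHS]mul1r; apply: expR_bound_le; rewrite ?lerDr//.
    by rewrite -!mulrA; apply: ler_wpM2r => //; rewrite mulr_ge0 ?powR_ge0 ?(ltW NR).
  apply: (@le_trans _ _ (P [set w | (1%:E < transport_cost p mu (empirical (X^~ w) N.+1))%E])).
    apply: le_measure; rewrite ?inE; [exact: mT|exact: mT|].
    by move=> w /=; apply: lt_trans; rewrite lte_fin.
  apply: (le_trans (H1 _ _ _ P X N.+1 1 HE iidX (And3 isT ltr01 (lexx _)))); rewrite lee_fin.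
  apply: expR_bound_le; rewrite ?lerDl// !(mulrAC _ N.+1%:R); apply: ler_wpM2r; first exact: ltW.
  apply: le_trans cc3; apply: ler_wpM2l; first exact: ltW.
  by apply: ge0_ler_powR; rewrite ?nnegrE ?(ltW r0) ?(ltW xp) ?(ltW xx0)// (le_trans _ x01).
have [c1 [C1 [c10 C10 H1]]] := deviation_heavy_small d_ge1 p_gt0 a_gt0 beta_gt0 E01 bp.
have [x0 [c2 [C2 [x01 c20 C20 H2]]]] := deviation_heavy_large d p_gt0 a_gt0 beta_gt0 E01 bp.
have x0r : 0 < x0 `^ r by apply: powR_gt0; exact: lt_le_trans x01.
have r1 : r <= 1 by rewrite ler_pdivrMr// mul1r ltW.
have [c [c0 cc1 cc2 [cc3 cc4]]] : exists c, [/\ 0 < c, c <= c1, c <= c2 &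
    c * x0 `^ r <= c1 * rate d p 1 /\ c * x0 `^ r <= c1].
  exists (Num.min (Num.min c1 c2) (Num.min (c1 * rate d p 1 / x0 `^ r) (c1 / x0 `^ r))); split.
  - by rewrite !lt_min c10 c20 !divr_gt0// mulr_gt0.
  - by rewrite !ge_min lexx.
  - by rewrite !ge_min lexx orbT.
  - by split; rewrite -ler_pdivlMr// !ge_min lexx !orbT.
exists c, (2 * C1 + C2 + 1); split => //; first by rewrite !addr_gt0// mulr_gt0.
move=> mu /HE0 HE disp Omega P X iidX; split => [|_]; first by [].
move=> N x xp; have CC : 0 <= C1 by exact: ltW.
have mX i : measurable_fun setT (X i) by exact: measurable_funPT.
have mT y : measurable [set w | (y%:E < transport_cost p mu (empirical (X^~ w) N))%E].
  exact: (measurable_transport_gt p_gt0 mu mX).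
case: N mT => [|N] mT.
  apply: (le_trans (probability_le1 _ (mT x))); rewrite lee_fin mulr0 !mul0r powR0 ?gt_eqF//.
  rewrite mulr0 oppr0 expR0 mul1r; have : 0 <= (x <= 1)%R%:R :> R by [].
  move: (_%:R) => b b0; have h : 0 <= (2 * C1 + C2 + 1) * b by rewrite !mulr_ge0// !addr_ge0// ?mulr_ge0// ltW.
  by rewrite mulrDr mulr1; lra.
have NR : 0 < N.+1%:R :> R by rewrite ltr0n.
have [x1|x1] := leP x 1.
  apply: (le_trans (H1 _ _ _ P X N.+1 x HE iidX (And3 isT xp x1))); rewrite lee_fin.
  have C1C : C1 <= 2 * C1 + C2 + 1 by lra.
  rewrite mulr1 !mulrDr; apply: lerD; apply: expR_bound_le => //.
    rewrite -!mulrA; apply: ler_wpM2r => //; rewrite mulr_ge0 ?(ltW NR)// ltW//; exact: rate_gt0.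
  by apply: ler_wpM2r => //; exact: powR_ge0.
rewrite mulr0 add0r.
have [x0x|xx0] := leP x0 x.
  apply: (le_trans (H2 _ _ _ P X N.+1 x HE iidX (conj isT x0x))).
  rewrite lee_fin; apply: expR_bound_le; [exact: ltW|lra|].
  by apply: ler_wpM2r => //; exact: powR_ge0.
apply: (@le_trans _ _ (P [set w | (1%:E < transport_cost p mu (empirical (X^~ w) N.+1))%E])).
  apply: le_measure; rewrite ?inE; [exact: mT|exact: mT|].
  by move=> w /=; apply: lt_trans; rewrite lte_fin.
apply: (le_trans (H1 _ _ _ P X N.+1 1 HE iidX (And3 isT ltr01 (lexx _)))); rewrite lee_fin.
have xr : (N.+1%:R * x) `^ r <= N.+1%:R `^ r * x0 `^ r.
  rewrite powRM ?(ltW NR) ?(ltW xp)// ler_wpM2l ?powR_ge0//.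
  by apply: ge0_ler_powR; rewrite ?nnegrE ?(ltW r0) ?(ltW xp) ?(ltW xx0)// (le_trans _ x01).
have Nr0 : 0 <= N.+1%:R `^ r :> R by exact: powR_ge0.
have Nr : N.+1%:R `^ r <= N.+1%:R :> R.
  by rewrite -[leRHS]powRr1 ?(ltW NR)//; apply: ler_powR => //; rewrite ler1n.
have cx : c * (N.+1%:R * x) `^ r <= N.+1%:R `^ r * (c * x0 `^ r).
  by rewrite mulrCA; apply: ler_wpM2l => //; exact: ltW.
apply: (@le_trans _ _ ((C1 + C1) * expR (- (c * (N.+1%:R * x) `^ r)))); last first.
  by apply: expR_bound_le => //; [exact: addr_ge0|lra].
rewrite mulrDl mulrDr; apply: lerD; apply: expR_bound_le => //; apply: (le_trans cx).
  rewrite mulrAC mulrC; apply: ler_pM => //; first by rewrite mulr_ge0 ?powR_ge0 ?(ltW c0).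
by rewrite mulr1 mulrC; apply: ler_wpM2r.
Qed.
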